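(* Let $N\ge 1$, $\beta\in(0,1)$ and $\vec a=(a_1<\ldots<a_N)\in\mathbb{W}^N$. The noncolliding Bernoulli random walk $\vec X(t)$ with parameter $\beta$ started from $\vec X(0)=\vec a$ is determinantal: for any $k\ge1$ and any pairwise distinct space-time points $(t_i,y_i)\in\mathbb{Z}_{\ge1}\times\mathbb{Z}$, $i=1,\ldots,k$, $$\mathbb{P}\big(\vec X(t_i)\text{ contains the point }y_i\text{ for all }i=1,\ldots,k\big)=\det\big[K^{\mathrm{Bernoulli}}_{\vec a;\beta}(t_i,y_i;t_j,y_j)\big]_{i,j=1}^{k},$$ where for $x_1,x_2\in\mathbb{Z}$ and $t_1,t_2\in\mathbb{Z}_{\ge1}$ $$K^{\mathrm{Bernoulli}}_{\vec a;\beta}(t_1,x_1;t_2,x_2)=\mathbf{1}_{x_1\ge x_2}\mathbf{1}_{t_1>t_2}(-1)^{x_1-x_2+1}\binom{t_1-t_2}{x_1-x_2}$$ $$+\frac{t_1!}{(t_2-1)!}\frac{1}{(2\pi \mathrm{i})^2}\int_{x_2-t_2+\frac12-\mathrm{i}\infty}^{x_2-t_2+\frac12+\mathrm{i}\infty}dz\oint dw\,\frac{(z-x_2+1)_{t_2-1}}{(w-x_1)_{t_1+1}}\frac{1}{w-z}\frac{\sin(\pi w)}{\sin(\pi z)}\left(\frac{1-\beta}{\beta}\right)^{w-z}\prod_{r=1}^{N}\frac{z-a_r}{w-a_r}.$$ Here the $z$ contour is the straight vertical line $\Re z=x_2-t_2+\frac12$ traversed upwards, and the $w$ contour is a positively (counter-clockwise)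 oriented circle or a union of two circles (depending on the ordering of $t_1,x_1,t_2,x_2$) encircling all the $w$ poles $\{x_1-t_1,x_1-t_1+1,\ldots,x_1\}\cap\{a_1,\ldots,a_N\}$ of the integrand, except the pole $w=z$ (i.e. the $w$ contour does not meet the $z$ contour and does not encircle $w=z$).
   Context: $\mathbb{W}^N=\{(x_1,\ldots,x_N)\in\mathbb{Z}^N: x_1<x_2<\ldots<x_N\}$; $|\vec x|=x_1+\ldots+x_N$; $\mathsf{V}(\vec x)=\prod_{1\le j<i\le N}(x_i-x_j)$. The noncolliding Bernoulli random walk with parameter $\beta\in(0,1)$ is the time-homogeneous Markov chain $\vec X(t)$, $t\in\mathbb{Z}_{\ge0}$, on $\mathbb{W}^N$ with transition probabilities $$\mathbb{P}(\vec X(t+1)=\vec x'\mid\vec X(t)=\vec x)=\frac{\mathsf{V}(\vec x')}{\mathsf{V}(\vec x)}\beta^{|\vec x'|-|\vec x|}(1-\beta)^{N-|\vec x'|+|\vec x|}$$ if $x_i'-x_i\in\{0,1\}$ for all $i$, and $0$ otherwise. A state $\vec x\in\mathbb{W}^N$ is identified with the $N$-point set $\{x_1,\dots,x_N\}\subset\mathbb{Z}$. Notation: $(z)_k=\Gamma(z+k)/\Gamma(z)=z(z+1)\cdots(z+k-1)$; $\binom{k}{a}=(-1)^a(-k)_a/a!$ for $k,a\in\mathbb{Z}_{\ge0}$; $\mathbf 1_A$ is an indicator; $\mathrm{i}=\sqrt{-1}$. *)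

(* Defs.v *)
From HB Require Import structures.
From mathcomp Require Import all_boot all_order all_algebra.
From mathcomp Require Import all_classical all_reals all_analysis.
From mathcomp Require Import complex.

Set Implicit Arguments.
Unset Strict Implicit.
Unset Printing Implicit Defensive.

Import Order.TTheory GRing.Theory Num.Theory.
Local Open Scope classical_set_scope.
Local Open Scope ring_scope.
Local Open Scope complex_scope.

Section MarkovChain.
Context (R : realType) (d : measure_display) (T : measurableType d).
Variable P : probability T R.

Definition cond_prob (A B : set T) : R := fine (P (A `&` B)) / fine (P B).

Variables (S : Type) (X : nat -> T -> S) (p : S -> S -> R).

Definition history (t : nat) (h : nat -> S) : set T :=
  [set w | forall s, (s <= t)%N -> X s w = h s].

(* [S] is meant to be countable and carries the discrete sigma-algebra. *)
Definition markov_chain : Prop :=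
  (forall t (A : set S), measurable (X t @^-1` A)) /\
  (forall t (h : nat -> S) (x' : S), P (history t h) != 0%E ->
     cond_prob [set w | X t.+1 w = x'] (history t h) = p (h t) x').

End MarkovChain.

Definition strictly_increasing N (x : {ffun 'I_N -> int}) : bool :=
  [forall i : 'I_N, forall j : 'I_N, (i < j)%N ==> (x i < x j)].

Record weyl (N : nat) := Weyl {
  coords :> {ffun 'I_N -> int};
  coords_incr : strictly_increasing coords }.

HB.instance Definition _ N := [isSub for @coords N].
HB.instance Definition _ N := [Countable of weyl N by <:].

Section Walk.
Context (N : nat).
Implicit Types x : weyl N.

Definition total x : int := \sum_(i < N) x i.

Definition vandermonde x : int :=
  \prod_(i < N) \prod_(j < N | (j < i)%N) (x i - x j).

Definition occupies x (y : int) : Prop := exists i : 'I_N, x i = y.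

Definition bernoulli_step (R : realType) (beta : R) x x' : R :=
  if [forall i : 'I_N, (x' i - x i == 0) || (x' i - x i == 1)]
  then (vandermonde x')%:~R / (vandermonde x)%:~R
       * beta ^ (total x' - total x)
       * (1 - beta) ^ (N%:Z - total x' + total x)
  else 0.

Definition noncolliding_bernoulli_walk (R : realType) (d : measure_display)
    (T : measurableType d) (P : probability T R) (beta : R) (a : weyl N)
    (X : nat -> T -> weyl N) : Prop :=
  markov_chain P X (bernoulli_step beta) /\ P [set w | X 0%N w = a] = 1%E.

End Walk.

Section ComplexFunctions.
Context (R : realType).
Implicit Types z w : R[i].

Definition cexp z : R[i] :=
  (expR (complex.Re z))%:C * (cos (complex.Im z) +i* sin (complex.Im z)).

Definition csin z : R[i] := (cexp ('i%C * z) - cexp (- ('i%C * z))) / (2 * 'i%C).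

(* [rpow r z] is r^z for a real base r > 0. *)
Definition rpow (r : R) z : R[i] := cexp (z * (ln r)%:C).

Definition pochhammer z (k : nat) : R[i] := \prod_(i < k) (z + i%:R).

Definition cintegral (D : set R) (f : R -> R[i]) : R[i] :=
  (\int[lebesgue_measure]_(s in D) complex.Re (f s))
    +i* (\int[lebesgue_measure]_(s in D) complex.Im (f s)).

Definition vline_integral (c : R) (f : R[i] -> R[i]) : R[i] :=
  cintegral setT (fun s => f (c +i* s) * 'i%C).

Definition circle_integral (c : R[i]) (r : R) (f : R[i] -> R[i]) : R[i] :=
  cintegral `[0, 2 * pi]
    (fun s => f (c + r%:C * cexp ('i%C * s%:C)) * (r%:C * 'i%C * cexp ('i%C * s%:C))).

(* A finite union of positively oriented circles, as (center, radius) pairs. *)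
Definition circles : Type := seq (R[i] * R).

Definition circles_integral (g : circles) (f : R[i] -> R[i]) : R[i] :=
  \sum_(cr <- g) circle_integral cr.1 cr.2 f.

Definition cdisk (cr : R[i] * R) : set R[i] := [set w | `|w - cr.1| <= cr.2%:C].
Definition odisk (cr : R[i] * R) : set R[i] := [set w | `|w - cr.1| < cr.2%:C].

End ComplexFunctions.

Section Kernel.
Context (R : realType) (N : nat) (a : weyl N) (beta : R).
Implicit Types (t : nat) (x : int).

Definition zline (t2 : nat) (x2 : int) : R := (x2 - t2%:Z)%:~R + 2^-1.

(* The other zeros of the denominator in w are cancelled by sin (pi w), so
   these and w = z are the only poles. *)
Definition wpole (t1 : nat) (x1 : int) (p : int) : Prop :=
  x1 - t1%:Z <= p <= x1 /\ occupies a p.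

(* Disjointness of the closed disks makes each pole be encircled exactly once;
   the condition on the line Re z = zline keeps w = z off and outside the
   contour. *)
Definition admissible_wcontour t1 x1 t2 x2 (g : circles R) : Prop :=
  [/\ (0 < size g <= 2)%N,
      (forall cr, cr \in g -> 0 < cr.2),
      (forall i j, (i < j < size g)%N ->
         cdisk (nth (0, 0) g i) `&` cdisk (nth (0, 0) g j) = set0),
      (forall cr (z : R[i]), cr \in g -> complex.Re z = zline t2 x2 -> ~ cdisk cr z) &
      (forall p, wpole t1 x1 p ->
         exists2 cr, cr \in g & odisk cr (p%:~R : R[i]))].

Definition bernoulli_integrand t1 x1 t2 x2 (z w : R[i]) : R[i] :=
  pochhammer (z - x2%:~R + 1) (t2 - 1) / pochhammer (w - x1%:~R) t1.+1
  * (1 / (w - z))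
  * (csin (pi%:C * w) / csin (pi%:C * z))
  * rpow ((1 - beta) / beta) (w - z)
  * \prod_(r < N) ((z - (a r)%:~R) / (w - (a r)%:~R)).

Definition bernoulli_kernel (g : circles R) t1 x1 t2 x2 : R[i] :=
  (if (x2 <= x1) && (t2 < t1)%N
   then (-1) ^ (x1 - x2 + 1) * ('C(t1 - t2, `|x1 - x2|%N))%:R
   else 0)
  + (t1`!)%:R / ((t2 - 1)`!)%:R
    * (1 / (2 * pi%:C * 'i%C) ^+ 2)
    * vline_integral (zline t2 x2) (fun z =>
        circles_integral g (bernoulli_integrand t1 x1 t2 x2 z)).

End Kernel.

(* Main.v *)
(* The walk is the transform by the Vandermonde determinant V of N independent
   Bernoulli walks.  Let S be the one-step operator p |-> (1 - b) p(x) + b p(x+1);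
   it is invertible on polynomials of degree < N, and H_(t,j) denotes S^(-t)
   applied to the j-th Lagrange polynomial of the nodes a_i.  Since
   det [H_(t,j)(x_i)] = V(x) / V(a) for every t, the expectation of
   prod_z (1 + c 1[y_z occupied at time t_z]) is an N x N determinant, which
   Duhamel's formula and Sylvester's identity turn into det (1 + c K) with
     K(t1,x1;t2,x2) = - 1[t2 < t1] p_(t1-t2)(x2,x1) + sum_j p_t1(a_j,x1) H_(t2,j)(x2).

   In the double integral, partial fractions and Cauchy's formula reduce the
   w-integral to sum_j p_t1(a_j,x1) times the j-th Lagrange polynomial in z.
   For the z-integral, the integrals along Re z = m - 1/2 and Re z = m + 1/2 add
   up to a residue at m: for f with the pole removed, the integral of
   f(m + x + is) - f(m - x + is) over s does not depend on x in (0,1) and tends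
   to 0 as x tends to 0.  Hence the
   z-integral inverts t2 steps of S, and the kernel of the theorem is K up to
   conjugation by a function of (t,x). *)

Require Import Defs.
From mathcomp Require Import all_boot all_order all_algebra perm.
From mathcomp Require Import all_classical all_reals all_analysis.
From mathcomp Require Import measurable_realfun complex ring lra zify.

Set Implicit Arguments.
Unset Strict Implicit.
Unset Printing Implicit Defensive.

Import Order.TTheory GRing.Theory Num.Theory.
Local Open Scope ring_scope.

(** * Determinants and polynomials *)

(** The products of $1+c\,\mathbf 1[\ldots]$ are taken because they are multiplicative over
    particles: a particle meets at most one of the distinct points at a given time, and a point is
    met by at most one particle. Every step of the walk then remains a determinant of one-particle
    quantities.

    In the $w$-integral an admissible circle may run through integers where the integrand has a
    removable singularity and its formula, with $0^{-1}=0$, takes a default value. Off finitely many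
    points it is therefore replaced by Cauchy kernels $F(w)/(w-q)$ plus pole-free terms, the sine
    entering only through $\sin(\pi(w-p))/(w-p)$. Where a zero of $(w-x_1)_{t_1+1}$ meets some
    $a_k$, the double pole loses one order to the sine; the other poles at integers cancel.

    With $\rho=(1-\beta)/\beta$, the conjugating function is $(-1)^x\rho^x(1-\beta)^{-t}$: the sign
    comes from the integer shifts of the sine, $\rho^x$ from the power, and $(1-\beta)^{-t}$ from
    reducing a $t$-step transition probability to a binomial coefficient. *)

Section Lagrange.
Context {F : fieldType} (n : nat) (p : 'I_n -> F).
Hypothesis pI : injective p.

Definition lagrange_poly (i : 'I_n) : {poly F} :=
  (\prod_(j | j != i) (p i - p j)^-1) *: \prod_(j | j != i) ('X - (p j)%:P).

Lemma lagrange_poly_at i k : (lagrange_poly i).[p k] = (i == k)%:R.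
Proof.
rewrite /lagrange_poly hornerZ horner_prod; case: eqVneq => [<-|ik].
  rewrite -big_split big1//= => j jk.
  by rewrite hornerXsubC mulVf// subr_eq0; apply: contra jk => /eqP/pI ->.
rewrite [X in _ * X](bigD1 k)/=; last by rewrite eq_sym.
by rewrite hornerXsubC subrr mul0r mulr0.
Qed.

Lemma size_lagrange_poly i : (size (lagrange_poly i) <= n)%N.
Proof.
rewrite (leq_trans (size_scale_leq _ _))// (leq_trans (size_poly_prod_leq _ _))//.
under eq_bigr do rewrite size_XsubC.
rewrite sum_nat_const.
have -> : #|[pred j | j != i]| = n.-1 by rewrite cardC1 card_ord.
by case: n i => [[]//|m _] /=; lia.
Qed.

Lemma sum_lagrange_poly : (0 < n)%N -> \sum_i lagrange_poly i = 1.
Proof.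
move=> n0; apply/eqP; rewrite -subr_eq0; apply/eqP.
apply: (@roots_geq_poly_eq0 _ _ (codom p)).
- apply/allP => _ /codomP[k ->]; rewrite rootE hornerD hornerN hornerC horner_sum.
  rewrite (bigD1 k)//= lagrange_poly_at eqxx big1 ?addr0 ?subrr// => i ik.
  by rewrite lagrange_poly_at (negbTE ik).
- by rewrite map_inj_uniq ?enum_uniq.
- rewrite size_codom card_ord (leq_trans (size_polyD _ _))// geq_max size_polyN size_poly1 n0 andbT.
  apply: (leq_trans (size_sum _ _ _)); apply/bigmax_leqP => i _; exact: size_lagrange_poly.
Qed.

(** The Lagrange polynomials sum to 1; evaluating this at $w$ and dividing by $\prod_i(w-p_i)$ gives
    the expansion. *)
Lemma partial_fractions (w : F) : (0 < n)%N -> (forall i, w != p i) ->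
  \prod_i (w - p i)^-1 = \sum_i (\prod_(j | j != i) (p i - p j)^-1) * (w - p i)^-1.
Proof.
move=> n0 wp; have w0 i : w - p i != 0 by rewrite subr_eq0.
have := congr1 (fun f : {poly F} => f.[w]) (sum_lagrange_poly n0).
rewrite hornerC horner_sum => h.
rewrite -[LHS]mul1r; transitivity ((\sum_i (lagrange_poly i).[w]) * \prod_i (w - p i)^-1).
  by rewrite h.
rewrite big_distrl /=; apply: eq_bigr => i _.
rewrite /lagrange_poly hornerZ horner_prod -mulrA; congr (_ * _).
have -> : \prod_j (w - p j)^-1 = (w - p i)^-1 * \prod_(j | j != i) (w - p j)^-1 by rewrite (bigD1 i).
rewrite mulrCA -big_split big1 ?mulr1//= => j ij.
by rewrite hornerXsubC mulfV.
Qed.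
End Lagrange.

Section DetLemmas.
Context {F : comUnitRingType}.

(** Multilinearity in the rows. In the walk, [B] is the pair of moves of one particle, so the sum
    runs over the joint moves of independent walkers. *)
Lemma det_sum_rows (B : finType) n (M : 'I_n -> B -> 'I_n -> F) :
  \det (\matrix_(i, j) \sum_e M i e j) =
  \sum_(e : {ffun 'I_n -> B}) \det (\matrix_(i, j) M i (e i) j).
Proof.
rewrite /determinant exchange_big /=; apply: eq_bigr => s _.
rewrite -big_distrr /=; congr (_ * _).
under eq_bigr do rewrite mxE.
rewrite bigA_distr_bigA; apply: eq_bigr => e _.
by apply: eq_bigr => i _; rewrite mxE.
Qed.

Lemma det_row_scale n (u : 'I_n -> F) (M : 'I_n -> 'I_n -> F) :
  \det (\matrix_(i, j) (u i * M i j)) = (\prod_i u i) * \det (\matrix_(i, j) M i j).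
Proof.
have -> : \matrix_(i, j) (u i * M i j) = diag_mx (\row_i u i) *m \matrix_(i, j) M i j.
  by apply/matrixP => i j; rewrite mul_diag_mx !mxE.
by rewrite det_mulmx det_diag; congr (_ * _); apply: eq_bigr => i _; rewrite mxE.
Qed.

(** The block matrix with rows $(1,-A)$ and $(B,1)$ has two block triangular factorisations, one for
    each side. *)
Lemma sylvester_det m n (A : 'M[F]_(m, n)) (B : 'M[F]_(n, m)) :
  \det (1%:M + A *m B) = \det (1%:M + B *m A).
Proof.
have h1 : block_mx 1%:M (- A) B 1%:M = block_mx 1%:M 0 B 1%:M *m block_mx 1%:M (- A) 0 (1%:M + B *m A).
  rewrite mulmx_block !mul1mx !mul0mx ?mulmx0 !addr0 mulmx1 mulmxN.
  by congr block_mx; rewrite addrCA addNr addr0.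
have h2 : block_mx 1%:M (- A) B 1%:M = block_mx (1%:M + A *m B) (- A) 0 1%:M *m block_mx 1%:M 0 B 1%:M.
  rewrite mulmx_block !mulmx1 !mul1mx !mul0mx ?mulmx0 !add0r mulNmx.
  by rewrite -addrA subrr addr0.
have := congr1 determinant h1; rewrite h2 !det_mulmx !det_ublock !det_lblock !det1 !mul1r !mulr1.
by [].
Qed.

(** A permutation $s$ with nonzero contribution satisfies $t_i<t_{s(i)}$ at each point it moves;
    since $\sum_i t_{s(i)}=\sum_i t_i$, it moves none. The indices come in no particular time order,
    so [W] is strictly triangular only after relabelling. *)
Lemma det_one_plus_strict n (t : 'I_n -> nat) (W : 'M[F]_n) :
  (forall i j, ~~ (t i < t j)%N -> W i j = 0) -> \det (1%:M + W) = 1.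
Proof.
move=> W0; rewrite /determinant (bigD1 (1%g : {perm 'I_n}))//= [X in _ + X]big1 ?addr0.
  rewrite odd_perm1 expr0 mul1r big1// => i _.
  by rewrite perm1 !mxE eqxx W0 ?ltnn// addr0.
move=> s s1; have [i si] : exists i, ~~ ((s i == i) || (t i < t (s i))%N).
  apply/existsP; rewrite -negb_forall; apply: contra s1 => /forallP h.
  have ts i : (t i <= t (s i))%N by have /orP[/eqP->|/ltnW] := h i.
  have St : (\sum_i t (s i) = \sum_i t i)%N by rewrite [RHS](reindex_inj (@perm_inj _ s)).
  have te i : t i = t (s i).
    apply/eqP; rewrite eqn_leq ts /=.
    move: St; rewrite (bigD1 i)//= [RHS](bigD1 i)//=.
    have := @leq_sum _ (index_enum 'I_n) (fun j => j != i) (fun j => t j) (fun j => t (s j)) (fun j _ => ts j).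
    by move=> h1 h2; rewrite -(leq_add2r (\sum_(i0 < n | i0 != i) t (s i0))) h2 leq_add2l.
  apply/eqP/permP => i; rewrite perm1.
  by have /orP[/eqP//|] := h i; rewrite te ltnn.
move: si; rewrite negb_or => /andP[si ti].
by rewrite (bigD1 i)//= !mxE W0// eq_sym (negbTE si) addr0 mul0r mulr0.
Qed.

End DetLemmas.

Section PolyLemmas.
Context {F : numFieldType}.

(** The integers $1,2,\ldots$ supply enough roots. The value 0 is left out because the identity to
    be extended is proved with $c=d^{-1}$. *)
Lemma poly_eq0_nonzero (p : {poly F}) : (forall d, d != 0 -> p.[d] = 0) -> p = 0.
Proof.
move=> h; apply: (@roots_geq_poly_eq0 _ p [seq i.+1%:R | i <- iota 0 (size p)]).
- by apply/allP => _ /mapP[i _ ->]; rewrite rootE h// pnatr_eq0.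
- by rewrite map_inj_uniq ?iota_uniq// => i j /eqP; rewrite eqr_nat => /eqP[].
- by rewrite size_map size_iota.
Qed.

Definition monic_deg (q : nat -> {poly F}) := forall k, q k \is monic /\ size (q k) = k.+1.

(** The coefficient matrix is unitriangular, so only the Vandermonde factor remains. *)
Lemma det_monic n (q : nat -> {poly F}) (x : 'I_n -> F) : monic_deg q ->
  \det (\matrix_(i < n, j < n) (q j).[x i]) = \prod_(i < n) \prod_(j < n | (j < i)%N) (x i - x j).
Proof.
move=> qm.
pose V := Vandermonde n (\row_i x i).
pose U : 'M[F]_n := \matrix_(j, k) (q j)`_k.
have E : \matrix_(i < n, j < n) (q j).[x i] = (U *m V)^T.
  apply/matrixP => i j; rewrite !mxE (@horner_coef_wide _ n); last by rewrite (qm j).2.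
  by apply: eq_bigr => k _; rewrite !mxE.
rewrite E det_tr det_mulmx.
have -> : \det U = 1.
  rewrite det_trig; last first.
    by apply/is_trig_mxP => i j ij; rewrite mxE nth_default// (qm i).2.
  rewrite big1// => i _; rewrite mxE.
  by have [/monicP m s] := qm i; rewrite -[RHS]m lead_coefE s.
rewrite mul1r det_Vandermonde.
rewrite (exchange_big_dep predT)//=; apply: eq_bigr => i _; apply: eq_bigr => j _.
by rewrite !mxE.
Qed.

(** The constant is the determinant of the coefficient matrix. It does not depend on the points, so
    one convenient configuration determines it. *)
Lemma det_poly_family n (P : 'I_n -> {poly F}) : (forall j, (size (P j) <= n)%N) ->
  exists k : F, forall x : 'I_n -> F,
  \det (\matrix_(i < n, j < n) (P j).[x i]) = k * \prod_(i < n) \prod_(j < n | (j < i)%N) (x i - x j).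
Proof.
move=> sP; exists (\det (\matrix_(j, k) (P j)`_k : 'M[F]_n)) => x.
have qm : monic_deg (fun k => 'X^k) by move=> k; rewrite monicXn size_polyXn.
rewrite -(det_monic x qm).
have -> : \matrix_(i < n, j < n) (P j).[x i] = ((\matrix_(j, k) (P j)`_k :
    'M[F]_n) *m (\matrix_(i < n, j < n) ('X^j).[x i])^T)^T.
  apply/matrixP => i j; rewrite !mxE (@horner_coef_wide _ n)//.
  by apply: eq_bigr => k _; rewrite !mxE hornerXn.
by rewrite det_tr det_mulmx det_tr.
Qed.

(* One step of a single Bernoulli walk, acting on polynomial observables. *)
Definition step_poly (b : F) (p : {poly F}) := (1 - b) *: p + b *: (p \Po ('X + 1%:P)).

Lemma size_shift_sub (p : {poly F}) : (size (p \Po ('X + 1%:P) - p)%R <= (size p).-1)%N.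
Proof.
elim/poly_ind: p => [|p c IH]; first by rewrite comp_poly0 subr0 size_poly0.
have [->|p0] := eqVneq p 0.
  by rewrite mul0r add0r comp_polyC subrr size_poly0.
(* Discrete Leibniz rule for $\Delta f=f(\cdot+1)-f$. *)
have -> : (p * 'X + c%:P) \Po ('X + 1%:P) - (p * 'X + c%:P) =
  (p \Po ('X + 1%:P) - p) * 'X + (p \Po ('X + 1%:P)).
  by rewrite comp_polyD comp_polyM comp_polyX comp_polyC; ring.
rewrite size_MXaddC (negbTE p0) /=.
rewrite (leq_trans (size_polyD _ _))// geq_max size_comp_poly2 ?size_XaddC// leqnn andbT.
have [->|d0] := eqVneq (p \Po ('X + 1%:P) - p) 0; first by rewrite mul0r size_poly0.
rewrite size_mulX// (leq_ltn_trans IH)// prednK ?size_poly_gt0//.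
Qed.

Lemma step_poly_monic b : monic_deg (fun k => step_poly b 'X^k).
Proof.
have E k : step_poly b 'X^k = 'X^k + b *: ('X^k \Po ('X + 1%:P) - 'X^k).
  by rewrite /step_poly scalerBl scale1r scalerBr -addrA; congr (_ + _); rewrite addrC.
have lt k : (size (b *: ('X^k \Po ('X + 1%:P) - 'X^k)%R) < size ('X^k : {poly F}))%N.
  rewrite size_polyXn ltnS (leq_trans (size_scale_leq _ _))//.
  by have := size_shift_sub 'X^k; rewrite size_polyXn.
move=> k; rewrite E; split; last by rewrite size_polyDl// size_polyXn.
by rewrite monicE lead_coefDl// lead_coefXn.
Qed.

(** The operator is $1+b\Delta$ and $\Delta$ lowers the degree, so the error $f-Sf$ falls under the
    induction hypothesis, and a preimage of the error corrects $f$ itself. *)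
Lemma step_poly_onto b n (f : {poly F}) : (size f <= n)%N ->
  exists2 g, step_poly b g = f & (size g <= n)%N.
Proof.
elim: n f => [|n IH] f.
  by rewrite leqn0 size_poly_eq0 => /eqP->; exists 0; rewrite ?size_poly0// /step_poly comp_poly0 !scaler0 addr0.
move=> sf.
have E p : step_poly b p = p + b *: (p \Po ('X + 1%:P) - p).
  by rewrite /step_poly scalerBl scale1r scalerBr -addrA; congr (_ + _); rewrite addrC.
have s1 : (size (f - step_poly b f)%R <= n)%N.
  rewrite E opprD addrA subrr sub0r size_polyN (leq_trans (size_scale_leq _ _))//.
  by rewrite (leq_trans (size_shift_sub f))// -subn1 leq_subLR add1n.
have [g gf sg] := IH _ s1.
exists (f + g); last by rewrite (leq_trans (size_polyD _ _))// geq_max sf ltnW.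
have stepD p q : step_poly b (p + q) = step_poly b p + step_poly b q.
  by rewrite /step_poly comp_polyD !scalerDr addrACA.
by rewrite stepD gf addrC subrK.
Qed.

Lemma step_poly_horner b p x : (step_poly b p).[x] = (1 - b) * p.[x] + b * p.[x + 1].
Proof. by rewrite /step_poly hornerD !hornerZ horner_comp hornerD hornerX hornerC. Qed.

End PolyLemmas.

(** * The walk as a sum over paths *)

Section Walk.
Context {F : numFieldType} (N : nat) (b : F).
Implicit Types (x : weyl N) (e : {ffun 'I_N -> bool}).

Definition vdm x : F := (vandermonde x)%:~R.

Lemma weyl_lt x (i j : 'I_N) : (i < j)%N -> x i < x j.
Proof. by move=> ij; have /forallP/(_ i)/forallP/(_ j)/implyP := coords_incr x; apply. Qed.

Lemma weyl_inj x : injective x.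
Proof.
move=> i j xij; apply/val_inj/eqP; case: ltngtP => // /weyl_lt => /(_ x); by rewrite xij ltxx.
Qed.

Lemma vdmE x : vdm x = \prod_(i < N) \prod_(j < N | (j < i)%N) ((x i)%:~R - (x j)%:~R).
Proof.
rewrite /vdm /vandermonde rmorph_prod; apply: eq_bigr => i _.
by rewrite rmorph_prod; apply: eq_bigr => j _; rewrite rmorphB.
Qed.

Lemma vdm_neq0 x : vdm x != 0.
Proof.
rewrite vdmE; apply/prodf_neq0 => i _; apply/prodf_neq0 => j ji.
by rewrite subr_eq0 eqr_int gt_eqF// weyl_lt.
Qed.

Definition moved x e : {ffun 'I_N -> int} := [ffun i => x i + (e i : nat)%:Z].

(** A finite list, so that expectations over the countable state space become finite sums; [insub]
    discards the moves that break the strict order. *)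
Definition next_states x : seq (weyl N) :=
  pmap insub [seq moved x e | e <- enum {: {ffun 'I_N -> bool}}].

Definition jump (e : bool) : F := if e then b else 1 - b.

(** [bernoulli_step] with one factor per particle, the form that can be absorbed into the rows of a
    determinant. *)
Definition step_weight x x' : F := vdm x' / vdm x * \prod_i jump (x' i != x i).

Lemma moved_inj x : injective (moved x).
Proof.
move=> e e' /ffunP h; apply/ffunP => i; have := h i; rewrite !ffunE => /addrI.
by case: (e i); case: (e' i).
Qed.

Lemma next_states_uniq x : uniq (next_states x).
Proof.
apply: (pmap_uniq (g := @coords N)) => [y|]; first exact: insubK.
by rewrite map_inj_uniq ?enum_uniq//; exact: moved_inj.
Qed.

Lemma mem_next_states x x' : (x' \in next_states x) =
  [forall i : 'I_N, (x' i - x i == 0) || (x' i - x i == 1)].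
Proof.
apply/idP/forallP => [|h].
  rewrite mem_pmap => /mapP[y /mapP[e _ ->]] hy i.
  have : x' = insubd x' (moved x e) by rewrite /insubd -hy.
  have hv : coords x' = moved x e.
    by move: hy; case: insubP => // u _ vu [->].
  by rewrite hv ffunE addrAC subrr add0r; case: (e i).
rewrite mem_pmap; apply/mapP; exists (coords x'); last by rewrite valK.
apply/mapP; exists [ffun i => x' i - x i == 1]; first by rewrite mem_enum.
apply/ffunP => i; rewrite !ffunE.
by have /orP[/eqP h1|/eqP h1] := h i; rewrite h1 /=; lia.
Qed.

(** Extends a sum over the allowed moves to all $2^N$ joint moves, provided that the summand
    vanishes at the forbidden ones. *)
Lemma next_states_sum x (G : weyl N -> F) (G' : {ffun 'I_N -> bool} -> F) :
  (forall e x', coords x' = moved x e -> G x' = G' e) ->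
  (forall e, ~~ strictly_increasing (moved x e) -> G' e = 0) ->
  \sum_(x' <- next_states x) G x' = \sum_e G' e.
Proof.
move=> h1 h2; rewrite /next_states big_pmap big_map big_enum /=.
apply: eq_bigr => e _; case: insubP => [u _ vu|] /=; first exact: h1.
by move=> /h2 ->.
Qed.

(** The Karlin-McGregor argument for one step. The factor $V(x')$ of the weight cancels the
    denominator, and the sum over allowed moves extends to all moves of independent walkers: since
    $x_i<x_j$ and steps are 0 or 1, a move that breaks the order makes two particles collide, and
    then two rows are proportional. *)
Lemma one_step x (g : int -> F) (h : 'I_N -> int -> F) :
  \sum_(x' <- next_states x) step_weight x x' *
     ((\prod_i g (x' i)) * (\det (\matrix_(i, j) h j (x' i)) / vdm x')) =
  \det (\matrix_(i, j) \sum_(e : bool) jump e * (g (x i + (e : nat)%:Z) * h j (x i + (e : nat)%:Z))) / vdm x.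
Proof.
rewrite det_sum_rows mulr_suml; apply: next_states_sum => [e x' xe|e ne].
  rewrite /step_weight.
  have xi i : x' i = x i + (e i : nat)%:Z by rewrite xe ffunE.
  have -> : \det (\matrix_(i, j) (jump (e i) * (g (x i + (e i : nat)%:Z) * h j (x i + (e i : nat)%:Z)))) =
    (\prod_i jump (x' i != x i)) * ((\prod_i g (x' i)) * \det (\matrix_(i, j) h j (x' i))).
    rewrite -det_row_scale -det_row_scale; congr (\det _); apply/matrixP => i j; rewrite !mxE.
    have -> : (x' i != x i) = e i by rewrite xi; case: (e i) => /=; lia.
    by rewrite xi.
  by field; rewrite !vdm_neq0.
rewrite (_ : \det _ = 0) ?mul0r//.
move/forallPn: ne => [i /forallPn[j]].
rewrite negb_imply => /andP[ij]; rewrite !ffunE => lt.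
have xij := weyl_lt x ij.
have E : x i + (e i : nat)%:Z = x j + (e j : nat)%:Z.
  by move: lt; case: (e i); case: (e j) => /=; lia.
have [ei ej] : e i = true /\ e j = false.
  by move: lt; case: (e i); case: (e j) => /=; lia.
pose M := \matrix_(i, j) (g (x i + (e i : nat)%:Z) * h j (x i + (e i : nat)%:Z)).
have -> : \matrix_(i, j) (jump (e i) * (g (x i + (e i : nat)%:Z) * h j (x i + (e i : nat)%:Z))) =
   \matrix_(i, j) (jump (e i) * M i j) by apply/matrixP => u v; rewrite !mxE.
rewrite (det_row_scale (fun i => jump (e i)) (fun i j => M i j)).
rewrite (_ : \det _ = 0) ?mulr0//.
apply: (@determinant_alternate _ _ _ i j); first by apply: contraTneq ij => ->; rewrite ltnn.
by move=> k; rewrite !mxE E.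
Qed.

Lemma sum_bool (G : bool -> F) : \sum_(e : bool) G e = G false + G true.
Proof. by rewrite big_bool addrC. Qed.

(** The Vandermonde determinant is harmonic for independent walkers: in [one_step] with monomials, a
    step turns $X^j$ into another monic polynomial of degree $j$, which leaves the determinant
    unchanged. *)
Lemma step_weight_sum1 x : \sum_(x' <- next_states x) step_weight x x' = 1.
Proof.
have qm := @step_poly_monic F b.
have Xm : monic_deg (fun k => 'X^k : {poly F}) by move=> k; rewrite monicXn size_polyXn.
have := one_step x (fun=> 1) (fun j y => ('X^j).[y%:~R]).
have -> : \sum_(x' <- next_states x) step_weight x x' * (\prod_(i < N) 1 * (\det (\matrix_(i < N, j < N)
    ('X^j).[(x' i)%:~R]) / vdm x')) = \sum_(x' <- next_states x) step_weight x x'.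
  apply: eq_bigr => x' _; rewrite big1// mul1r (det_monic (fun i => (x' i)%:~R) Xm) -vdmE divff ?vdm_neq0//.
  by rewrite mulr1.
move=> ->.
rewrite (_ : \matrix_(i, j) _ = \matrix_(i < N, j < N) (step_poly b 'X^j).[(x i)%:~R]).
  by rewrite (det_monic (fun i => (x i)%:~R) qm) -vdmE divff ?vdm_neq0.
apply/matrixP => i j; rewrite !mxE sum_bool /= step_poly_horner addr0 !mul1r.
by rewrite intrD.
Qed.

Section Expectation.
Variable p : weyl N -> weyl N -> F.

Definition extend_path (h : nat -> weyl N) s x' : nat -> weyl N :=
  fun u => if u == s then x' else h u.

(** The path is carried as a function of time so that the observable can read all times at once.
    Entries beyond time [s + n] keep the values of the initial [h]. *)
Fixpoint path_sum n s (h : nat -> weyl N) (f : (nat -> weyl N) -> F) : F :=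
  if n is n'.+1 then \sum_(x' <- next_states (h s)) p (h s) x' *
       path_sum n' s.+1 (extend_path h s.+1 x') f
  else f h.

Lemma eq_path_sum n s h f f' : (forall h', f h' = f' h') -> path_sum n s h f = path_sum n s h f'.
Proof.
move=> ff; elim: n s h => [|n IH] s h /=; first exact: ff.
by apply: eq_bigr => x' _; rewrite IH.
Qed.

Lemma path_sum_lin (I : Type) (l : seq I) (c : I -> F) (f : I -> (nat -> weyl N) -> F) n s h :
  path_sum n s h (fun h' => \sum_(i <- l) c i * f i h') = \sum_(i <- l) c i * path_sum n s h (f i).
Proof.
elim: n s h => [//|n IH] s h /=.
under eq_bigr do rewrite IH big_distrr /=.
rewrite exchange_big /=; apply: eq_bigr => i _; rewrite big_distrr /=.
by apply: eq_bigr => x' _; rewrite mulrCA.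
Qed.

End Expectation.
End Walk.

(** * Harmonic polynomials and the correlation determinant *)

Section Harmonic.
Context {F : numFieldType} (N : nat) (b : F) (a : weyl N).
Hypothesis N0 : (0 < N)%N.
Implicit Types (x : weyl N).

(** A preimage under [step_poly] is chosen at each time; the default 0 is never reached, by
    [step_poly_onto]. The size bound is part of the choice since it provides the next preimage and
    makes [det_poly_family] applicable. *)
Fixpoint harmonic_poly t (j : 'I_N) : {poly F} :=
  if t is t'.+1 then
    xget 0 [set g | step_poly b g = harmonic_poly t' j /\ (size g <= N)%N]%classic
  else lagrange_poly (fun i => (a i)%:~R : F) j.

Lemma size_harmonic t j : (size (harmonic_poly t j) <= N)%N.
Proof.
elim: t => [|t IH] /=; first exact: size_lagrange_poly.
have [g h1 h2] := step_poly_onto b IH.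
by have [] := @xgetPex _ 0 [set g | step_poly b g = harmonic_poly t j /\ (size g <=
    N)%N]%classic (ex_intro _ g (conj h1 h2)).
Qed.

Lemma harmonic_step t j : step_poly b (harmonic_poly t.+1 j) = harmonic_poly t j.
Proof.
have [g h1 h2] := step_poly_onto b (size_harmonic t j).
by have [] := @xgetPex _ 0 [set g | step_poly b g = harmonic_poly t j /\ (size g <=
    N)%N]%classic (ex_intro _ g (conj h1 h2)).
Qed.

Lemma harmonic_poly_at0 i j : (harmonic_poly 0 j).[(a i)%:~R] = (i == j)%:R.
Proof. by rewrite /= lagrange_poly_at 1?eq_sym// => u v /intr_inj /weyl_inj. Qed.

Arguments harmonic_poly : simpl never.

(** By degrees, the determinant is $k\,V(x)$ for some constant $k$. At time 0 the nodes $a_i$ give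
    the identity matrix, hence $k=1/V(a)$. Later, averaging the constant ratio over one step from
    $a$ with [one_step] returns the determinant of the previous time at $a$, so $k$ does not
    change. *)
Lemma det_harmonic t x : \det (\matrix_(i, j) (harmonic_poly t j).[(x i)%:~R]) = vdm x / vdm a.
Proof.
elim: t x => [|t IH] x.
  have [k hk] := det_poly_family (size_harmonic 0).
  have := hk (fun i => (a i)%:~R); rewrite -vdmE.
  have -> : \matrix_(i < N, j < N) (harmonic_poly 0 j).[(a i)%:~R] = 1%:M.
    by apply/matrixP => i j; rewrite !mxE harmonic_poly_at0.
  rewrite det1 => k1.
  rewrite (hk (fun i => (x i)%:~R)) -vdmE; apply: (mulIf (vdm_neq0 a)).
  by rewrite divfK ?vdm_neq0// mulrAC -k1 mul1r.
have [k hk] := det_poly_family (size_harmonic t.+1).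
have h := one_step b a (fun=> 1) (fun j y => (harmonic_poly t.+1 j).[y%:~R]).
rewrite (hk (fun i => (x i)%:~R)) -vdmE mulrC; congr (_ * _).
transitivity (\sum_(x' <- next_states a) step_weight b a x' * k).
  by rewrite -mulr_suml step_weight_sum1 mul1r.
transitivity (\det (\matrix_(i, j) (harmonic_poly t j).[(a i)%:~R]) / vdm a); last first.
  by rewrite IH divff ?vdm_neq0// mul1r.
rewrite (_ : \matrix_(i, j) _ = \matrix_(i < N, j < N) \sum_(e :
    bool) jump b e * (1 * (harmonic_poly t.+1 j).[(a i + (e : nat)%:Z)%:~R])); last first.
  apply/matrixP => i j; rewrite !mxE sum_bool /= addr0 !mul1r -[harmonic_poly t j]harmonic_step step_poly_horner.
  by rewrite intrD.
rewrite -h; apply: eq_bigr => x' _; rewrite big1// mul1r.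
by rewrite (hk (fun i => (x' i)%:~R)) -vdmE mulfK ?vdm_neq0.
Qed.

Fixpoint walk_prob n (x y : int) : F :=
  if n is n'.+1 then (1 - b) * walk_prob n' x y + b * walk_prob n' (x + 1) y
  else (x == y)%:R.

Definition walk_kernel t1 (x1 : int) t2 (x2 : int) : F :=
  - (if (t2 < t1)%N then walk_prob (t1 - t2) x2 x1 else 0)
  + \sum_j walk_prob t1 (a j) x1 * (harmonic_poly t2 j).[x2%:~R].

Section Obs.
Variable G : nat -> int -> F.

(** A discrete Feynman-Kac recursion: [harmonic_poly (s + n) j] is propagated back to time [s], each
    site visited after time [s] contributing its factor [G]. *)
Fixpoint back_fun n s (j : 'I_N) (y : int) : F :=
  if n is n'.+1 then \sum_(e : bool) jump b e *
      (G s.+1 (y + (e : nat)%:Z) * back_fun n' s.+1 j (y + (e : nat)%:Z))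
  else (harmonic_poly s j).[y%:~R].

Definition obs s (h : nat -> weyl N) : F :=
  \prod_(1 <= u < s.+1) \prod_i G u (h u i).

(** [one_step] absorbs each time step into the determinant; at the final time [det_harmonic] says
    that $V(a)$ times the determinant over the Vandermonde is 1, which starts the induction. *)
Lemma path_sum_det n s (h : nat -> weyl N) :
  path_sum (step_weight b) n s h (obs (s + n)) =
  obs s h * (vdm a * (\det (\matrix_(i, j) back_fun n s j (h s i)) / vdm (h s))).
Proof.
elim: n s h => [|n IH] s h /=.
  by rewrite addn0 det_harmonic mulrAC divff ?vdm_neq0// mul1r mulfV ?vdm_neq0// mulr1.
rewrite addnS -addSn.
transitivity (\sum_(x' <- next_states (h s)) obs s h * vdm a * (step_weight b (h s) x' *
   (\prod_i G s.+1 (x' i) * (\det (\matrix_(i, j) back_fun n s.+1 j (x' i)) / vdm x')))).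
  apply: eq_bigr => x' _; rewrite IH /obs big_nat_recr//= /extend_path eqxx.
  have -> : \prod_(1 <= u < s.+1) \prod_(i < N) G u ((if u == s.+1 then x' else h u) i) = \prod_(1 <=
      u < s.+1) \prod_(i < N) G u (h u i).
    by apply: eq_big_nat => u /andP[_ us]; rewrite (ltn_eqF us).
  by ring.
by rewrite -mulr_sumr one_step -mulrA.
Qed.
End Obs.

Section Points.
Variables (k : nat) (t : 'I_k -> nat) (y : 'I_k -> int) (T : nat).
Hypothesis t0 : forall z, (0 < t z)%N.
Hypothesis tT : forall z, (t z <= T)%N.
Hypothesis tyI : injective (fun z => (t z, y z)).

(** At most one factor differs from 1. It is applied to the points at one time compared with a site,
    and to the particles compared with a point. *)
Lemma prod_at_most_one (I : finType) (P : pred I) (B : I -> bool) (c : F) :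
  (forall i j, P i -> P j -> B i -> B j -> i = j) ->
  \prod_(i | P i) (1 + c * (B i)%:R) = 1 + c * \sum_(i | P i) (B i)%:R.
Proof.
move=> PB; have [/existsP[i /andP[Pi Bi]]|] := boolP [exists i, P i && B i].
  have B0 j : P j && (j != i) -> B j = false.
    by move=> /andP[Pj ji]; apply: contraNF ji => Bj; apply/eqP; apply: PB.
  rewrite (bigD1 i)//= [in RHS](bigD1 i)//= Bi.
  rewrite big1 ?mulr1; last by move=> j /B0 ->; rewrite mulr0 addr0.
  by rewrite big1 ?addr0 ?mulr1// => j /B0 ->.
rewrite negb_exists => /forallP h.
have B0 j : P j -> B j = false by move=> Pj; have := h j; rewrite Pj /= => /negbTE.
rewrite big1; last by move=> j /B0 ->; rewrite mulr0 addr0.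
by rewrite big1 ?mulr0 ?addr0// => j /B0 ->.
Qed.

Definition hit (h : nat -> weyl N) z : bool := [exists i, h (t z) i == y z].

Section Perturbation.
Variable c : F.
Let G (s : nat) (y0 : int) : F := \prod_(z | t z == s) (1 + c * (y z == y0)%:R).

Let GE (s : nat) y0 : G s y0 = 1 + c * \sum_(z | t z == s) (y z == y0)%:R.
Proof.
apply: prod_at_most_one => i j /eqP ti /eqP tj /eqP yi /eqP yj.
by apply: tyI; rewrite ti tj yi yj.
Qed.

(** The products over particles and over points are exchanged; for a fixed point at most one
    particle can be there, so the product over particles collapses to a single factor. *)
Lemma obs_hit h : obs G T h = \prod_z (1 + c * (hit h z)%:R).
Proof.
rewrite /obs.
under eq_bigr do rewrite exchange_big.
transitivity (\prod_(1 <= u < T.+1) \prod_(z | t z == u) (1 + c * (hit h z)%:R)).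
  apply: eq_bigr => u _; apply: eq_bigr => z /eqP tz.
  rewrite (prod_at_most_one (P := predT) (B := fun i => y z == h u i)); last first.
    by move=> i j _ _ /eqP h1 /eqP h2; apply: (@weyl_inj _ (h u)); rewrite -h1 -h2.
  congr (1 + c * _); rewrite /hit tz.
  have [/existsP[i /eqP hi]|] := boolP [exists i, h u i == y z].
    rewrite (bigD1 i)//= hi eqxx big1 ?addr0// => j ji.
    by rewrite -hi (inj_eq (@weyl_inj _ (h u))) eq_sym (negbTE ji).
  rewrite negb_exists => /forallP hn; rewrite big1// => i _.
  by rewrite eq_sym (negbTE (hn i)).
rewrite (exchange_big_dep predT)//=; apply: eq_bigr => z _.
(* The time of a point occurs exactly once among $1,\ldots,T$; this is where [t0] and [tT] enter. *)
rewrite (big_rem (t z))/=; last by rewrite mem_index_iota t0 ltnS tT.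
rewrite eqxx big_seq_cond big1 ?mulr1// => u /andP[hu /eqP tu].
by move: hu; rewrite -tu mem_rem_uniqF ?iota_uniq.
Qed.

Let v z j := back_fun G (T - t z) (t z) j (y z).

(** Each point later than [s] acts as a source of strength $c\,v$ at its own time and site, and its
    effect travels back to $(s,x)$ by the free transition probability. *)
Let duhamel n s j (x : int) : (s + n = T)%N -> back_fun G n s j x = (harmonic_poly s j).[x%:~R] +
  c * \sum_(z | (s < t z)%N) walk_prob (t z - s) x (y z) * v z j.
Proof.
elim: n s x => [|n IH] s x snT.
  rewrite [LHS]/= big_pred0 ?mulr0 ?addr0// => z.
  by apply/negbTE; rewrite -leqNgt -[s]addn0 snT.
have sn : (s.+1 + n = T)%N by rewrite addSn -addnS.
rewrite [LHS]/= sum_bool /jump [(false : nat)%:Z]/= addr0 [(true : nat)%:Z]/= !GE.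
(* The points at time $s+1$ are separated from the later ones: for them one free step is a pair of
   indicators, which place $v$ at $x$ or at $x+1$. *)
have S1 : \sum_(z | (s < t z)%N) walk_prob (t z - s) x (y z) * v z j =
  (1 - b) * \sum_(z | (s.+1 < t z)%N) walk_prob (t z - s.+1) x (y z) * v z j +
  b * \sum_(z | (s.+1 < t z)%N) walk_prob (t z - s.+1) (x + 1) (y z) * v z j +
  ((1 - b) * (\sum_(z | t z == s.+1) (y z == x)%:R) * back_fun G n s.+1 j x +
   b * (\sum_(z | t z == s.+1) (y z == x + 1)%:R) * back_fun G n s.+1 j (x + 1)).
  rewrite (bigID (fun z => t z == s.+1)) /= [LHS]addrC; congr (_ + _).
    rewrite !mulr_sumr -big_split /=; apply: eq_big => z.
      by rewrite eq_sym andbC -ltn_neqAle.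
    move=> /andP[sz nz]; have -> : (t z - s = (t z - s.+1).+1)%N by lia.
    by rewrite /=; ring.
  rewrite !mulr_sumr !mulr_suml -big_split /=; apply: eq_big => z.
    by case: eqP => [->|]; rewrite ?ltnSn ?andbF.
  move=> /andP[_ /eqP tz]; rewrite tz subSnn /=.
  have vE : v z j = back_fun G n s.+1 j (y z) by rewrite /v tz; congr back_fun; lia.
  rewrite vE mulrDl; congr (_ + _).
    by rewrite eq_sym; case: eqP => [->|]; rewrite ?mulr0 ?mul0r.
  by rewrite eq_sym; case: eqP => [->|]; rewrite ?mulr0 ?mul0r.
rewrite S1 -[harmonic_poly s j]harmonic_step step_poly_horner.

set A := \sum_(z | t z == s.+1) (y z == x)%:R.
set B := \sum_(z | t z == s.+1) (y z == x + 1)%:R.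
have h1 := IH s.+1 x sn; have h2 := IH s.+1 (x + 1) sn.
rewrite intrD in h2.
move: h1 h2; set X := back_fun _ _ _ _ x; set Y := back_fun _ _ _ _ (x + 1).
set S := \sum_(z | (s.+1 < t z)%N) _; set S' := \sum_(z | (s.+1 < t z)%N) _.
move=> h1 h2.
have -> : (1 - b) * ((1 + c * A) * X) + b * ((1 + c * B) * Y) =
  (1 - b) * X + b * Y + c * ((1 - b) * A * X + b * B * Y) by ring.
by rewrite [in X in X + _ = _]h1 [in X in X + _ = _]h2; ring.
Qed.

(** Duhamel's formula at time 0 gives $\det(1+cFV)$, and at the points themselves it reads
    $(1-cW)V=G$. As $W$ strictly increases time, $\det(1-cW)=1$, so
    $\det(1+cFV)=\det(1+cVF)=\det((1-cW)(1+cVF))=\det(1-cW+cGF)$, and $GF-W$ is the transpose of the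
    kernel. *)
Lemma path_sum_kernel :
  path_sum (step_weight b) T 0 (fun=> a) (fun h => \prod_z (1 + c * (hit h z)%:R)) =
  \det (1%:M + c *: (\matrix_(i < k, j < k) walk_kernel (t i) (y i) (t j) (y j))).
Proof.
pose Fm : 'M[F]_(N, k) := \matrix_(i, z) walk_prob (t z) (a i) (y z).
pose Gm : 'M[F]_(k, N) := \matrix_(z, j) (harmonic_poly (t z) j).[(y z)%:~R].
pose W : 'M[F]_k := \matrix_(z, z') (if (t z < t z')%N then walk_prob (t z' - t z) (y z) (y z') else 0).
pose Vm : 'M[F]_(k, N) := \matrix_(z, j) v z j.
have -> : path_sum (step_weight b) T 0 (fun=> a) (fun h => \prod_z (1 + c * (hit h z)%:R)) =
   \det (1%:M + (c *: Fm) *m Vm).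
  rewrite -(@eq_path_sum _ _ _ _ _ _ _ _ obs_hit) -[T in obs _ T]add0n path_sum_det /obs big_geq// mul1r.
  rewrite mulrCA mulfV ?vdm_neq0// mulr1; congr (\det _).
  apply/matrixP => i j; rewrite !mxE duhamel// harmonic_poly_at0; congr (_ + _).
  rewrite mulr_sumr; apply: eq_big => z; first by rewrite t0.
  by move=> _; rewrite !mxE subn0 mulrA.
have Veq : (1%:M - c *: W) *m Vm = Gm.
  apply/eqP; rewrite mulmxBl mul1mx subr_eq; apply/eqP/matrixP => z j.
  rewrite !mxE {1}/v duhamel ?subnKC//; congr (_ + _).
  rewrite mulr_sumr [LHS]big_mkcond; apply: eq_bigr => z' _; rewrite !mxE.
  by case: ifP => _; rewrite ?mulrA// mulr0 mul0r.
have detU : \det (1%:M - c *: W) = 1.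
  by rewrite -scaleNr; apply: (det_one_plus_strict (t := t)) => i j /negbTE ij; rewrite !mxE ij mulr0.
rewrite sylvester_det.
have -> : \det (1%:M + Vm *m (c *: Fm)) = \det (1%:M - c *: W) * \det (1%:M + Vm *m (c *: Fm)) by rewrite detU mul1r.
rewrite -det_mulmx mulmxDr mulmx1 mulmxA Veq.
rewrite -det_tr; congr (\det _); apply/matrixP => i j; rewrite !mxE eq_sym -addrA; congr (_ + _).
rewrite /walk_kernel mulrDr mulrN; congr (_ + _).
rewrite mulr_sumr; apply: eq_bigr => l _; rewrite !mxE; ring.
Qed.
End Perturbation.

(* Both sides are the values at [d = 0] of polynomials in [d], the path sum of
   [\prod_z (d + hit z)] and [\det (d + K)]; for [d != 0] they agree by
   [path_sum_kernel] with [c = d^-1]. *)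
Theorem path_sum_hits :
  path_sum (step_weight b) T 0 (fun=> a) (fun h => \prod_z (hit h z)%:R) =
  \det (\matrix_(i < k, j < k) walk_kernel (t i) (y i) (t j) (y j)).
Proof.
set K := \matrix_(i < k, j < k) _.
pose E (A : {set 'I_k}) := path_sum (step_weight b) T 0 (fun=> a) (fun h => \prod_z (if z \in A then 1 else
    (hit h z)%:R)).
pose p1 : {poly F} := \sum_(A : {set 'I_k}) 'X^#|A| * (E A)%:P.
pose p2 : {poly F} := \det ('X%:M + map_mx polyC K).
have p1E d : p1.[d] = path_sum (step_weight b) T 0 (fun=> a) (fun h => \prod_z (d + (hit h z)%:R)).
  transitivity (path_sum (step_weight b) T 0 (fun=> a) (fun h => \sum_(A :
      {set 'I_k}) d ^+ #|A| * \prod_z (if z \in A then 1 else (hit h z)%:R))); last first.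
    apply: eq_path_sum => h; rewrite bigA_distr; apply: eq_bigr => A _.
    rewrite -prodr_const [X in X * _]big_mkcond -big_split /=; apply: eq_bigr => z _.
    by case: ifP; rewrite ?mulr1 ?mul1r.
  rewrite path_sum_lin /p1 horner_sum; apply: eq_bigr => A _.
  by rewrite hornerM hornerXn hornerC.
have p2E d : p2.[d] = \det (d%:M + K).
  rewrite /p2 -horner_evalE -det_map_mx; congr (\det _); apply/matrixP => i j.
  by rewrite !mxE /= /horner_eval hornerD hornerMn hornerX hornerC.
have p12 : p1 = p2.
  apply/eqP; rewrite -subr_eq0; apply/eqP/poly_eq0_nonzero => d d0.
  rewrite hornerD hornerN p1E p2E; apply/eqP; rewrite subr_eq0; apply/eqP.
  have -> : d%:M + K = d *: (1%:M + d^-1 *: K).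
    by rewrite scalerDr scalerA mulfV// scale1r scale_scalar_mx mulr1.
  rewrite detZ -path_sum_kernel.
  have := @path_sum_lin F N (step_weight b) _ [:: tt] (fun=> d ^+ k) (fun=> (fun h => \prod_z (1 + d^-1 * (hit
      h z)%:R))) T 0 (fun=> a).
  rewrite big_seq1 => <-; apply: eq_path_sum => h; rewrite big_seq1.
  rewrite -[X in d ^+ X](card_ord k) -prodr_const -big_split /=; apply: eq_bigr => z _.
  by rewrite mulrDr mulr1 mulVKf.
have := congr1 (fun p : {poly F} => p.[0]) p12; rewrite p1E p2E.
rewrite (_ : 0%:M = 0) ?add0r; last by apply/matrixP => i j; rewrite !mxE mul0rn.
by move=> <-; apply: eq_path_sum => h; apply: eq_bigr => z _; rewrite add0r.
Qed.

End Points.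
End Harmonic.

Import numFieldNormedType.Exports.
Import Normc.
Local Open Scope classical_set_scope.
Local Open Scope ring_scope.
Local Open Scope complex_scope.

(** * From the probability space to sums over paths *)

Section Markov.
Context (R : realType) (d : measure_display) (T : measurableType d) (P : probability T R).
Context (N : nat) (X : nat -> T -> weyl N) (p : weyl N -> weyl N -> R).
Hypothesis mc : markov_chain P X p.
Hypothesis p_sum1 : forall x, \sum_(x' <- next_states x) p x x' = 1.
Implicit Types (A B : set T) (h : nat -> weyl N).

Let Pr A : R := fine (P A).

Let mX t (A : set (weyl N)) : measurable (X t @^-1` A).
Proof. by case: mc. Qed.

Let PrE A : measurable A -> P A = (Pr A)%:E.
Proof. by move=> mA; rewrite /Pr fineK// fin_num_measure. Qed.

Let PrU A B : measurable A -> measurable B -> A `&` B = set0 -> Pr (A `|` B) = Pr A + Pr B.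
Proof.
move=> mA mB AB; by rewrite /Pr measureU// fineD// fin_num_measure.
Qed.

Let Pr0 : Pr set0 = 0. Proof. by rewrite /Pr measure0. Qed.

Let Pr_ge0 A : 0 <= Pr A. Proof. by rewrite fine_ge0. Qed.

Let Pr_le A B : measurable A -> measurable B -> A `<=` B -> Pr A <= Pr B.
Proof.
move=> mA mB AB; rewrite -lee_fin -!PrE//.
by apply: le_measure => //; rewrite inE.
Qed.

Let Pr_null A B : measurable A -> measurable B -> A `<=` B -> Pr B = 0 -> Pr A = 0.
Proof. by move=> mA mB AB B0; apply/eqP; rewrite eq_le Pr_ge0 andbT -B0 Pr_le. Qed.

Lemma measurable_history t h : measurable (history X t h).
Proof.
have -> : history X t h = \bigcap_(s in [set s | (s <= t)%N]) (X s @^-1` [set h s]).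
  by apply/seteqP; split => w /=.
by apply: bigcap_measurable => [|s _]; [exists 0%N|exact: mX].
Qed.

Let history_step s h x' : [set w | X s.+1 w = x'] `&` history X s h =
  history X s.+1 (extend_path h s.+1 x').
Proof.
apply/seteqP; split => w /=.
  move=> [Xw hw] u; rewrite /extend_path leq_eqVlt => /predU1P[->|us]; first by rewrite eqxx.
  by rewrite (ltn_eqF us) hw.
move=> hw; split; first by rewrite hw// /extend_path eqxx.
by move=> u us; rewrite hw ?leqW// /extend_path ltn_eqF.
Qed.

Let split_next s h B (l : seq (weyl N)) : measurable B -> uniq l ->
  Pr ((history X s h `&` B) `&` [set w | X s.+1 w \in l]) =
  \sum_(x' <- l) Pr (history X s.+1 (extend_path h s.+1 x') `&` B).
Proof.
move=> mB; elim: l => [_|x' l IH /= /andP[x'l ul]].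
  by rewrite big_nil (_ : [set w | _] = set0) ?setI0 ?Pr0//; apply/seteqP; split => w.
have mH := measurable_history s h.
rewrite big_cons -IH// -PrU.
- congr Pr; rewrite -history_step; apply/seteqP; split => w /=.
    by move=> [[hw Bw]]; rewrite inE => /orP[/eqP->|xl]; [left|right].
  by move=> [[[-> hw] Bw]|[[hw Bw] xl]]; rewrite inE ?eqxx ?xl ?orbT.
- exact: measurableI (measurable_history _ _) mB.
- by apply: measurableI; [exact: measurableI|exact: (mX s.+1 [set x | x \in l])].
- rewrite -history_step; apply/seteqP; split => w //= [[[Xw _] _] [_ xl]].
  by move: x'l; rewrite -Xw xl.
Qed.

(** Induction on the number of remaining steps, conditioning on the next state. The chain property
    speaks only of histories of positive probability and of one successor at a time; that no mass
    escapes [next_states] follows from [p_sum1]. *)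
Lemma prob_path_sum (Phi : (nat -> weyl N) -> bool) n s h :
  (forall g g', (forall u, (u <= s + n)%N -> g u = g' u) -> Phi g = Phi g') ->
  measurable [set w | Phi (X ^~ w)] ->
  Pr (history X s h `&` [set w | Phi (X ^~ w)]) =
  Pr (history X s h) * path_sum p n s h (fun g => (Phi g)%:R).
Proof.
move=> Philoc mA; set A := [set w | _] in mA *.
elim: n s h Philoc => [|n IH] s h Philoc /=.
  have e w : history X s h w -> Phi (X ^~ w) = Phi h.
    by move=> hw; apply: Philoc => u; rewrite addn0 => us; exact: hw.
  case: (boolP (Phi h)) => Ph.
    rewrite mulr1; congr Pr; apply/seteqP; split => w; first by case.
    by move=> hw; split => //; rewrite /A /= e.
  rewrite mulr0 (_ : _ `&` _ = set0)//; apply/seteqP; split => w //= [hw].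
  by rewrite /A /= (e w hw) (negbTE Ph).
have mH := measurable_history s h.
(* A null history has no conditional law; there both sides vanish. *)
have [H0|H0] := eqVneq (Pr (history X s h)) 0.
  by rewrite H0 mul0r; apply: (Pr_null (measurableI _ _ mH mA) mH _ H0); exact: subIsetl.
have step x' : Pr (history X s.+1 (extend_path h s.+1 x')) = Pr (history X s h) * p (h s) x'.
  have [_ /(_ s h x')] := mc.
  rewrite /cond_prob history_step => <-; last by rewrite PrE// eqe.
  by rewrite mulrC divfK.
pose Cs := [set w | X s.+1 w \in next_states (h s)].
have mC : measurable Cs by exact: (mX s.+1 [set x | x \in next_states (h s)]).
have ul := next_states_uniq (h s).
(* The listed successors carry the whole probability of the history, so its part outside them is
   null. *)
have PC : Pr (history X s h `&` Cs) = Pr (history X s h).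
  have := split_next s h measurableT ul; rewrite setIT => ->.
  under eq_bigr do rewrite setIT step.
  by rewrite -mulr_sumr p_sum1 mulr1.
have PnC : Pr (history X s h `\` Cs) = 0.
  have := @PrU (history X s h `&` Cs) (history X s h `\` Cs) (measurableI _ _ mH mC) (measurableD mH mC).
  rewrite setUIDK PC => h2.
  have {}h2 := h2 ltac:(by apply/seteqP; split => w //= [[_ c] [_ nc]]).
  by apply: (addrI (Pr (history X s h))); rewrite addr0 -h2.
transitivity (Pr ((history X s h `&` A) `&` Cs)).
  have e : history X s h `&` A = ((history X s h `&` A) `&` Cs) `|` ((history X s h `&` A) `\` Cs).
    by rewrite setUIDK.
  have mHA := measurableI _ _ mH mA.
  rewrite [in LHS]e PrU; last 3 first.
  - exact: measurableI.
  - exact: measurableD.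
  - by apply/seteqP; split => w //= [[_ c] [_ nc]].
  rewrite [X in _ + X](_ : _ = 0) ?addr0//.
  apply: (Pr_null _ _ _ PnC); [exact: measurableD|exact: measurableD|].
  by move=> w /= [[hw _] nc].
rewrite split_next// mulr_sumr; apply: eq_bigr => x' _.
by rewrite IH ?step ?mulrA//; move=> g g' gg; apply: Philoc => u; rewrite addnS -addSn; exact: gg.
Qed.

Lemma prob_start_path_sum (Phi : (nat -> weyl N) -> bool) n a :
  P [set w | X 0%N w = a] = 1%E ->
  (forall g g', (forall u, (u <= n)%N -> g u = g' u) -> Phi g = Phi g') ->
  measurable [set w | Phi (X ^~ w)] ->
  fine (P [set w | Phi (X ^~ w)]) = path_sum p n 0 (fun=> a) (fun g => (Phi g)%:R).
Proof.
move=> P1 Philoc mA; rewrite -/(Pr _).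
have h0 : history X 0 (fun=> a) = [set w | X 0%N w = a].
  apply/seteqP; split => w /=; first by move=> /(_ 0%N (leqnn _)).
  by move=> Xw u; rewrite leqn0 => /eqP ->.
have := @prob_path_sum Phi n 0 (fun=> a) Philoc mA.
rewrite h0 [X in _ = X * _]/Pr P1 mul1r => <-.
set H := [set w | X 0%N w = a]; set A := [set w | _].
have mH : measurable H by exact: (mX 0 [set a]).
have e0 : A = (A `&` H) `|` (A `\` H) by rewrite setUIDK.
rewrite [in LHS]e0 PrU; last 3 first.
- by apply: measurableI => //; exact: mA.
- by apply: measurableD => //; exact: mA.
- by apply/seteqP; split => w //= [[_ c] [_ nc]].
rewrite [X in _ + X](_ : _ = 0) ?addr0; first by rewrite setIC.
apply: (@Pr_null _ (~` H)).
- by apply: measurableD => //; exact: mA.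
- exact: measurableC.
- by move=> w [].
have := @PrU H (~` H) mH (measurableC mH) (setICr H).
rewrite setUCr {1}/Pr probability_setT {1}/Pr P1 /= => e.
by apply: (addrI 1); rewrite addr0 -e.
Qed.
End Markov.

Section Cast.
Context (R : realType) (N : nat).
Notation C := R[i].

Lemma path_sum_cast (p : weyl N -> weyl N -> R) (q : weyl N -> weyl N -> C) n s h f :
  (forall x x', x' \in next_states x -> (p x x')%:C = q x x') ->
  (path_sum p n s h f)%:C = path_sum q n s h (fun g => (f g)%:C).
Proof.
move=> pq; elim: n s h => [//|n IH] s h /=.
rewrite rmorph_sum big_seq [RHS]big_seq; apply: eq_bigr => x' x'n.
by rewrite rmorphM /= IH pq.
Qed.

(** The two exponents count particles: $|x'|-|x|$ is the number of those that jump, collected in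
    [D], and the other exponent is the number of those that stay. *)
Lemma bernoulli_step_weight (b : R) (x x' : weyl N) : x' \in next_states x ->
  bernoulli_step b x x' = step_weight b x x'.
Proof.
rewrite mem_next_states /bernoulli_step => h; rewrite h /step_weight -mulrA; congr (_ * _).
pose D : pred 'I_N := fun i => x' i != x i.
have dE i : x' i - x i = (D i : nat)%:Z.
  move/forallP: h => /(_ i); rewrite /D subr_eq0; case: eqP => [->|_ /=]; first by rewrite subrr.
  by move=> /eqP.
have e1 : Defs.total x' - Defs.total x = (#|D|)%:Z.
  rewrite /Defs.total -sumrB; under eq_bigr do rewrite dE.
  rewrite -sum1_card [in RHS]big_mkcond (big_morph Posz PoszD (erefl _)).
  apply: eq_bigr => i _; have -> : (i \in D) = D i by [].
  by case: (D i).
have e2 : N%:Z - Defs.total x' + Defs.total x = (#|[predC D]|)%:Z.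
  have := cardC D; rewrite card_ord => hc.
  have -> : N%:Z - Defs.total x' + Defs.total x = N%:Z - (Defs.total x' - Defs.total x) by ring.
  by rewrite e1 -[in N%:Z]hc PoszD addrC addKr.
rewrite e1 e2 -!exprnP -!prodr_const [RHS](bigID D) /=; congr (_ * _).
  apply: eq_bigr => i Di; have h1 : (x' i != x i) = true := Di.
  by rewrite /jump h1.
apply: eq_bigr => i nD; have h1 : (x' i != x i) = false := negbTE nD.
by rewrite /jump h1.
Qed.
End Cast.

Section WalkProb.
Context {F : numFieldType} (b : F).

Lemma walk_prob_lt n (x y : int) : y < x -> walk_prob b n x y = 0.
Proof.
elim: n x => [|n IH] x yx /=; first by rewrite gt_eqF.
rewrite !IH ?mulr0 ?addr0//; lia.
Qed.

(** The power of $1-b$ does not depend on $m$. This avoids the truncated difference $n-m$, keeps the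
    formula valid for $m>n$, where the binomial vanishes, and matches the factors of the conjugating
    function. *)
Lemma walk_probE n (x : int) (m : nat) : b != 0 -> 1 - b != 0 ->
  walk_prob b n x (x + m%:Z) = 'C(n, m)%:R * (1 - b) ^+ n * (b / (1 - b)) ^+ m.
Proof.
move=> b0 b1; elim: n x m => [|n IH] x m /=.
  case: m => [|m]; first by rewrite addr0 eqxx bin0 !mulr1.
  by rewrite bin0n /= !mul0r -[X in X == _]addr0 (inj_eq (addrI x)).
rewrite IH; case: m => [|m].
  by rewrite walk_prob_lt ?mulr0 ?addr0 ?bin0; [rewrite exprS; ring|lia].
have -> : x + m.+1%:Z = (x + 1) + m%:Z by rewrite -addn1 PoszD; ring.
rewrite IH binS natrD !exprS; move: ((1 - b) ^+ n) ((b / (1 - b)) ^+ m) => u v.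
by field.
Qed.
End WalkProb.

(** * Integrals along vertical lines *)

Section ComplexDerivative.
Context {R : realType}.
Notation C := R[i].
Implicit Types z w u v : C.

(** The derivative of a complex curve in a real parameter, taken componentwise. Holomorphy is used
    as a pair of such derivatives, along horizontals and along verticals, the second being $\mathrm
    i$ times the first. *)
Definition cder (f : R -> C) (x : R) (d : C) : Prop :=
  is_derive x (1:R) (fun t => complex.Re (f t)) (complex.Re d) /\
  is_derive x (1:R) (fun t => complex.Im (f t)) (complex.Im d).

Lemma cReD z w : complex.Re (z + w) = complex.Re z + complex.Re w.
Proof. by case: z w => [? ?] [? ?]. Qed.
Lemma cImD z w : complex.Im (z + w) = complex.Im z + complex.Im w.
Proof. by case: z w => [? ?] [? ?]. Qed.
Lemma cReN z : complex.Re (- z) = - complex.Re z.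
Proof. by case: z. Qed.
Lemma cImN z : complex.Im (- z) = - complex.Im z.
Proof. by case: z. Qed.
Lemma cReM z w : complex.Re (z * w) =
  complex.Re z * complex.Re w - complex.Im z * complex.Im w.
Proof. by case: z w => [? ?] [? ?]. Qed.
Lemma cImM z w : complex.Im (z * w) =
  complex.Re z * complex.Im w + complex.Im z * complex.Re w.
Proof. by case: z w => [? ?] [? ?]. Qed.
Lemma complex_eqP z w : complex.Re z = complex.Re w ->
  complex.Im z = complex.Im w -> z = w.
Proof. by case: z w => [? ?] [? ?] /= -> ->. Qed.

Lemma cder_ext (f : R -> C) x d d' : cder f x d' -> d' = d -> cder f x d.
Proof. by move=> ? <-. Qed.

Lemma cder_cst (c : C) x : cder (fun=> c) x 0.
Proof. by split; apply: is_derive_cst. Qed.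

Lemma cderD f g x a b : cder f x a -> cder g x b ->
  cder (fun t => f t + g t) x (a + b).
Proof.
move=> [f1 f2] [g1 g2]; split.
  under eq_fun do rewrite cReD.
  by rewrite cReD; apply: is_deriveD.
under eq_fun do rewrite cImD.
by rewrite cImD; apply: is_deriveD.
Qed.

Lemma cderM f g x a b : cder f x a -> cder g x b ->
  cder (fun t => f t * g t) x (a * g x + f x * b).
Proof.
move=> [f1 f2] [g1 g2]; split.
  under eq_fun do rewrite cReM.
  rewrite cReD !cReM; apply: is_derive_eq.
  by rewrite /GRing.scale /=; ring.
under eq_fun do rewrite cImM.
rewrite cImD !cImM; apply: is_derive_eq.
by rewrite /GRing.scale /=; ring.
Qed.

Lemma cderV f x a : f x != 0 -> cder f x a ->
  cder (fun t => (f t)^-1) x (- a / (f x) ^+ 2).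
Proof.
move=> fx0 [f1 f2].
pose N t := complex.Re (f t) ^+ 2 + complex.Im (f t) ^+ 2.
have N0 : N x != 0.
  apply: contra fx0; rewrite /N paddr_eq0 ?sqr_ge0// !sqrf_eq0.
  by move=> /andP[/eqP a0 /eqP b0]; apply/eqP; apply: complex_eqP.
have RV t : complex.Re (f t)^-1 = complex.Re (f t) * (N t)^-1.
  by rewrite /N; case: (f t).
have IV t : complex.Im (f t)^-1 = - complex.Im (f t) * (N t)^-1.
  by rewrite /N; case: (f t) => a0 b0 /=; rewrite mulNr.
have dN : is_derive x (1:R) N (2 * complex.Re (f x) * complex.Re a + 2 * complex.Im (f x) * complex.Im a).
  rewrite /N; apply: is_derive_eq; rewrite /GRing.scale /= ?mulr_natl; ring.
have dV : is_derive x (1:R) (fun t => (N t)^-1) (- (N x) ^- 2 *: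
    (2 * complex.Re (f x) * complex.Re a + 2 * complex.Im (f x) * complex.Im a)).
  exact: is_deriveV.
have -> : - a / f x ^+ 2 = - a * (f x)^-1 * (f x)^-1 by rewrite expr2 invfM mulrA.
split.
  under eq_fun do rewrite RV.
  rewrite !cReM !cImM !cReN !cImN RV IV.
  apply: is_derive_eq.
  rewrite /GRing.scale /=; move: N0; rewrite /N; set p := complex.Re (f x); set q := complex.Im (f x) => N0.
  by field.
under eq_fun do rewrite IV.
rewrite !cImM !cReM !cReN !cImN RV IV.
apply: is_derive_eq.
rewrite /GRing.scale /=; move: N0; rewrite /N; set p := complex.Re (f x); set q := complex.Im (f x) => N0.
by field.
Qed.

Lemma cexpD z w : cexp (z + w) = cexp z * cexp w.
Proof.
case: z w => [a b] [c d]; rewrite /cexp /=; apply: complex_eqP;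
    rewrite !(cReM, cImM) /= ?mul0r ?subr0 ?addr0 expRD ?cosD ?sinD; ring.
Qed.

Lemma cder_cexp f x a : cder f x a ->
  cder (fun t => cexp (f t)) x (a * cexp (f x)).
Proof.
move=> [f1 f2].
have RE t : complex.Re (cexp (f t)) = expR (complex.Re (f t)) * cos (complex.Im (f t)).
  by rewrite /cexp cReM /= mul0r subr0.
have IE t : complex.Im (cexp (f t)) = expR (complex.Re (f t)) * sin (complex.Im (f t)).
  by rewrite /cexp cImM /= mul0r addr0.
have d1 : is_derive x (1:R) (fun t => expR (complex.Re (f t))) (complex.Re a * expR (complex.Re (f x))).
  have := @is_derive1_comp _ expR (fun t => complex.Re (f t)) x _ _ (is_derive_expR _) f1.
  by rewrite mulrC.
have d2 : is_derive x (1:R) (fun t => cos (complex.Im (f t))) (- complex.Im a * sin (complex.Im (f x))).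
  have := @is_derive1_comp _ cos (fun t => complex.Im (f t)) x _ _ (is_derive_cos _) f2.
  by rewrite mulrC mulrN mulNr.
have d3 : is_derive x (1:R) (fun t => sin (complex.Im (f t))) (complex.Im a * cos (complex.Im (f x))).
  have := @is_derive1_comp _ sin (fun t => complex.Im (f t)) x _ _ (is_derive_sin _) f2.
  by rewrite mulrC.
split.
  under eq_fun do rewrite RE.
  rewrite cReM RE IE; apply: is_derive_eq; rewrite /GRing.scale /=; ring.
under eq_fun do rewrite IE.
rewrite cImM RE IE; apply: is_derive_eq; rewrite /GRing.scale /=; ring.
Qed.
End ComplexDerivative.

Section IntegrableDecay.
Context {R : realType}.
Notation C := R[i].
Notation mu := (@lebesgue_measure R).

Lemma integrable_oneDsqrV :
  mu.-integrable [set: R] (EFin \o (fun s => (1 + s ^+ 2)^-1)).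
Proof.
have c1 : continuous (fun s : R => (1 + s ^+ 2)^-1) by exact: continuous_oneDsqrV.
apply/integrableP; split.
  apply/measurable_EFinP. apply: continuous_measurable_fun. exact: c1.
apply: (@le_lt_trans _ _ (\int[mu]_x ((1 + x ^+ 2)^-1)%:E)%E).
  rewrite le_eqVlt; apply/orP; left; apply/eqP; apply: eq_integral => x _ /=.
  by rewrite ger0_norm// invr_ge0 addr_ge0// sqr_ge0.
rewrite ge0_symfun_integralT//=; first last.
- by move=> x /=; rewrite sqrrN.
- by move=> x; rewrite invr_ge0 addr_ge0// sqr_ge0.
rewrite -set_itvcy.
rewrite [X in (_ * X)%E](_ : _ = (pi / 2)%:E); first by rewrite -EFinM ltry.
exact: integral0y_oneDsqr.
Qed.

Lemma integrable_domin (f : R -> R) M : measurable_fun setT f ->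
  (forall s, `|f s| <= M / (1 + s ^+ 2)) ->
  mu.-integrable [set: R] (EFin \o f).
Proof.
move=> mf fM.
apply: (@le_integrable _ _ _ mu setT _ _ (EFin \o (fun s => M * (1 + s ^+ 2)^-1))) => //=.
- exact/measurable_EFinP.
- move=> x _; rewrite lee_fin (le_trans (fM x))// ler_norm//.
- have := @integrableZl _ _ _ mu _ measurableT M _ integrable_oneDsqrV.
  by apply: eq_integrable => // x _ /=.
Qed.

(** Integration over $[-n-1,n+1]$ leaves $F(n+1)-F(-n-1)$, which is $O(1/n)$; dominated convergence
    passes to the whole line. *)
Lemma Rintegral_derive_eq0 (F f : R -> R) (M : R) :
  continuous f -> (forall x : R, is_derive x (1 : R) F (f x)) ->
  (forall s, `|f s| <= M / (1 + s ^+ 2)) ->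
  (forall s, `|F s| <= M / (1 + s ^+ 2)) ->
  \int[mu]_x f x = 0.
Proof.
move=> cf dF fM FM.
have intf := integrable_domin (continuous_measurable_fun cf) fM.
pose I n : set R := `[- n.+1%:R, n.+1%:R]%classic.
have fn n : (\int[mu]_x ((f \_ (I n)) x)%:E = (F n.+1%:R - F (- n.+1%:R))%:E)%E.
  under eq_integral do rewrite -[(_)%:E]/((EFin \o (f \_ (I n))) _) -restrict_EFin.
  rewrite -integral_mkcond.
  rewrite (@continuous_FTC2 _ f F)//.
  - by rewrite (@lt_le_trans _ _ 0)// oppr_lt0.
  - exact: continuous_subspaceT.
  - have cF : continuous F by move=> x; apply/differentiable_continuous/derivable1_diffP; case: (dF x).
    split=> //.
    + by apply: cvg_at_right_filter; exact: cF.
    + by apply: cvg_at_left_filter; exact: cF.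
  - by move=> x _; rewrite derive1E; apply: derive_val.
have FI : (\int[mu]_x (f x)%:E)%E = (\int[mu]_x f x)%:E.
  by rewrite /Rintegral fineK//; exact: integrable_fin_num.
have [|||||_ _] := @dominated_convergence _ _ _ mu setT measurableT
  (fun n x => ((f \_ (I n)) x)%:E) (EFin \o f) (EFin \o (fun s => M * (1 + s ^+ 2)^-1)).
- move=> n; apply/measurable_EFinP; apply/(measurable_restrictT _ _).1.
    exact: measurable_itv.
  by apply: measurable_funTS; exact: continuous_measurable_fun.
- by apply/measurable_EFinP; exact: continuous_measurable_fun cf.
- apply: aeW => x _; apply: cvg_near_cst; near=> n.
  congr EFin; rewrite /patch ifT//; apply/mem_set; rewrite /I /= in_itv /= -ler_norml.
  apply: ltW; apply: (@lt_trans _ _ n%:R); last by rewrite ltr_nat.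
  near: n; exact: nbhs_infty_gtr.
- have := @integrableZl _ _ _ mu _ measurableT M _ integrable_oneDsqrV.
  by apply: eq_integrable => // x _ /=.
- apply: aeW => x n _; rewrite /patch; case: ifP => _ /=; rewrite lee_fin //.
  by rewrite normr0 (le_trans (normr_ge0 _) (fM x)).
rewrite [X in X @ _ --> _](_ : _ = (fun n => (F n.+1%:R - F (- n.+1%:R))%:E)); last exact/funext.
rewrite [X in _ --> X]FI => /fine_cvgP[_] /= H.
have H0 : (F n.+1%:R - F (- n.+1%:R)) @[n --> \oo] --> (0:R).
  apply: (@norm_cvg0 _ R^o).
  have K : (2 * M) * (n.+1%:R)^-1 @[n --> \oo] --> (0:R).
    rewrite -[X in _ --> X](mulr0 (2 * M)); exact: (cvgM (cvg_cst _) (@cvg_harmonic R)).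
  apply: (@squeeze_cvgr _ _ _ _ (cst 0) _ _ _ _ _ K); last exact: cvg_cst.
  apply/nearW => n /=; rewrite normr_ge0 /=.
  apply: (le_trans (ler_normB _ _)).
  have M0 : 0 <= M by have := le_trans (normr_ge0 _) (FM 0); rewrite expr0n /= addr0 divr1.
  have B : M / (1 + n.+1%:R ^+ 2) <= M * (n.+1%:R)^-1.
    apply: ler_wpM2l => //; rewrite lef_pV2 ?posrE ?ltr0n ?ltr_wpDr ?sqr_ge0//.
    by rewrite -natrX nat1r ler_nat (leq_trans _ (leqnSn _))// expnS expn1 leq_pmulr.
  have := lerD (FM n.+1%:R) (FM (- n.+1%:R)); rewrite sqrrN => h; apply: (le_trans h).
  by rewrite -mulrA mulr_natl mulr2n lerD.
by rewrite -(cvg_lim _ H) // (cvg_lim _ H0).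
Unshelve. all: end_near. Qed.
End IntegrableDecay.

(** * Growth of the hyperbolic and trigonometric functions *)

Section Hyperbolic.
Context {R : realType}.
Notation C := R[i].
Implicit Types (x y s : R) (z w : C).

Definition ch y : R := (expR y + expR (- y)) / 2.
Definition sh y : R := (expR y - expR (- y)) / 2.

Lemma ch2 y : ch y ^+ 2 = 1 + sh y ^+ 2.
Proof.
have e : expR y * expR (- y) = 1 by exact: expRxMexpNx_1.
by rewrite /ch /sh; move: e; set a := expR y; set b := expR (- y) => e; field: e.
Qed.

Lemma chN y : ch (- y) = ch y.
Proof. by rewrite /ch opprK addrC. Qed.

Lemma ch_norm y : ch `|y| = ch y.
Proof. by case: (ger0P y) => // _; rewrite chN. Qed.

(** With $t=|y|$, add $e^t\ge(1+t/2)^2$ and $e^{-t}\ge1-t$: the linear terms cancel and half of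
    $t^2/4$ remains. *)
Lemma ch_lower y : 1 + y ^+ 2 / 8 <= ch y.
Proof.
rewrite -[ch y]ch_norm -real_normK ?num_real//; move: (normr_ge0 y); set t := `|y| => t0.
have e1 : (1 + t / 2) ^+ 2 <= expR t.
  rewrite [X in _ <= expR X](_ : t = 2%:R * (t / 2)); last by rewrite mulrC divfK.
  rewrite expRM_natl lerXn2r ?nnegrE ?expR_ge0 ?expR_ge1Dx// addr_ge0// divr_ge0//.
have e2 : 1 + - t <= expR (- t) by exact: expR_ge1Dx.
rewrite /ch; nra.
Qed.

Lemma ch_ge1 y : 1 <= ch y.
Proof. by apply: le_trans (ch_lower y); rewrite lerDl divr_ge0 ?sqr_ge0. Qed.

Lemma ch_gt0 y : 0 < ch y.
Proof. exact: lt_le_trans ltr01 (ch_ge1 y). Qed.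

Lemma sh2_ge y : y ^+ 2 / 4 <= sh y ^+ 2.
Proof.
have := ch_lower y; have := ch2 y; have := sqr_ge0 y.
move: (ch y) (sh y ^+ 2) (y ^+ 2) => c S Y Y0 e h; nra.
Qed.

Lemma sh2pi_ge s : s ^+ 2 <= sh (pi * s) ^+ 2.
Proof.
apply: le_trans (sh2_ge _); rewrite exprMn.
have p := @pi_ge2 R; have p4 : (4 : R) <= pi ^+ 2 by nra.
by have := sqr_ge0 s; nra.
Qed.

Lemma ch_exp_lower y n : y ^+ (n.+1).*2 / (n.+1).*2`!%:R / 2 <= ch y.
Proof.
rewrite -[ch y]ch_norm.
have -> : y ^+ (n.+1).*2 = `|y| ^+ (n.+1).*2.
  by rewrite -mul2n !exprM real_normK ?num_real.
have t0 := normr_ge0 y; set t := `|y| in t0 *.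
have := @expR_ge1Dxn R t (n.*2.+1) t0; rewrite -doubleS.
have := expR_ge0 (- t); rewrite /ch; lra.
Qed.

(** The exponential term of order $2n+2$ suffices: the left side is at most $2^n$ when $s^2\le1$ and
    at most $2^n s^{2n+2}$ otherwise. *)
Lemma poly_ch n : exists2 M, 0 < M & forall s, (1 + s ^+ 2) ^+ n <= M * ch (pi * s).
Proof.
exists (2 ^+ n * (1 + (n.+1).*2`!%:R * 2)).
  by rewrite mulr_gt0// ?exprn_gt0// addr_gt0// mulr_gt0// ltr0n fact_gt0.
move=> s.
have c1 := ch_ge1 (pi * s).
have c2 : s ^+ (n.+1).*2 <= (n.+1).*2`!%:R * 2 * ch (pi * s).
  rewrite -ler_pdivrMl ?mulr_gt0// invfM mulrC mulrA.
  apply: le_trans (ch_exp_lower (pi * s) n).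
  rewrite !ler_pM2r ?invr_gt0 ?ltr0n ?fact_gt0 // exprMn ler_peMl//.
    by rewrite -mul2n exprM exprn_ge0// sqr_ge0.
  by rewrite exprn_ege1// (le_trans _ (@pi_ge2 R))// ler1n.
have s2 := sqr_ge0 s.
have [s1|s1] := lerP (s ^+ 2) 1.
  apply: (@le_trans _ _ (2 ^+ n)).
    by rewrite lerXn2r ?nnegrE ?addr_ge0// (_ : 2 = 1 + 1)// lerD2l.
  rewrite -mulrA ler_peMr ?exprn_ge0// mulrDl mul1r.
  by rewrite (le_trans c1)// lerDl ltW// mulr_gt0 ?ch_gt0 ?mulr_gt0.
apply: (@le_trans _ _ (2 ^+ n * s ^+ (n.+1).*2)).
  apply: (@le_trans _ _ ((2 * s ^+ 2) ^+ n)).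
    have h1 : 0 <= 1 + s ^+ 2 by lra.
    have h2 : 1 + s ^+ 2 <= 2 * s ^+ 2 by lra.
    by rewrite lerXn2r// nnegrE (le_trans h1).
  rewrite exprMn ler_pM2l ?exprn_gt0// -mul2n (exprM s).
  by rewrite ler_eXn2l.
rewrite -mulrA ler_pM2l ?exprn_gt0// mulrDl mul1r (le_trans c2)// lerDr.
exact: ltW (ch_gt0 _).
Qed.

Lemma cexpE x y : cexp (x +i* y) = (expR x * cos y) +i* (expR x * sin y).
Proof. by rewrite /cexp; apply: complex_eqP; rewrite !(cReM, cImM) /=; ring. Qed.

Lemma csinE x y : csin (x +i* y) = (sin x * ch y) +i* (cos x * sh y).
Proof.
rewrite /csin.
have -> : 'i%C * (x +i* y) = (- y) +i* x by apply: complex_eqP; rewrite !(cReM, cImM) /=; ring.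
have -> : - ((- y) +i* x) = y +i* (- x) by apply: complex_eqP; rewrite /= ?opprK.
rewrite !cexpE cosN sinN.
have i2 : (2 * 'i%C : C) != 0.
  by rewrite mulf_neq0 ?pnatr_eq0// eq_complex /= oner_eq0 andbF.
apply: (mulIf i2); rewrite divfK//.
by apply: complex_eqP; rewrite !(cReD, cImD, cReN, cImN, cReM, cImM) /= /ch /sh; field.
Qed.
End Hyperbolic.

Section ComplexSine.
Context {R : realType}.
Notation C := R[i].
Notation mu := (@lebesgue_measure R).
Implicit Types (x y s t : R) (z w : C).

Definition ccos z : C := (cexp ('i%C * z) + cexp (- ('i%C * z))) / 2.

Lemma ccosE x y : ccos (x +i* y) = (cos x * ch y) +i* (- (sin x * sh y)).
Proof.
rewrite /ccos.
have -> : 'i%C * (x +i* y) = (- y) +i* x by apply: complex_eqP; rewrite !(cReM, cImM) /=; ring.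
have -> : - ((- y) +i* x) = y +i* (- x) by apply: complex_eqP; rewrite /= ?opprK.
rewrite !cexpE cosN sinN.
have i2 : (2 : C) != 0 by rewrite pnatr_eq0.
apply: (mulIf i2); rewrite divfK//.
by apply: complex_eqP; rewrite !(cReD, cImD, cReN, cImN, cReM, cImM) /= /ch /sh; field.
Qed.

Lemma cder_csin f x a : cder f x a -> cder (fun t => csin (f t)) x (a * ccos (f x)).
Proof.
move=> df; rewrite /csin /ccos.
have i2 : (2 * 'i%C : C) != 0.
  by rewrite mulf_neq0 ?pnatr_eq0// eq_complex /= oner_eq0 andbF.
have d1 : cder (fun t => 'i%C * f t) x ('i%C * a).
  by apply: cder_ext (cderM (cder_cst 'i%C x) df) _; rewrite mul0r add0r.
have d2 : cder (fun t => - ('i%C * f t)) x (- ('i%C * a)).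
  have -> : (fun t => - ('i%C * f t)) = (fun t => (-1) * ('i%C * f t)) by apply/funext => t; rewrite mulN1r.
  by apply: cder_ext (cderM (cder_cst (-1) x) d1) _; rewrite mul0r add0r mulN1r.
have d2' := cder_cexp d2.
have d3 : cder (fun t => - cexp (- ('i%C * f t))) x ('i%C * a * cexp (- ('i%C * f x))).
  have -> : (fun t => - cexp (- ('i%C * f t))) = (fun t => (-1) * cexp (- ('i%C * f t))) by apply/funext => t;
      rewrite mulN1r.
  by apply: cder_ext (cderM (cder_cst (-1) x) d2') _; rewrite mul0r add0r mulN1r mulNr opprK.
apply: cder_ext (cderM (cderD (cder_cexp d1) d3) (cder_cst _ x)) _.
rewrite mulr0 addr0; have j : ('i%C : C) != 0 by rewrite eq_complex /= oner_eq0 andbF.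
by field; rewrite j.
Qed.

Lemma normc_ge0 z : 0 <= normc z.
Proof. by case: z => a b; exact: sqrtr_ge0. Qed.

Lemma sqr_normcE z : normc z ^+ 2 = complex.Re z ^+ 2 + complex.Im z ^+ 2.
Proof. by case: z => a b; rewrite sqr_sqrtr// addr_ge0 ?sqr_ge0. Qed.

Lemma Re_le_normc z : `|complex.Re z| <= normc z.
Proof.
rewrite -(@ler_pXn2r _ 2) ?nnegrE ?normc_ge0// real_normK ?num_real//.
by rewrite sqr_normcE lerDl sqr_ge0.
Qed.

Lemma Im_le_normc z : `|complex.Im z| <= normc z.
Proof.
rewrite -(@ler_pXn2r _ 2) ?nnegrE ?normc_ge0// real_normK ?num_real//.
by rewrite sqr_normcE lerDr sqr_ge0.
Qed.

Lemma normc_real x : normc x%:C = `|x|.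
Proof. by rewrite /= expr0n /= addr0 sqrtr_sqr. Qed.

Lemma normc_csin2 x y : normc (csin (x +i* y)) ^+ 2 = sin x ^+ 2 + sh y ^+ 2.
Proof.
rewrite csinE sqr_normcE /=; move: (ch2 y) (cos2sin2 x).
by move: (ch y) (sh y) => c h e1 e2; rewrite !exprMn e1 e2; ring.
Qed.

Lemma normc_csin_ge x y : `|sin x| * ch y <= normc (csin (x +i* y)).
Proof.
apply: le_trans (Re_le_normc _).
by rewrite csinE /= normrM (ger0_norm (ltW (ch_gt0 y))).
Qed.

Lemma normc_ccos_le x y : normc (ccos (x +i* y)) <= ch y.
Proof.
rewrite -(@ler_pXn2r _ 2) ?nnegrE ?normc_ge0 ?(ltW (ch_gt0 y))//.
rewrite ccosE sqr_normcE /= sqrrN; move: (ch2 y) (cos2sin2 x).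
move: (ch y) (sh y) => c h e1 e2; rewrite !exprMn e1 e2.
by have := sqr_ge0 (sin x); lra.
Qed.

Lemma csin_neq0 x y : sin x != 0 -> csin (x +i* y) != 0.
Proof.
move=> s0; rewrite csinE eq_complex /= negb_and mulf_neq0//.
by rewrite gt_eqF// ch_gt0.
Qed.

Lemma cder_continuous_Re (f d : R -> C) : (forall x, cder f x (d x)) ->
  continuous (fun x => complex.Re (f x)).
Proof. by move=> df x; apply/differentiable_continuous/derivable1_diffP; case: (df x).1. Qed.

Lemma cder_continuous_Im (f d : R -> C) : (forall x, cder f x (d x)) ->
  continuous (fun x => complex.Im (f x)).
Proof. by move=> df x; apply/differentiable_continuous/derivable1_diffP; case: (df x).2. Qed.

End ComplexSine.

Section Shift.
Context {R : realType}.
Notation C := R[i].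
Notation mu := (@lebesgue_measure R).
Variables (f d d2 : R -> R -> C) (u v e M : R).
Hypothesis e1 : e = 1 \/ e = -1.
Hypothesis dx : forall x s, x \in `]u, v[%R -> cder (f ^~ s) x (e%:C * d x s).
Hypothesis ds : forall x s, x \in `]u, v[%R -> cder (f x) s ('i%C * d x s).
Hypothesis ds2 : forall x s, x \in `]u, v[%R -> cder (d x) s (d2 x s).
Hypothesis fM : forall x s, x \in `]u, v[%R -> normc (f x s) <= M / (1 + s ^+ 2).
Hypothesis dM : forall x s, x \in `]u, v[%R -> normc (d x s) <= M / (1 + s ^+ 2).

(* Cauchy-Riemann: d/dx Re f = e Im (d/ds f), whose integral over s vanishes *)
Lemma shift_line x1 x2 : u < x1 -> x1 < x2 -> x2 < v ->
  \int[mu]_s complex.Re (f x1 s) = \int[mu]_s complex.Re (f x2 s).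
Proof.
move=> ux1 x12 x2v.
have M0 : 0 <= M.
  have := @fM x1 0; rewrite in_itv /= ux1 (lt_trans x12 x2v) => /(_ isT).
  by rewrite expr0n addr0 divr1; apply: le_trans; rewrite normc_ge0.
have dU x s : x \in `]u, v[%R ->
    is_derive x (1 : R) (fun t => complex.Re (f t s)) (e * complex.Re (d x s)).
  by move=> xI; have := (dx s xI).1; rewrite cReM /= mul0r subr0.
have cRe x : x \in `]u, v[%R -> continuous (fun s => complex.Re (f x s)).
  by move=> xI; apply: (@cder_continuous_Re _ _ (fun s => 'i%C * d x s)) => s; apply: ds.
have dJ x : x \in `]u, v[%R ->
    is_derive x (1 : R) (fun t => \int[mu]_s complex.Re (f t s)) 0.
  move=> xI.
  pose F t s := complex.Re (f t s).
  have H := @cvg_differentiation_under_integral R _ _ mu F setT measurableT x u v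
    _ _ _ (fun s => M / (1 + s ^+ 2)).
  have d1E t s : t \in `]u, v[%R -> partial1of2 F t s = e * complex.Re (d t s).
    by move=> tI; rewrite partial1of2E; apply: (@derive_val _ _ _ _ _ _ _ (dU t s tI)).
  have {}H : (h^-1 *: (\int[mu]_(s in setT) F (h + x) s - \int[mu]_(s in setT) F x s) @[h --> 0^'])
     --> \int[mu]_(s in setT) (partial1of2 F) x s.
    apply: H => //.
    - move=> t tI; apply: (@integrable_domin _ _ M).
        by apply: continuous_measurable_fun; apply: cRe; rewrite inE.
      by move=> s; apply: le_trans (Re_le_normc _) (fM _ _); rewrite inE.
    - by move=> t s tI _; have [] := @dU t s ltac:(by rewrite inE).
    - by move=> s; rewrite divr_ge0// addr_ge0// sqr_ge0.
    - have := @integrableZl _ _ _ mu _ measurableT M _ integrable_oneDsqrV.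
      by apply: eq_integrable.
    - move=> t s tI _; rewrite d1E ?inE// normrM.
      have -> : `|e| = 1 by case: e1 => ->; rewrite ?normrN normr1.
      by rewrite mul1r; apply: le_trans (Re_le_normc _) (dM _ _); rewrite inE.
  have J0 : \int[mu]_(s in setT) (partial1of2 F) x s = 0.
    under eq_Rintegral do rewrite d1E//.
    rewrite RintegralZl//; last first.
      apply: (@integrable_domin _ _ M).
        apply: continuous_measurable_fun.
        by apply: (@cder_continuous_Re _ _ (d2 x)) => s; apply: ds2.
      by move=> s; apply: le_trans (Re_le_normc _) (dM _ _).
    have -> : \int[mu]_s complex.Re (d x s) = 0; last by rewrite mulr0.
    apply: (@Rintegral_derive_eq0 _ (fun s => complex.Im (f x s)) _ M).
    - by apply: (@cder_continuous_Re _ _ (d2 x)) => s; apply: ds2.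
    - by move=> s; have := (ds s xI).2; rewrite cImM /= mul0r add0r mul1r.
    - by move=> s; apply: le_trans (Re_le_normc _) (dM _ _).
    - by move=> s; apply: le_trans (Im_le_normc _) (fM _ _).
  rewrite J0 in H.
  apply: DeriveDef.
    apply/cvg_ex; exists 0.
    by under eq_fun do rewrite /= scaler1.
  rewrite -derive1E /derive1.
  exact: cvg_lim H.
have xI x : x \in `[x1, x2] -> x \in `]u, v[%R.
  rewrite !in_itv /= => /andP[a b].
  by rewrite (lt_le_trans ux1 a) (le_lt_trans b x2v).
have [c _] := @MVT _ (fun t => \int[mu]_s complex.Re (f t s)) (fun=> 0) _ _ x12
  ltac:(by move=> x xx; apply: dJ; apply: xI; apply: subset_itv_oo_cc xx)
  ltac:(by apply: derivable_within_continuous => x xx; have [] := dJ x (xI x xx)).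
by rewrite mul0r => /eqP; rewrite subr_eq0 => /eqP.
Qed.
End Shift.

Section LineDerivatives.
Context {R : realType}.
Notation C := R[i].
Implicit Types (x y s t : R) (z w : C).

Lemma cder_scale (f : R -> C) e x d : cder f (e * x) d ->
  cder (fun t => f (e * t)) x (e%:C * d).
Proof.
move=> [f1 f2].
have de : is_derive x (1:R) (fun t => e * t) e.
  by apply: is_derive_eq; rewrite /GRing.scale /= mulr1.
split.
  have := @is_derive1_comp _ (fun t => complex.Re (f t)) (fun t => e * t) x _ _ f1 de.
  by rewrite cReM /= mul0r subr0 mulrC.
have := @is_derive1_comp _ (fun t => complex.Im (f t)) (fun t => e * t) x _ _ f2 de.
by rewrite cImM /= mul0r addr0 mulrC.
Qed.

Lemma cder_lineX a s x : cder (fun t => (a * t) +i* s : C) x (a%:C).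
Proof.
split => /=; last exact: is_derive_cst.
by apply: is_derive_eq; rewrite /GRing.scale /= mulr1.
Qed.

Lemma cder_lineY a x s : cder (fun t => x +i* (a * t) : C) s ('i%C * a%:C).
Proof.
split => /=; first by rewrite mul0r mul1r subr0; apply: is_derive_cst.
by apply: is_derive_eq; rewrite /GRing.scale /= ?mulr1 mul0r mul1r add0r.
Qed.

(** Monotonicity on $[0,1/2]$ and the reflection $x\mapsto1-x$. *)
Lemma sin_pi_ge x u0 : 0 < u0 -> u0 <= x -> x <= 1 - u0 -> sin (pi * u0) <= sin (pi * x).
Proof.
move=> u00.
have p0 := @pi_gt0 R.
have key t : u0 <= t -> t <= 2^-1 -> sin (pi * u0) <= sin (pi * t).
  move=> a b; move: a; rewrite le_eqVlt => /predU1P[->//|a].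
  apply: ltW; rewrite ltr_sin ?ltr_pM2l// in_itv /=.
    apply/andP; split; first by rewrite (@le_trans _ _ 0)// ?oppr_le0 ?divr_ge0 ?mulr_ge0 ?ltW.
    by rewrite ler_pM2l// (le_trans _ b)// ltW.
  apply/andP; split; last by rewrite ler_pM2l.
  rewrite (@le_trans _ _ 0)// ?oppr_le0 ?divr_ge0 ?mulr_ge0 ?ltW//; lra.
move=> a b; have [c|c] := lerP x 2^-1; first exact: key.
have -> : sin (pi * x) = sin (pi * (1 - x)).
  by rewrite mulrBr mulr1 sinB sinpi cospi mul0r mulN1r opprK add0r.
apply: key; lra.
Qed.

Lemma sin_pi_gt0 x : 0 < x -> x < 1 -> 0 < sin (pi * x).
Proof.
by move=> a b; apply: sin_gt0_pi; rewrite mulr_gt0 ?pi_gt0//= gtr_pMr// pi_gt0.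
Qed.

(** Mean value theorem from 0: as $\pi x\le\pi/4\le1$, the slope is at least $\cos1>0$, and the
    factor $\pi\ge1$ is dropped. *)
Lemma sin_pi_lin x : 0 < x -> x <= 4^-1 -> cos 1 * x <= sin (pi * x).
Proof.
move=> x0 x1.
have p0 := @pi_gt0 R.
have y0 : 0 < pi * x by rewrite mulr_gt0.
have y1 : pi * x <= 1.
  have := @pihalf_lt2 R => h; rewrite (@le_trans _ _ (pi * 4^-1))// ?ler_pM2l//; lra.
have [c] := @MVT _ (@sin R) (@cos R) _ _ y0 (fun t _ => is_derive_sin t)
  (continuous_subspaceT (@continuous_sin R)).
rewrite in_itv /= sin0 !subr0 => /andP[c0 c1] ->.
have c2 : cos 1 <= cos c.
  have p2 := @pi_ge2 R.
  rewrite ltW// ltr_cos ?in_itv/=; [lra| |]; apply/andP; split; lra.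
have := @cos1_gt0 R => cp.
apply: ler_pM => //; [exact: ltW|exact: ltW|].
by rewrite ler_peMl ?ltW// (lt_le_trans _ (@pi_ge2 R)) ?ltr1n.
Qed.

End LineDerivatives.

(** * Vertical lines on the two sides of a removed pole *)

Section Pole.
Context {R : realType}.
Notation C := R[i].
Notation mu := (@lebesgue_measure R).
Variables (G dG : C -> C) (d2G : R -> R -> C) (n : nat) (K : R).
Hypothesis Gx : forall x s : R, cder (fun t => G (t +i* s)) x (dG (x +i* s)).
Hypothesis Gs : forall x s : R, cder (fun t => G (x +i* t)) s ('i%C * dG (x +i* s)).
Hypothesis dGs : forall x s : R, cder (fun t => dG (x +i* t)) s (d2G x s).
Hypothesis GK : forall x s : R, `|x| <= 1 ->
  normc (G (x +i* s)) <= K * (`|x| + `|s|) * (1 + s ^+ 2) ^+ n.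
Hypothesis dGK : forall x s : R, `|x| <= 1 ->
  normc (dG (x +i* s)) <= K * (1 + s ^+ 2) ^+ n.

Let S (e x s : R) := csin ((pi * (e * x)) +i* (pi * s) : C).
Let D (e x s : R) := pi%:C * ccos ((pi * (e * x)) +i* (pi * s) : C).
(** The quotient $G(z)/\sin(\pi z)$ on the line $\Re z=ex$; the sign $e=\pm1$ selects the side of 0,
    so that both lines have the same parameter $x\in(0,1)$. The bound [GK] forces $G(0)=0$, which
    removes the pole at 0. *)
Let f e x s := G ((e * x) +i* s) * (S e x s)^-1.
Let d e x s := dG ((e * x) +i* s) * (S e x s)^-1
  + G ((e * x) +i* s) * (- D e x s / (S e x s) ^+ 2).

Let Sx e x s : cder (S e ^~ s) x (e%:C * D e x s).
Proof.
rewrite /S /D.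
under eq_fun do rewrite mulrA.
apply: cder_ext (cder_csin (cder_lineX _ _ _)) _.
have -> : (pi * e)%:C = e%:C * pi%:C :> C by rewrite mulrC rmorphM.
by rewrite -!mulrA.
Qed.

Let Ss e x s : cder (S e x) s ('i%C * D e x s).
Proof.
by rewrite /S /D; apply: cder_ext (cder_csin (cder_lineY _ _ _)) _; rewrite !mulrA.
Qed.

Let fx e x s : S e x s != 0 -> cder (f e ^~ s) x (e%:C * d e x s).
Proof.
move=> S0; have h := @cder_scale R (fun t => G (t +i* s)) e x _ (Gx _ _).
have hh := cderM h (@cderV _ (S e ^~ s) x _ S0 (Sx e x s)).
refine (cder_ext hh _).
by rewrite /d; ring.
Qed.

Let fs e x s : S e x s != 0 -> cder (f e x) s ('i%C * d e x s).
Proof.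
move=> S0; have h := Gs (e * x) s.
have hh := cderM h (@cderV _ (S e x) s _ S0 (Ss e x s)).
refine (cder_ext hh _).
by rewrite /d; ring.
Qed.

(** This second derivative provides the continuity in $s$ of [d] that [shift_line] uses. *)
Let ds e x s : S e x s != 0 -> exists d2, cder (d e x) s d2.
Proof.
move=> S0.
have h1 := Gs (e * x) s.
have h2 := dGs (e * x) s.
have h3 := @cderV _ (S e x) s _ S0 (Ss e x s).
have h4 : exists q, cder (D e x) s q.
  rewrite /D /ccos; eexists.
  apply: cderM; first exact: cder_cst.
  apply: cderM; last exact: cder_cst.
  have l : cder (fun t => 'i%C * ((pi * (e * x)) +i* (pi * t)) : C) s ('i%C * ('i%C * pi%:C)).
    by apply: cder_ext (cderM (cder_cst _ s) (cder_lineY _ _ _)) _; rewrite mul0r add0r.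
  apply: cderD; first exact: cder_cexp l.
  apply: cder_cexp.
  under eq_fun do rewrite -mulN1r.
  by apply: cderM; [exact: cder_cst|exact: l].
have [q h5] := h4.
eexists.
apply: cderD; first exact: cderM h2 h3.
apply: cderM; first exact: h1.
apply: cderM.
  by under eq_fun do rewrite -mulN1r; apply: cderM h5; exact: cder_cst.
apply: cderV; first by rewrite expf_neq0.
by under eq_fun do rewrite expr2; apply: cderM (Ss e x s) (Ss e x s).
Qed.

Let sinE2 (e x : R) : e = 1 \/ e = -1 -> `|sin (pi * (e * x))| = `|sin (pi * x)|.
Proof. by case=> ->; rewrite ?mul1r// mulN1r mulrN sinN normrN. Qed.

Let enorm (e x : R) : e = 1 \/ e = -1 -> `|e * x| = `|x|.
Proof. by case=> ->; rewrite ?mul1r// mulN1r normrN. Qed.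

Let K0 : 0 <= K.
Proof.
have := @dGK 0 0; rewrite normr0 ler01 expr0n addr0 expr1n mulr1 => /(_ isT).
by apply: le_trans; exact: normc_ge0.
Qed.

Let S_neq0 e x s : e = 1 \/ e = -1 -> 0 < x -> x < 1 -> S e x s != 0.
Proof.
move=> e1 x0 x1; apply: csin_neq0; rewrite -normr_gt0 sinE2//.
by rewrite normr_gt0 gt_eqF// sin_pi_gt0.
Qed.

(** Away from the integers $|\sin\pi z|\ge\sin(\pi u_0)\cosh(\pi s)$, and by [poly_ch] the
    hyperbolic cosine beats the polynomial growth of $G$ and its derivative. *)
Let bounds u0 : 0 < u0 -> u0 < 1 -> exists M, forall e x s, e = 1 \/ e = -1 ->
  x \in `]u0, 1 - u0[%R -> normc (f e x s) <= M / (1 + s ^+ 2) /\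
   normc (d e x s) <= M / (1 + s ^+ 2).
Proof.
move=> u00 u01.
have [M' M'0 HM'] := @poly_ch R n.+2.
pose k := sin (pi * u0); have k0 : 0 < k by exact: sin_pi_gt0.
(* The bound for [f] costs $2K/k$, the two terms of [d] cost $K/k$ and $2K\pi/k^2$; their sum serves
   both. *)
exists ((3 * K / k + 2 * K * pi / k ^+ 2) * M') => e x s e1.
rewrite in_itv /= => /andP[ux xv].
have x01 : 0 < x < 1 by apply/andP; split; lra.
have [x0 x1] := andP x01.
set P := 1 + s ^+ 2; set c := ch (pi * s).
have P1 : 1 <= P by rewrite lerDl sqr_ge0.
have c0 : 0 < c := ch_gt0 _.
have PM : P ^+ n.+2 <= M' * c := HM' s.
have kS : k * c <= normc (S e x s).
  apply: le_trans (normc_csin_ge _ _); rewrite sinE2// ler_wpM2r ?(ltW c0)//.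
  rewrite ger0_norm; last exact/ltW/sin_pi_gt0.
  by apply: sin_pi_ge => //; exact: ltW.
have ex1 : `|e * x| <= 1 by rewrite enorm// ger0_norm ltW.
have Pn0 : 0 <= P ^+ n by rewrite exprn_ge0// (le_trans _ P1).
have sP : 1 + `|s| <= 2 * P.
  rewrite /P -[s ^+ 2]real_normK ?num_real//.
  have := sqr_ge0 (`|s| - 1); rewrite sqrrB1 => h; nra.
have GB : normc (G ((e * x) +i* s)) <= 2 * K * P ^+ n.+1.
  apply: (le_trans (GK s ex1)); rewrite -/P.
  have -> : 2 * K * P ^+ n.+1 = K * (2 * P) * P ^+ n by rewrite (exprS P); ring.
  rewrite ler_wpM2r// ler_wpM2l//.
  by apply: le_trans sP; rewrite lerD2r enorm// ger0_norm ltW.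
have kc0 : 0 < k * c by rewrite mulr_gt0.
have SVB : normc (S e x s)^-1 <= (k * c)^-1.
  by rewrite normcV lef_pV2 ?posrE// (lt_le_trans kc0).
have DB : normc (D e x s) <= pi * c.
  rewrite /D normcM normc_real ger0_norm ?pi_ge0//.
  by rewrite ler_wpM2l ?pi_ge0// normc_ccos_le.
have PMc : P ^+ n.+1 * c^-1 <= M' / P.
  rewrite ler_pdivlMr ?(lt_le_trans _ P1)// mulrAC ler_pdivrMr//.
  by rewrite -exprSr.
have P00 : 0 < P by exact: lt_le_trans P1.
have fB : normc (f e x s) <= (2 * K / k) * (M' / P).
  rewrite /f normcM.
  apply: (@le_trans _ _ (2 * K * P ^+ n.+1 * (k * c)^-1)).
    by apply: ler_pM => //; exact: normc_ge0.
  rewrite invfM; have -> : 2 * K * P ^+ n.+1 * (k^-1 * c^-1) = 2 * K / k * (P ^+ n.+1 * c^-1) by ring.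
  by rewrite ler_wpM2l// divr_ge0 ?(ltW k0)// mulr_ge0.
have pk0 : 0 <= 2 * K * pi / k ^+ 2.
  by rewrite divr_ge0 ?sqr_ge0// !mulr_ge0 ?pi_ge0.
have Kk0 : 0 <= K / k by rewrite divr_ge0// (ltW k0).
have MP0 : 0 <= M' / P by rewrite divr_ge0 ?(ltW M'0) ?(ltW P00).
split.
  apply: (le_trans fB).
  have -> : (3 * K / k + 2 * K * pi / k ^+ 2) * M' / P = 2 * K / k * (M' / P) + (K / k + 2 * K * pi / k ^+ 2) *
      (M' / P) by ring.
  by rewrite lerDl mulr_ge0// addr_ge0.
rewrite /d; apply: (le_trans (le_normcD _ _)).
have -> : (3 * K / k + 2 * K * pi / k ^+ 2) * M' / P = K / k * (M' / P) + (2 * K * pi / k ^+ 2) * (M' / P) + 2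
    * (K / k) * (M' / P) by ring.
rewrite (@le_trans _ _ (K / k * (M' / P) + (2 * K * pi / k ^+ 2) * (M' / P)))//; last first.
  by rewrite lerDl mulr_ge0// mulr_ge0.
apply: lerD.
  rewrite normcM.
  apply: (@le_trans _ _ (K * P ^+ n * (k * c)^-1)).
    by apply: ler_pM => //; [exact: normc_ge0|exact: normc_ge0|exact: dGK].
  rewrite invfM; have -> : K * P ^+ n * (k^-1 * c^-1) = K / k * (P ^+ n * c^-1) by ring.
  rewrite ler_wpM2l// (le_trans _ PMc)// ler_wpM2r ?invr_ge0 ?(ltW c0)//.
  by rewrite ler_weXn2l.
rewrite normcM expr2 invfM mulrA 2!normcM normcN.
apply: (@le_trans _ _ (2 * K * P ^+ n.+1 * (pi * c * (k * c)^-1 * (k * c)^-1))).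
  apply: ler_pM; rewrite ?normc_ge0 ?mulr_ge0 ?normc_ge0//.
  apply: ler_pM; rewrite ?normc_ge0 ?mulr_ge0 ?normc_ge0//.
  by apply: ler_pM; rewrite ?normc_ge0.
have -> : 2 * K * P ^+ n.+1 * (pi * c * (k * c)^-1 * (k * c)^-1) = 2 * K * pi / k ^+ 2 * (P ^+ n.+1 * c^-1).
  by field; rewrite (gt_eqF k0) (gt_eqF c0).
by rewrite ler_wpM2l.
Qed.

(** Uniform down to $x=0$, since the zero of $G$ compensates that of the sine: $(x+|s|)\cosh(\pi s)$
    is at most a constant times $(1+s^2)|\sin\pi z|$. The constant [k] is the inverse square of the
    slope in [sin_pi_lin]. This is the domination needed for $x\to0$. *)
Let near0 : exists M, forall e x s, e = 1 \/ e = -1 -> 0 < x -> x <= 4^-1 ->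
  normc (f e x s) <= M / (1 + s ^+ 2).
Proof.
have [M' M'0 HM'] := @poly_ch R n.+2.
pose k := (cos 1 ^+ 2)^-1 : R.
have k0 : 0 < k by rewrite invr_gt0 exprn_gt0// cos1_gt0.
exists (K * (2 * (k + 2)) * M') => e x s e1 x0 x4.
set P := 1 + s ^+ 2; set c := ch (pi * s).
have P1 : 1 <= P by rewrite lerDl sqr_ge0.
have P0 : 0 < P by exact: lt_le_trans P1.
have c0 : 0 < c := ch_gt0 _.
have PM : P ^+ n.+2 <= M' * c := HM' s.
have x1 : x < 1 by lra.
have S0 : 0 < normc (S e x s).
  rewrite lt_neqAle normc_ge0 andbT eq_sym; apply: contra_neq (@S_neq0 e x s e1 x0 x1).
  exact: eq0_normc.
have key : (x + `|s|) * c <= 2 * (k + 2) * P * normc (S e x s).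
  rewrite -(@ler_pXn2r _ 2)// ?nnegrE; last 2 first.
  - by rewrite mulr_ge0 ?(ltW c0)// addr_ge0// ltW.
  - by rewrite !mulr_ge0 ?normc_ge0 ?(ltW P0)// addr_ge0// ltW.
  have xk : x ^+ 2 <= k * sin (pi * (e * x)) ^+ 2.
    rewrite -[X in _ <= _ * X]real_normK ?num_real// sinE2// real_normK ?num_real//.
    rewrite /k ler_pdivlMl ?exprn_gt0 ?cos1_gt0// -exprMn.
    by rewrite lerXn2r ?nnegrE ?sin_pi_lin// ?mulr_ge0 ?ltW ?cos1_gt0 ?sin_pi_gt0.
  rewrite exprMn [X in _ <= X]exprMn normc_csin2 ch2.
  have sh2 := sh2pi_ge s.
  have := sqr_ge0 (sin (pi * (e * x))); move: xk sh2.
  move: (sin (pi * (e * x)) ^+ 2) (sh (pi * s) ^+ 2) => A B xk sB A0.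
  have a1 : (x + `|s|) ^+ 2 <= 2 * (x ^+ 2 + s ^+ 2).
    rewrite -[s ^+ 2]real_normK ?num_real//; have := sqr_ge0 (x - `|s|); nra.
  have x2 : x ^+ 2 <= 1 by rewrite expr_le1// ltW.
  have s2 := sqr_ge0 s.
  have B0 : 0 <= B by exact: le_trans sB.
  have h0 : (x ^+ 2 + s ^+ 2) * (1 + B) <= (k + 2) * P * (A + B).
    rewrite /P.
    have b1 : (x ^+ 2 + s ^+ 2) * (1 + B) = x ^+ 2 + s ^+ 2 + x ^+ 2 * B + s ^+ 2 * B by ring.
    have b2 : x ^+ 2 * B <= B by rewrite ler_piMl.
    have b3 : (k + 2) * (1 + s ^+ 2) * (A + B) = k * A + 2 * A + k * B + 2 * B + k * s ^+ 2 * A + 2 * s ^+ 2 *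
        A + k * s ^+ 2 * B + 2 * (s ^+ 2 * B) by ring.
    have p1 : 0 <= k * s ^+ 2 * A by rewrite mulr_ge0// mulr_ge0// ltW.
    have p2 : 0 <= k * s ^+ 2 * B by rewrite mulr_ge0// mulr_ge0// ltW.
    have p3 : 0 <= s ^+ 2 * B by rewrite mulr_ge0.
    have p4 : 0 <= s ^+ 2 * A by rewrite mulr_ge0.
    have p5 : 0 <= k * B by rewrite mulr_ge0// ltW.
    rewrite b1 b3; lra.
  apply: (@le_trans _ _ (2 * (x ^+ 2 + s ^+ 2) * (1 + B))).
    by rewrite ler_wpM2r// addr_ge0.
  rewrite -mulrA; apply: (@le_trans _ _ (2 * ((k + 2) * P * (A + B)))).
    by rewrite ler_pM2l.
  rewrite mulrA ler_wpM2r ?addr_ge0// mulrA.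
  have q1 : 1 <= 2 * (k + 2) * P.
    rewrite -[X in X <= _]mulr1; apply: ler_pM => //; lra.
  by rewrite expr2 ler_peMr// (le_trans _ q1).
have x11 : `|e * x| <= 1 by rewrite enorm// ger0_norm ltW.
rewrite /f normcM normcV ler_pdivrMr//.
apply: (le_trans (GK s x11)); rewrite enorm// (ger0_norm (ltW x0)) -/P.
rewrite -!mulrA ler_wpM2l//.
rewrite -(ler_pM2r c0).
have -> : (x + `|s|) * P ^+ n * c = P ^+ n * ((x + `|s|) * c) by ring.
apply: (@le_trans _ _ (P ^+ n * (2 * (k + 2) * P * normc (S e x s)))).
  by rewrite ler_pM2l// exprn_gt0.
have -> : P ^+ n * (2 * (k + 2) * P * normc (S e x s)) = P ^+ n.+2 * (2 * (k + 2) * (P^-1 * normc (S e x s))).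
  by rewrite !exprS; field; rewrite (gt_eqF P0).
have -> : 2 * ((k + 2) * (M' * (P^-1 * normc (S e x s)))) * c =
    M' * c * (2 * (k + 2) * (P^-1 * normc (S e x s))) by ring.
rewrite ler_wpM2r// !mulr_ge0 ?invr_ge0 ?normc_ge0 ?(ltW P0)//.
by rewrite addr_ge0// ltW.
Qed.

Let integrable_f e x : e = 1 \/ e = -1 -> 0 < x -> x < 1 ->
  mu.-integrable [set: R] (EFin \o (fun s => complex.Re (f e x s))).
Proof.
move=> e1 x0 x1.
pose u0 := Num.min x (1 - x) / 2.
have u00 : 0 < Num.min x (1 - x) by rewrite lt_min x0 subr_gt0.
have ux : Num.min x (1 - x) <= x by rewrite ge_min lexx.
have uv : Num.min x (1 - x) <= 1 - x by rewrite ge_min lexx orbT.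
have [M HM] := @bounds u0 ltac:(by rewrite /u0 divr_gt0) ltac:(rewrite /u0; lra).
apply: (@integrable_domin _ _ M).
  apply: continuous_measurable_fun.
  by apply: (@cder_continuous_Re _ _ (fun s => 'i%C * d e x s)) => s; apply: fs; apply: S_neq0.
move=> s; apply: le_trans (Re_le_normc _) _.
apply: (HM e x s e1 _).1.
by rewrite in_itv /= /u0; apply/andP; split; lra.
Qed.

Let const_f e x : e = 1 \/ e = -1 -> 0 < x -> x < 2^-1 ->
  \int[mu]_s complex.Re (f e x s) = \int[mu]_s complex.Re (f e 2^-1 s).
Proof.
move=> e1 x0 x1.
have [M HM] := @bounds (x / 2) ltac:(by rewrite divr_gt0) ltac:(lra).
have I0 t : t \in `](x / 2), (1 - x / 2)[%R -> 0 < t < 1.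
  by rewrite in_itv /= => /andP[a b]; apply/andP; split; lra.
have SI t s : t \in `](x / 2), (1 - x / 2)[%R -> S e t s != 0.
  by move=> /I0/andP[? ?]; apply: S_neq0.
pose d2 t s := xget 0 [set q | cder (d e t) s q].
apply: (@shift_line _ (f e) (d e) d2 (x / 2) (1 - x / 2) e M e1); try lra.
- by move=> t s tI; apply: fx; apply: SI.
- by move=> t s tI; apply: fs; apply: SI.
- move=> t s tI; have [q hq] := ds (SI t s tI).
  by rewrite /d2; have := @xgetPex _ 0 [set q | cder (d e t) s q] (ex_intro _ q hq).
- by move=> t s tI; apply: (HM e t s e1 tI).1.
- by move=> t s tI; apply: (HM e t s e1 tI).2.
Qed.

(* The integrand f(1,x,.) - f(-1,x,.) tends to 0 pointwise as x -> 0+ and is dominated, while its integral does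
    not depend on x. *)
Lemma half_lines_Re :
  \int[mu]_s (complex.Re (G (2^-1 +i* s) + G ((- 2^-1) +i* s)) / ch (pi * s)) = 0.
Proof.
have o1 : (1 : R) = 1 \/ (1 : R) = -1 by left.
have o2 : (-1 : R) = 1 \/ (-1 : R) = -1 by right.
(* On the lines $\Re z=\pm1/2$ the sine is $\pm\cosh(\pi s)$, so the difference of the quotients is
   the sum of the two values of $G$ over $\cosh(\pi s)$. *)
have E1 s : complex.Re (f 1 2^-1 s) - complex.Re (f (-1) 2^-1 s) =
    complex.Re (G (2^-1 +i* s) + G ((- 2^-1) +i* s)) / ch (pi * s).
  have c0 := gt_eqF (ch_gt0 (pi * s)).
  have SE e : e = 1 \/ e = -1 -> S e 2^-1 s = (e * ch (pi * s))%:C.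
    rewrite /S csinE; case=> ->; rewrite ?mul1r ?mulN1r ?mulrN ?sinN ?cosN sin_pihalf cos_pihalf mul0r ?mul1r//.
    by rewrite mulN1r.
  rewrite /f !SE// mul1r !mulN1r.
  have V x : (x%:C)^-1 = (x^-1)%:C :> C by rewrite fmorphV.
  move: (ch _) c0 => c c0; rewrite !V !cReM cReD [complex.Re _%:C]/= [complex.Im _%:C]/= !mulr0 !subr0.
  have RR x : complex.Re x%:C = x by [].
  by rewrite !RR mul1r invrN mulrN opprK mulrDl.
transitivity (\int[mu]_s (complex.Re (f 1 2^-1 s) - complex.Re (f (-1) 2^-1 s))).
  by apply: eq_Rintegral => s _; rewrite E1.
rewrite RintegralB//; [|by apply: integrable_f => //; lra..].
(* Starting at $1/4$ keeps the sequence in the range of [near0]. *)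
pose x_ (k : nat) : R := (k.+4)%:R^-1.
have x0 k : 0 < x_ k by rewrite invr_gt0.
have x4 k : x_ k <= 4^-1 by rewrite lef_pV2 ?posrE// ler_nat.
have x2 k : x_ k < 2^-1 by apply: le_lt_trans (x4 k) _; rewrite ltf_pV2 ?posrE// ltr_nat.
have x1 k : x_ k < 1 by apply: lt_trans (x2 k) _; rewrite invf_lt1// ltr1n.
have TE k : \int[mu]_s complex.Re (f 1 2^-1 s) - \int[mu]_s complex.Re (f (-1) 2^-1 s) =
    \int[mu]_s (complex.Re (f 1 (x_ k) s) - complex.Re (f (-1) (x_ k) s)).
  rewrite RintegralB//; [|by apply: integrable_f => //; rewrite ?x1..].
  by rewrite (@const_f 1 (x_ k))// (@const_f (-1) (x_ k)).
have [M HM] := near0.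
pose g k s := complex.Re (f 1 (x_ k) s) - complex.Re (f (-1) (x_ k) s).
have gi k : mu.-integrable [set: R] (EFin \o g k).
  have := @integrableB _ _ _ mu _ measurableT _ _ (integrable_f o1 (x0 k) (x1 k)) (integrable_f o2 (x0 k) (x1 k)).
  by apply: eq_integrable.
have [||||| _ _] := @dominated_convergence _ _ _ mu setT measurableT
  (fun k s => (g k s)%:E) (fun=> 0%E) (EFin \o (fun s => (2 * M) * (1 + s ^+ 2)^-1)).
- by move=> k; exact: measurable_int (gi k).
- exact: measurable_cst.
(* At $s=0$ the sine vanishes in the limit $x=0$; pointwise convergence is claimed only off this
   null set. *)
- exists [set 0]; split; [exact: measurable_set1|exact: lebesgue_measure_set1|].
  move=> s /= /not_implyP[_ h]; apply: contrapT => /eqP s0; apply: h.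
  apply/fine_cvgP; split; first exact: nearW.
  have S0 e : S e 0 s != 0.
    rewrite /S mulr0 mulr0 csinE sin0 cos0 eq_complex /= mul1r negb_and; apply/orP; right.
    rewrite -sqrf_eq0 gt_eqF// (lt_le_trans _ (sh2pi_ge s))//.
    by rewrite exprn_even_gt0.
  have c0 e : complex.Re (f e (x_ k) s) @[k --> \oo] --> complex.Re (f e 0 s).
    have cc : {for 0, continuous (fun t => complex.Re (f e t s))}.
      by apply/differentiable_continuous/derivable1_diffP; case: (fx (S0 e)) => -[].
    apply: (cvg_comp x_ (fun t => complex.Re (f e t s)) _ cc).
    have -> : x_ = (fun n0 => @harmonic R (n0 + 3)%N) by apply/funext => i; rewrite /x_ /= addn3.
    by rewrite cvg_shiftn; exact: cvg_harmonic.
  have E0 : f 1 0 s = f (-1) 0 s by rewrite /f /S !mulr0.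
  by have := cvgB (c0 1) (c0 (-1)); rewrite E0 subrr; exact.
- have := @integrableZl _ _ _ mu _ measurableT (2 * M) _ integrable_oneDsqrV.
  by apply: eq_integrable.
- apply: aeW => s k _ /=; rewrite lee_fin /g.
  apply: (le_trans (ler_normB _ _)).
  rewrite -mulrA mulr_natl mulr2n; apply: lerD; apply: le_trans (Re_le_normc _) _.
  + exact: HM.
  + exact: HM.
rewrite integral_cst// mul0e => /fine_cvgP[_] /= H.
rewrite -(cvg_lim (@Rhausdorff R) H); symmetry; apply: lim_near_cst; first exact: Rhausdorff.
by apply: nearW => k /=; rewrite [RHS](TE k).
Qed.

End Pole.

Section Cint.
Context {R : realType}.
Notation C := R[i].
Notation mu := (@lebesgue_measure R).
Implicit Types (D : set (measurableTypeR R)) (f g : R -> C).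

Definition cintegrable D f :=
  mu.-integrable D (EFin \o (fun s => complex.Re (f s))) /\
  mu.-integrable D (EFin \o (fun s => complex.Im (f s))).

Lemma eq_cintegral D f g : (forall s, D s -> f s = g s) -> cintegral D f = cintegral D g.
Proof.
move=> fg; rewrite /cintegral; congr (_ +i* _); apply: eq_Rintegral => s; rewrite inE => /fg -> //.
Qed.

Lemma eq_cintegrable D f g : measurable D -> (forall s, D s -> f s = g s) ->
  cintegrable D f -> cintegrable D g.
Proof.
move=> mD fg [f1 f2]; split.
  by apply: eq_integrable f1 => // s; rewrite inE => /fg /= ->.
by apply: eq_integrable f2 => // s; rewrite inE => /fg /= ->.
Qed.

Lemma cintegrableD D f g : measurable D -> cintegrable D f -> cintegrable D g ->
  cintegrable D (fun s => f s + g s).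
Proof.
move=> mD [f1 f2] [g1 g2]; split.
  have := integrableD mD f1 g1.
  by apply: eq_integrable => // s _ /=; rewrite cReD.
have := integrableD mD f2 g2.
by apply: eq_integrable => // s _ /=; rewrite cImD.
Qed.

Lemma cintegralD D f g : measurable D -> cintegrable D f -> cintegrable D g ->
  cintegral D (fun s => f s + g s) = cintegral D f + cintegral D g.
Proof.
move=> mD [f1 f2] [g1 g2]; apply: complex_eqP; rewrite ?(cReD, cImD) /cintegral [LHS]/= /=.
  by rewrite -RintegralD//; apply: eq_Rintegral => s _; rewrite cReD.
by rewrite -RintegralD//; apply: eq_Rintegral => s _; rewrite cImD.
Qed.

Lemma cintegrableZ D f (c : C) : measurable D -> cintegrable D f ->
  cintegrable D (fun s => c * f s).
Proof.
move=> mD [f1 f2]; split.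
  have := integrableB mD (integrableZl mD (complex.Re c) f1) (integrableZl mD (complex.Im c) f2).
  by apply: eq_integrable => // s _ /=; rewrite cReM.
have := integrableD mD (integrableZl mD (complex.Re c) f2) (integrableZl mD (complex.Im c) f1).
by apply: eq_integrable => // s _ /=; rewrite cImM.
Qed.

Let intZ D (h : R -> R) (k : R) : measurable D -> mu.-integrable D (EFin \o h) ->
  mu.-integrable D (EFin \o (fun s => k * h s)).
Proof. by move=> mD h1; have := integrableZl mD k h1; apply: eq_integrable. Qed.

Lemma cintegralZ D f (c : C) : measurable D -> cintegrable D f ->
  cintegral D (fun s => c * f s) = c * cintegral D f.
Proof.
move=> mD [f1 f2]; apply: complex_eqP; rewrite ?(cReM, cImM) /cintegral [LHS]/= /=.
  rewrite -RintegralZl// -RintegralZl// -RintegralB//; try exact: intZ.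
  by apply: eq_Rintegral => s _; rewrite cReM.
rewrite -RintegralZl// -RintegralZl// -RintegralD//; try exact: intZ.
by apply: eq_Rintegral => s _; rewrite cImM.
Qed.

Lemma cintegral_sum (I : Type) (r : seq I) D (F : I -> R -> C) : measurable D ->
  (forall i, cintegrable D (F i)) ->
  cintegrable D (fun s => \sum_(i <- r) F i s) /\
  cintegral D (fun s => \sum_(i <- r) F i s) = \sum_(i <- r) cintegral D (F i).
Proof.
move=> mD IF; elim: r => [|i r [IH1 IH2]].
  have e s : \sum_(i <- [::]) F i s = 0 by rewrite big_nil.
  split.
    apply: (@eq_cintegrable _ (fun=> 0)) => [//|s _|]; first by rewrite e.
    by split; exact: integrable0.
  rewrite big_nil (@eq_cintegral _ _ (fun=> 0)); last by move=> s _; exact: e.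
  by rewrite /cintegral /= !Rintegral_cst// !mul0r.
under eq_fun do rewrite big_cons.
split; first exact: cintegrableD.
by rewrite cintegralD// IH2 big_cons.
Qed.

Lemma normc_le_ReIm (z : C) (e : R) : `|complex.Re z| <= e -> `|complex.Im z| <= e -> normc z <= 2 * e.
Proof.
move=> h1 h2; have e0 : 0 <= e by apply: le_trans h1.
rewrite -(@ler_pXn2r _ 2) ?nnegrE ?normc_ge0 ?mulr_ge0//.
rewrite sqr_normcE -(real_normK (num_real (complex.Re z))) -(real_normK (num_real (complex.Im z))).
have h3 : `|complex.Re z| ^+ 2 <= e ^+ 2 by rewrite lerXn2r ?nnegrE.
have h4 : `|complex.Im z| ^+ 2 <= e ^+ 2 by rewrite lerXn2r ?nnegrE.
by rewrite exprMn; have := sqr_ge0 e; lra.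
Qed.

End Cint.

Section Line.
Context {R : realType}.
Notation C := R[i].
Notation mu := (@lebesgue_measure R).
Implicit Types (F : {poly C}) (x s : R).

Lemma cder_horner F (f : R -> C) x a : cder f x a ->
  cder (fun t => F.[f t]) x (a * F^`().[f x]).
Proof.
move=> df; elim/poly_ind: F => [|p c IH].
  under eq_fun do rewrite horner0.
  by rewrite deriv0 horner0 mulr0; exact: cder_cst.
under eq_fun do rewrite hornerMXaddC.
apply: cder_ext (cderD (cderM IH df) (cder_cst c x)) _.
rewrite derivD derivM derivX derivC addr0 mulr1 !hornerE. ring.
Qed.

Lemma sqrt1D_bound s : 1 + `|s| <= 2 * (1 + s ^+ 2).
Proof.
rewrite -[s ^+ 2]real_normK ?num_real//.
by have := sqr_ge0 (`|s| - 1); rewrite sqrrB1 => h; nra.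
Qed.

Lemma normc_rect_le x s : normc (x +i* s) <= `|x| + `|s|.
Proof.
have -> : x +i* s = x%:C + 'i%C * s%:C :> C by apply: complex_eqP; rewrite ?(cReD, cImD, cReM, cImM) /=; ring.
apply: (le_trans (le_normcD _ _)); rewrite normcM !normc_real.
by rewrite /= expr0n expr1n add0r sqrtr1 mul1r.
Qed.

Lemma poly_bound F : exists n K, 0 <= K /\ forall x s, `|x| <= 1 ->
  normc F.[x +i* s] <= K * (1 + s ^+ 2) ^+ n.
Proof.
elim/poly_ind: F => [|p c [n [K [K0 IH]]]].
  by exists 0%N, 0; split => // x s _; rewrite horner0 mul0r normc0.
exists n.+1, (K * 2 + normc c); split; first by rewrite addr_ge0 ?mulr_ge0 ?normc_ge0.
move=> x s x1; rewrite hornerMXaddC.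
apply: (le_trans (le_normcD _ _)); rewrite normcM mulrDl.
have P1 : 1 <= 1 + s ^+ 2 by rewrite lerDl sqr_ge0.
apply: lerD; last by rewrite ler_peMr ?normc_ge0// exprn_ege1.
have -> : K * 2 * (1 + s ^+ 2) ^+ n.+1 = (K * (1 + s ^+ 2) ^+ n) * (2 * (1 + s ^+ 2)) by rewrite (exprS (1 +
    _)); ring.
apply: ler_pM; rewrite ?normc_ge0 ?IH//.
apply: (le_trans (normc_rect_le _ _)); apply: le_trans (sqrt1D_bound s).
by rewrite lerD2r.
Qed.

Lemma normc_cexp x s : normc (cexp (x +i* s) : C) = expR x.
Proof.
have h : normc (cexp (x +i* s)) ^+ 2 = expR x ^+ 2.
  by rewrite cexpE sqr_normcE /= !exprMn -mulrDr cos2Dsin2 mulr1.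
by apply/eqP; rewrite -(@eqrXn2 _ 2)// ?normc_ge0 ?expR_ge0// h.
Qed.

Lemma expR_sub1_bound x : `|expR x - 1| <= `|x| * expR `|x|.
Proof.
have h := expR_ge1Dx x.
have [x0|x0] := ger0P x.
  have h2 := expR_ge1Dx (- x).
  have e1 : expR x * expR (- x) = 1 by exact: expRxMexpNx_1.
  rewrite ger0_norm; last by rewrite subr_ge0 (le_trans _ h)// lerDl.
  have e0 := expR_ge0 x; nra.
have e1 : 1 <= expR (- x) by rewrite (le_trans _ (expR_ge1Dx _))// lerDl oppr_ge0 ltW.
rewrite ler0_norm; last by rewrite subr_le0 expR_le1 ltW.
apply: (@le_trans _ _ (- x)); first by lra.
by rewrite ler_peMr// oppr_ge0 ltW.
Qed.

Lemma sin_le_norm x : `|sin x| <= `|x|.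
Proof.
wlog x0 : x / 0 < x.
  move=> h; have [|x0|<-] := ltgtP 0 x; first exact: h.
    by rewrite -normrN -sinN -(normrN x); apply: h; rewrite oppr_gt0.
  by rewrite sin0 normr0.
have [c _] := @MVT R (@sin R) (@cos R) _ _ x0 (fun t _ => is_derive_sin t)
  (continuous_subspaceT (@continuous_sin R)).
by rewrite sin0 !subr0 => ->; rewrite normrM ler_piMl// cos_max.
Qed.

Lemma cos_sub1_norm x : `|cos x - 1| <= `|x|.
Proof.
wlog x0 : x / 0 < x.
  move=> h; have [|x0|<-] := ltgtP 0 x; first exact: h.
    by rewrite -cosN -(normrN x); apply: h; rewrite oppr_gt0.
  by rewrite cos0 subrr normr0.
have [c _] := @MVT R (@cos R) (fun t => - sin t) _ _ x0 (fun t _ => is_derive_cos t)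
  (continuous_subspaceT (@continuous_cos R)).
by rewrite cos0 !subr0 => ->; rewrite normrM normrN ler_piMl// sin_max.
Qed.

Lemma cexp_sub1_bound x s : normc (cexp (x +i* s) - 1 : C) <=
  expR `|x| * (`|x| + 2 * `|s|).
Proof.
have -> : cexp (x +i* s) - 1 = (expR x)%:C * ((cos s - 1) +i* sin s) + (expR x - 1)%:C :> C.
  by rewrite cexpE; apply: complex_eqP; rewrite !(cReD, cImD, cReM, cImM) /=; ring.
apply: (le_trans (le_normcD _ _)); rewrite normcM !normc_real.
have e1 : `|expR x| <= expR `|x| by rewrite ger0_norm ?expR_ge0// ler_expR ler_norm.
rewrite mulrDr addrC; apply: lerD; first by rewrite mulrC expR_sub1_bound.
apply: ler_pM; rewrite ?normr_ge0 ?normc_ge0//.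
by apply: normc_le_ReIm; [exact: cos_sub1_norm|exact: sin_le_norm].
Qed.

Lemma is_derive_chpi s : is_derive s (1 : R) (fun t => ch (pi * t)) (pi * sh (pi * s)).
Proof.
have h1 : is_derive s (1:R) (fun s => expR (pi * s)) (expR (pi * s) * pi).
  by apply: is_derive1_comp; apply: is_derive_eq; rewrite /GRing.scale /= mulr1.
have h2 : is_derive s (1:R) (fun s => expR (- (pi * s))) (expR (- (pi * s)) * (- pi)).
  by apply: is_derive1_comp; apply: is_derive_eq; rewrite /GRing.scale /= mulr1.
rewrite /ch /sh; apply: is_derive_eq.
by rewrite /GRing.scale /=; ring.
Qed.

(** An antiderivative is $\frac2\pi\arctan(e^{\pi s})$. It grows from $1/2$ to $1$ on the half-line,
    and evenness doubles this. *)
Lemma integral_sech : \int[mu]_s (ch (pi * s))^-1 = 1.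
Proof.
have cont : continuous (fun s : R => (ch (pi * s))^-1).
  move=> s; apply/differentiable_continuous/derivable1_diffP.
  by have [] := @is_deriveV _ (fun t => ch (pi * t)) s _ 1 (lt0r_neq0 (ch_gt0 _)) (is_derive_chpi s).
rewrite /Rintegral ge0_symfun_integralT; [|by move=> s; rewrite invr_ge0 ltW ?ch_gt0|exact:
    cont|by move=> s /=; rewrite mulrN chN].
rewrite -set_itvcy.
pose F s : R := (pi / 2)^-1 * atan (expR (pi * s)).
have p0 : (pi : R) != 0 by rewrite gt_eqF// pi_gt0.
have dF s : is_derive s (1 : R) F ((ch (pi * s))^-1).
  have h1 : is_derive s (1:R) (fun s => expR (pi * s)) (expR (pi * s) * pi).
    by apply: is_derive1_comp; apply: is_derive_eq; rewrite /GRing.scale /= mulr1.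
  have h2 : is_derive s (1:R) (fun s => atan (expR (pi * s))) ((1 + expR (pi * s) ^+ 2)^-1 * (expR (pi * s) * pi)).
    exact: is_derive1_comp.
  rewrite /F; apply: is_derive_eq; move: (@pi R) p0 => p p0.
  rewrite /GRing.scale /= /ch expRN; have := expR_gt0 (p * s).
  set E := expR _ => E0; have E1 : 1 + E ^+ 2 != 0 by rewrite gt_eqF// ltr_pwDl ?sqr_ge0.
  by field; rewrite p0 (gt_eqF E0) -expr2 (addrC _ 1) E1.
have cF : continuous F by move=> s; apply/differentiable_continuous/derivable1_diffP; case: (dF s).
rewrite (@ge0_continuous_FTC2y _ _ F 0 1).
- rewrite /F mulr0 expR0 atan1 -EFinB -EFinM; move: (@pi R) p0 => p p0 /=.
  by field.
- by move=> s _; rewrite invr_ge0 ltW ?ch_gt0.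
- exact: continuous_subspaceT.
- have -> : (1 : R) = (pi / 2)^-1 * (pi / 2) by rewrite mulVf// mulf_neq0// invr_eq0 pnatr_eq0.
  apply: cvgM; first exact: cvg_cst.
  apply: (@cvg_comp _ _ _ (fun s => expR (pi * s)) (@atan R) _ _ _ _ (@cvgy_atan R)).
  apply: (@ger_cvgy _ _ _ _ (fun s : R => s)); last exact: cvg_id.
  near=> s; apply: le_trans (expR_ge1Dx _); rewrite addrC ler_wpDr//.
  by rewrite ler_peMl ?(le_trans _ (@pi_ge2 R)) ?ler1n//; near: s; exact: nbhs_pinfty_ge.
- by move=> s _; case: (dF s).
- by apply: cvg_at_right_filter; exact: cF.
- by move=> s _; rewrite derive1E; exact: derive_val.
Unshelve. all: end_near. Qed.

End Line.

Section Lint.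
Local Opaque cexp ch sh.
Context {R : realType}.
Notation C := R[i].
Notation mu := (@lebesgue_measure R).
Variable lam : R.
Implicit Types (F : {poly C}) (x s : R).

Definition gl F (z : C) : C := F.[z] * cexp (z * lam%:C).
(* On the lines [Re z = x] with half-integer [x], [csin (pi z)] is [ch (pi s)] up to sign. *)
Definition lint (x : R) F : C :=
  cintegral setT (fun s => gl F (x +i* s) * ((ch (pi * s))^-1)%:C).

Lemma cder_gl F (f : R -> C) t a : cder f t a ->
  cder (fun t => gl F (f t)) t (a * gl (F^`() + lam%:C *: F) (f t)).
Proof.
move=> df; rewrite /gl.
have h : cder (fun t => f t * lam%:C) t (a * lam%:C).
  by apply: cder_ext (cderM df (cder_cst _ t)) _; rewrite mulr0 addr0.
apply: cder_ext (cderM (cder_horner F df) (cder_cexp h)) _.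
by rewrite hornerD hornerZ; ring.
Qed.

Lemma cder_x s x : cder (fun t => t +i* s : C) x 1.
Proof.
have h := @cder_lineX R 1 s x.
by move: h; under eq_fun do rewrite mul1r.
Qed.

Lemma cder_y x s : cder (fun t => x +i* t : C) s 'i%C.
Proof.
have h := @cder_lineY R 1 x s.
by move: h; under eq_fun do rewrite mul1r; rewrite mulr1.
Qed.

Lemma mul_lam x s : (x +i* s) * lam%:C = (x * lam) +i* (s * lam).
Proof. by apply: complex_eqP; rewrite ?(cReM, cImM) /=; ring. Qed.

Lemma gl_bound F : exists n K, 0 <= K /\ forall x s, `|x| <= 1 ->
  normc (gl F (x +i* s)) <= K * (1 + s ^+ 2) ^+ n.
Proof.
have [n [K [K0 HK]]] := poly_bound F.
exists n, (K * expR `|lam|); split; first by rewrite mulr_ge0 ?expR_ge0.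
move=> x s x1; rewrite /gl normcM mul_lam normc_cexp mulrAC.
apply: ler_pM; rewrite ?normc_ge0 ?expR_ge0 ?HK//.
rewrite ler_expR (le_trans (ler_norm _))// normrM ler_piMl//.
Qed.

Lemma lint_integrable x F :
  cintegrable setT (fun s => gl F (x +i* s) * ((ch (pi * s))^-1)%:C).
Proof.
(* [gl_bound] covers only $|x|\le1$, so $F$ is recentred at $x$ and the bound is used on the line
   $\Re z=0$. *)
have [n [K [K0 HK]]] := gl_bound (F \Po ('X + (x%:C)%:P)).
have [M M0 HM] := @poly_ch R n.+1.
pose E := expR (x * lam).
have HB s : normc (gl F (x +i* s) * ((ch (pi * s))^-1)%:C) <= (E * K * M) / (1 + s ^+ 2).
  have P0 : 0 < 1 + s ^+ 2 by rewrite ltr_pwDl ?sqr_ge0.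
  have c0 := ch_gt0 (pi * s).
  have eq1 : gl F (x +i* s) = cexp ((x * lam)%:C) * gl (F \Po ('X + (x%:C)%:P)) (0 +i* s).
    rewrite /gl horner_comp hornerD hornerX hornerC.
    have -> : (0 +i* s) + x%:C = x +i* s :> C by apply: complex_eqP; rewrite ?(cReD, cImD) /= ?add0r ?addr0.
    rewrite [RHS]mulrCA -cexpD; congr (_ * cexp _).
    by apply: complex_eqP; rewrite !(cReD, cImD, cReM, cImM) /=; ring.
  rewrite normcM normc_real ger0_norm ?invr_ge0 ?(ltW c0)// eq1 normcM normc_cexp -/E.
  rewrite ler_pdivlMr// -!mulrA ler_pM2l ?expR_gt0//.
  have h := HK 0 s; rewrite normr0 ler01 in h.
  apply: (@le_trans _ _ (K * (1 + s ^+ 2) ^+ n * ((ch (pi * s))^-1 * (1 + s ^+ 2)))).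
    by rewrite ler_wpM2r ?h// mulr_ge0 ?invr_ge0 ?ltW.
  rewrite -mulrA ler_wpM2l// mulrCA mulrC -exprSr ler_pdivrMr//.
have dd s : cder (fun s => gl F (x +i* s) * ((ch (pi * s))^-1)%:C) s
  ('i%C * gl (F^`() + lam%:C *: F) (x +i* s) * ((ch (pi * s))^-1)%:C + gl F (x +i* s) *
   (- (ch (pi * s)) ^- 2 *: (pi * sh (pi * s)))%:C).
  apply: cderM; first exact: cder_gl (cder_y _ _).
  split => /=; last exact: is_derive_cst.
  exact: (@is_deriveV _ (fun t => ch (pi * t)) s _ 1 (lt0r_neq0 (ch_gt0 _)) (is_derive_chpi s)).
split.
  apply: integrable_domin; first exact: (continuous_measurable_fun (cder_continuous_Re dd)).
  by move=> s; apply: le_trans (Re_le_normc _) (HB s).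
apply: integrable_domin; first exact: (continuous_measurable_fun (cder_continuous_Im dd)).
by move=> s; apply: le_trans (Im_le_normc _) (HB s).
Qed.

Lemma glD F G z : gl (F + G) z = gl F z + gl G z.
Proof. by rewrite /gl hornerD mulrDl. Qed.

Lemma glZ c F z : gl (c *: F) z = c * gl F z.
Proof. by rewrite /gl hornerZ mulrA. Qed.

Lemma lintD x F G : lint x (F + G) = lint x F + lint x G.
Proof.
rewrite /lint -cintegralD; [|exact: measurableT|exact: lint_integrable..].
by apply: eq_cintegral => s _; rewrite glD mulrDl.
Qed.

Lemma lintZ x c F : lint x (c *: F) = c * lint x F.
Proof.
rewrite /lint -cintegralZ; [|exact: measurableT|exact: lint_integrable].
by apply: eq_cintegral => s _; rewrite glZ mulrA.
Qed.

Lemma poly_split F : exists Q, F = Q * 'X + (F.[0])%:P.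
Proof.
elim/poly_ind: F => [|p c _]; first by exists 0; rewrite horner0 mul0r add0r.
by exists p; rewrite hornerMXaddC mulr0 add0r.
Qed.

(** Subtracting $c=F(0)$ makes the numerator vanish at 0, so [half_lines_Re] gives 0 for the
    difference; the subtracted constant contributes $2c\int ds/\cosh(\pi s)=2c$. *)
Lemma lint_half_Re F :
  complex.Re (lint 2^-1 F + lint (- 2^-1) F) = complex.Re (2 * F.[0]).
Proof.
have [Q QE] := poly_split F.
set c := F.[0] in QE *.
pose G (z : C) := gl F z - c.
have [n1 [K1 [K10 HK1]]] := gl_bound Q.
have [n2 [K2 [K20 HK2]]] := gl_bound (F^`() + lam%:C *: F).
pose n := (n1 + n2)%N.
have le_pw m s : (m <= n)%N -> (1 + s ^+ 2) ^+ m <= (1 + s ^+ 2) ^+ n.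
  by move=> mn; rewrite ler_weXn2l// lerDl sqr_ge0.
pose K := K1 + K2 + normc c * (expR `|lam| * (2 * `|lam|)).
have c0 : 0 <= normc c * (expR `|lam| * (2 * `|lam|)).
  by rewrite !mulr_ge0 ?normc_ge0 ?expR_ge0.
have H := @half_lines_Re R G (gl (F^`() + lam%:C *: F))
  (fun x s => 'i%C * gl ((F^`() + lam%:C *: F)^`() + lam%:C *: (F^`() + lam%:C *: F)) (x +i* s)) n K.
have {}H : \int[mu]_s (complex.Re (G (2^-1 +i* s) + G ((- 2^-1) +i* s)) / ch (pi * s)) = 0.
  apply: H.
  - move=> x s; rewrite /G; apply: cder_ext (cderD (cder_gl F (cder_x s x)) (cder_cst (- c) x)) _.
    by rewrite mul1r addr0.
  - move=> x s; rewrite /G; apply: cder_ext (cderD (cder_gl F (cder_y x s)) (cder_cst (- c) s)) _.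
    by rewrite addr0.
  - by move=> x s; apply: cder_gl (cder_y x s).
  - move=> x s x1.
    have -> : G (x +i* s) = gl Q (x +i* s) * (x +i* s) + c * (cexp ((x +i* s) * lam%:C) - 1).
      by rewrite /G /gl [in LHS]QE hornerMXaddC; ring.
    apply: (le_trans (le_normcD _ _)); rewrite (normcM (gl Q _)) (normcM c).
    set P := 1 + s ^+ 2; set A := `|x| + `|s|.
    have A0 : 0 <= A by rewrite addr_ge0.
    have P1 : 1 <= P ^+ n by rewrite exprn_ege1// lerDl sqr_ge0.
    have h1 : normc (gl Q (x +i* s)) * normc (x +i* s) <= K1 * A * P ^+ n.
      rewrite [X in _ <= X]mulrAC; apply: ler_pM; rewrite ?normc_ge0 ?normc_rect_le//.
      by apply: (le_trans (HK1 x s x1)); rewrite ler_wpM2l// le_pw// leq_addr.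
    have h2 : normc (cexp ((x +i* s) * lam%:C) - 1) <= expR `|lam| * (2 * `|lam|) * A.
      rewrite mul_lam; apply: (le_trans (cexp_sub1_bound _ _)).
      rewrite -mulrA; apply: ler_pM; rewrite ?expR_ge0 ?addr_ge0 ?mulr_ge0//.
        by rewrite ler_expR normrM ler_piMl.
      by rewrite !normrM /A; have := mulr_ge0 (normr_ge0 x) (normr_ge0 lam); lra.
    have h3 : normc c * normc (cexp ((x +i* s) * lam%:C) - 1) <= normc c * (expR `|lam| * (2 * `|lam|)) * A * P ^+ n.
      apply: (@le_trans _ _ (normc c * (expR `|lam| * (2 * `|lam|)) * A)).
        by rewrite -mulrA ler_wpM2l// normc_ge0.
      by rewrite ler_peMr// mulr_ge0.
    apply: (le_trans (lerD h1 h3)); rewrite -!mulrDl ler_wpM2r ?(le_trans _ P1)// ler_wpM2r//.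
    by rewrite /K lerD2r lerDl.
  - move=> x s x1; apply: (le_trans (HK2 x s x1)).
    apply: ler_pM; rewrite ?exprn_ge0 ?addr_ge0 ?sqr_ge0//; last by rewrite le_pw// leq_addl.
    by rewrite /K -addrA addrCA lerDl addr_ge0.
have hI x := (lint_integrable x F).1.
have lRe x : complex.Re (lint x F) = \int[mu]_s complex.Re (gl F (x +i* s) * ((ch (pi * s))^-1)%:C) by [].
have sI : mu.-integrable setT (EFin \o (fun s => (ch (pi * s))^-1)).
  have := (lint_integrable 0 1).1.
  have [M M0 HM] := @poly_ch R 1.
  move=> _; apply: (@integrable_domin _ _ M).
    apply: continuous_measurable_fun => s; apply/differentiable_continuous/derivable1_diffP.
    by have [] := @is_deriveV _ (fun t => ch (pi * t)) s _ 1 (lt0r_neq0 (ch_gt0 _)) (is_derive_chpi s).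
  move=> s; have := HM s; rewrite expr1 => h.
  have P0 : 0 < 1 + s ^+ 2 by rewrite ltr_pwDl ?sqr_ge0.
  by rewrite ger0_norm ?invr_ge0 ?(ltW (ch_gt0 _))// ler_pdivlMr// mulrC ler_pdivrMr// ch_gt0.
rewrite cReD !lRe -RintegralD; [|exact: measurableT|exact: hI..].
have -> : complex.Re (2 * c) = \int[mu]_s (complex.Re (2 * c) * (ch (pi * s))^-1).
  by rewrite RintegralZl// integral_sech mulr1.
apply/eqP; rewrite -subr_eq0; apply/eqP.
rewrite -RintegralB//; first last.
- have := integrableZl measurableT (complex.Re (2 * c)) sI; exact: eq_integrable.
- have := integrableD measurableT (hI 2^-1) (hI (- 2^-1)); exact: eq_integrable.
rewrite -[RHS]H; apply: eq_Rintegral => s _.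
have RR y z : complex.Re (y * z%:C) = complex.Re y * z :> R by rewrite cReM /= mulr0 subr0.
have R2 : complex.Re (2 * c) = 2 * complex.Re c by rewrite mulr_natl mulr2n cReD mulr_natl mulr2n.
by rewrite !RR R2 /G !(cReD, cReN); ring.
Qed.

(** The imaginary part is the real part for $-\mathrm iF$. *)
Lemma lint_half F : lint 2^-1 F + lint (- 2^-1) F = 2 * F.[0].
Proof.
apply: complex_eqP; first exact: lint_half_Re.
have := lint_half_Re ((- 'i%C) *: F).
rewrite !lintZ hornerZ -mulrDr mulrCA.
by rewrite !(cReM (- 'i%C)) /= oppr0 !mul0r !sub0r !mulN1r !opprK.
Qed.

Lemma lint_trans m x F : lint (m + x) F = cexp (m%:C * lam%:C) * lint x (F \Po ('X + (m%:C)%:P)).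
Proof.
rewrite /lint -cintegralZ; [|exact: measurableT|exact: lint_integrable].
apply: eq_cintegral => s _; rewrite mulrA; congr (_ * _).
rewrite /gl horner_comp hornerD hornerX hornerC.
have -> : (x +i* s) + m%:C = (m + x) +i* s :> C by apply: complex_eqP; rewrite ?(cReD, cImD) /= ?add0r ?addr0// addrC.
rewrite [RHS]mulrCA -cexpD; congr (_ * cexp _).
by apply: complex_eqP; rewrite !(cReD, cImD, cReM, cImM) /=; ring.
Qed.

Lemma lint_half_at m F :
  lint (m + 2^-1) F + lint (m - 2^-1) F = 2 * gl F m%:C.
Proof.
rewrite !lint_trans -mulrDr lint_half horner_comp hornerD hornerX hornerC add0r /gl.
by move: (cexp _) => E; ring.
Qed.

End Lint.

(** * Inversion of the walk step by a line integral *)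

Section Inverse.
Local Opaque cexp ch sh.
Context {R : realType}.
Notation C := R[i].
Variable b : R.
Hypothesis b01 : 0 < b < 1.
Implicit Types (F : {poly C}) (n : nat).

Let lam : R := - ln ((1 - b) / b).

(** The factor $(z-x_2+1)_{t_2-1}$ of the integrand, for $n=t_2-1$ and in the variable $z-x_2$. *)
Definition rising n : {poly C} := \prod_(i < n) ('X + (i.+1%:R)%:P).

(* The normalized z-integral of the kernel as a functional of the polynomial
   factor; [line_fun0] and [line_funS] say that it undoes [n.+1] steps of the walk. *)
Definition line_fun n F : C :=
  (-1) ^+ n * ((1 - b)%:C ^- n.+1) / (n`!)%:R / 2 *
  lint lam (- n.+1%:R + 2^-1) (rising n * F).

Let b0 : 0 < b. Proof. by case/andP: b01. Qed.
Let b1 : 0 < 1 - b. Proof. by rewrite subr_gt0; case/andP: b01. Qed.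

Let cexp_lam : cexp (1%:C * lam%:C) = (b / (1 - b))%:C :> C.
Proof.
rewrite mul1r; have -> : lam%:C = lam +i* 0 by [].
rewrite cexpE cos0 sin0 mulr1 mulr0 /lam -lnV ?posrE ?divr_gt0//.
by rewrite lnK ?posrE ?invr_gt0 ?divr_gt0// invf_div.
Qed.

Let lint_shift x F : lint lam x (F \Po ('X + 1%:P)) = ((1 - b) / b)%:C * lint lam (1 + x) F.
Proof.
rewrite (lint_trans lam 1 x F) cexp_lam mulrA -rmorphM /=.
have -> : (1 - b) / b * (b / (1 - b)) = 1 by field; rewrite !gt_eqF.
by rewrite mul1r.
Qed.

Let bb : b%:C * ((1 - b) / b)%:C = 1 - b%:C :> C.
Proof. by rewrite -rmorphM /= mulrC divfK ?gt_eqF// rmorphB. Qed.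

(** The choice of [lam] makes a shift of the polynomial by 1 equal to a move of the line by 1 with
    factor $(1-b)/b$. The two terms of the step thus acquire the same coefficient $1-b$ on the lines
    $\mp1/2$, and [lint_half] yields the value at 0. *)
Lemma line_fun0 F : line_fun 0 (step_poly b%:C F) = F.[0].
Proof.
rewrite /line_fun /rising big_ord0 mul1r expr0 mul1r divr1 /step_poly lintD !lintZ lint_shift.
have -> : 1 + (- 1 + 2^-1) = 2^-1 :> R by lra.
have -> : - 1 + 2^-1 = - 2^-1 :> R by lra.
have -> : b%:C * (((1 - b) / b)%:C * lint lam 2^-1 F) = (1 - b%:C) * lint lam 2^-1 F.
  by rewrite mulrA bb.
rewrite -mulrDr (addrC (lint _ (- _) _)) lint_half expr1 rmorphB /=.
have h : 1 - b%:C != 0 :> C by rewrite -(rmorph1 (real_complex R)) -rmorphB fmorph_eq0 gt_eqF.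
by field.
Qed.

(** [rising n.+1] vanishes at $-(n+1)$, so there is no residue between the neighbouring lines and
    their integrals are opposite. After the shift the other term carries $X\cdot$[rising n]; since
    [rising n.+1] is $(X+n+1)\cdot$[rising n], only $n+1$ times the integral of [rising n]
    survives. *)
Lemma line_funS n F : line_fun n.+1 (step_poly b%:C F) = line_fun n F.
Proof.
rewrite /line_fun /step_poly mulrDr -!scalerAr lintD !lintZ.
have q1 : rising n.+1 = rising n * ('X + (n.+1%:R)%:P) by rewrite /rising big_ord_recr.
have q2 : rising n.+1 = ('X * rising n) \Po ('X + 1%:P).
  rewrite comp_polyM comp_polyX /rising big_ord_recl mulr1n rmorph_prod /=; congr (_ * _).
  apply: eq_bigr => i _; rewrite comp_polyD comp_polyX comp_polyC -addrA -polyCD.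
  by congr ('X + _%:P); rewrite nat1r.
have q3 : rising n.+1 * (F \Po ('X + 1%:P)) = ('X * rising n * F) \Po ('X + 1%:P) by rewrite comp_polyM -q2.
rewrite q3 lint_shift.
have e1 : 1 + (- n.+2%:R + 2^-1) = - n.+1%:R + 2^-1 :> R by rewrite -[n.+2]addn1 natrD; lra.
have e2 : - n.+2%:R + 2^-1 = - n.+1%:R - 2^-1 :> R by rewrite -[n.+2]addn1 natrD; lra.
rewrite e1 e2.
have h := lint_half_at lam (- n.+1%:R) (rising n.+1 * F).
have g0 : gl lam (rising n.+1 * F) (- n.+1%:R)%:C = 0.
  by rewrite /gl q1 !hornerM hornerD hornerX hornerC rmorphN /= rmorph_nat addNr mulr0 !mul0r.
move: h; rewrite g0 mulr0 => /eqP; rewrite addrC addr_eq0 => /eqP ->.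
have -> : rising n.+1 * F = 'X * rising n * F + n.+1%:R *: (rising n * F).
  by rewrite q1 -mul_polyC; ring.
rewrite lintD lintZ.
set A := lint lam _ ('X * _ * _); set B := lint lam _ (rising n * F).
have -> : b%:C * (((1 - b) / b)%:C * A) = (1 - b%:C) * A.
  by rewrite mulrA bb.
have h : 1 - b%:C != 0 :> C by rewrite -(rmorph1 (real_complex R)) -rmorphB fmorph_eq0 gt_eqF.
have f0 : (n`!)%:R != 0 :> C by rewrite pnatr_eq0 -lt0n fact_gt0.
have n0 : n.+1%:R != 0 :> C by rewrite pnatr_eq0.
rewrite factS natrM rmorphB /= !exprS; move: (n.+1%:R) n0 => k n0.
have hn : (1 - b%:C) ^+ n != 0 :> C by rewrite expf_neq0.
by field; rewrite hn f0 n0 h.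
Qed.
End Inverse.

(** * Cauchy's formula on circles *)

Section Cauchy.
Local Opaque cexp ch sh.
Context {R : realType}.
Notation C := R[i].
Notation mu := (@lebesgue_measure R).
Implicit Types (c q w z : C) (r x s : R) (P Q : {poly C}).

Local Notation D := (`[0%R, (2 * pi)%R]%classic : set (measurableTypeR R)).
Lemma circle_domain_measurable : measurable D. Proof. exact: measurable_itv. Qed.

Lemma pi2_gt0 : 0 < 2 * pi :> R. Proof. by rewrite mulr_gt0// pi_gt0. Qed.

Lemma circle_domain0 : D 0.
Proof. by rewrite /= in_itv; apply/andP; split; [exact: lexx|exact: ltW pi2_gt0]. Qed.

Lemma circle_domain_length : (mu : {measure set (measurableTypeR R) -> \bar R}) D = (2 * pi)%:E.
Proof. by rewrite /= lebesgue_measure_itv /= lte_fin pi2_gt0 -EFinB subr0. Qed.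

Lemma normc_triangle_sub z w : normc z - normc w <= normc (z - w).
Proof. by rewrite lerBlDr; have := le_normcD (z - w) w; rewrite subrK. Qed.

Lemma normc_sum (I : Type) (l : seq I) (F : I -> C) :
  normc (\sum_(i <- l) F i) <= \sum_(i <- l) normc (F i).
Proof.
elim: l => [|i l IH]; first by rewrite !big_nil normc0.
by rewrite !big_cons (le_trans (le_normcD _ _))// lerD2l.
Qed.

Lemma normcX z n : normc (z ^+ n) = normc z ^+ n.
Proof. by elim: n => [|n IH]; rewrite ?expr0 ?normc1// !exprS normcM IH. Qed.

Lemma circle_integrable (h : R -> C) (B : R) :
  measurable_fun D (fun s => complex.Re (h s)) ->
  measurable_fun D (fun s => complex.Im (h s)) ->
  (forall s, D s -> normc (h s) <= B) -> cintegrable D h.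
Proof.
have K (g : R -> R) : measurable_fun D g -> (forall s, D s -> `|g s| <= B) ->
    mu.-integrable D (EFin \o g).
  move=> mg gB; apply: measurable_bounded_integrable => //.
    by rewrite circle_domain_length ltry.
  exists B; split; first exact: num_real.
  by move=> y By s Ds; apply: le_trans (gB s Ds) (ltW By).
by move=> m1 m2 hB; split; apply: K => // s Ds; [exact: le_trans (Re_le_normc _) (hB s Ds)|exact:
    le_trans (Im_le_normc _) (hB s Ds)].
Qed.

Lemma circle_integral_bound (h : R -> C) (B : R) : cintegrable D h ->
  (forall s, D s -> normc (h s) <= B) -> normc (cintegral D h) <= 2 * (2 * pi * B).
Proof.
have K (g : R -> R) : mu.-integrable D (EFin \o g) -> (forall s, D s -> `|g s| <= B) ->
    `|\int[mu]_(s in D) g s| <= 2 * pi * B.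
  move=> ig gB; apply: (le_trans (le_normr_Rintegral circle_domain_measurable ig)).
  rewrite (_ : 2 * pi * B = \int[mu]_(s in D) B); last first.
    by rewrite Rintegral_cst// circle_domain_length /= mulrC.
  apply: le_Rintegral => //; first exact: integrable_norm ig.
  apply: measurable_bounded_integrable => //; [by rewrite circle_domain_length ltry|].
  exists B; split; first exact: num_real.
  by move=> y By s _ /=; rewrite (le_trans _ (ltW By))// ger0_norm// (le_trans (normr_ge0 (g 0)))// gB//;
      exact: circle_domain0.
move=> [h1 h2] hB; apply: normc_le_ReIm; apply: K => // s Ds.
  exact: le_trans (Re_le_normc _) (hB s Ds).
exact: le_trans (Im_le_normc _) (hB s Ds).
Qed.

Lemma cder_measurable (h dh : R -> C) : (forall s, cder h s (dh s)) ->
  measurable_fun D (fun s => complex.Re (h s)) /\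
  measurable_fun D (fun s => complex.Im (h s)).
Proof.
move=> hd; split; apply: measurable_funTS; apply: continuous_measurable_fun.
  exact: cder_continuous_Re hd.
exact: cder_continuous_Im hd.
Qed.

Lemma cintegral_FTC (h H dh : R -> C) : (forall s, cder H s (h s)) ->
  (forall s, cder h s (dh s)) -> cintegral D h = H (2 * pi) - H 0.
Proof.
move=> hH hd.
have K (f F : R -> R) : continuous f -> (forall x : R, is_derive x (1 : R) F (f x)) ->
    \int[mu]_(s in D) f s = F (2 * pi) - F 0.
  move=> cf dF; rewrite /Rintegral (@continuous_FTC2 _ f F) ?pi2_gt0//.
  - exact: continuous_subspaceT.
  - have cF : continuous F by move=> x; apply/differentiable_continuous/derivable1_diffP; case: (dF x).
    split=> //; first by apply: cvg_at_right_filter; exact: cF.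
    by apply: cvg_at_left_filter; exact: cF.
  - by move=> x _; rewrite derive1E; apply: derive_val.
apply: complex_eqP; rewrite ?(cReD, cImD, cReN, cImN) [LHS]/=.
  by apply: (K (fun s => complex.Re (h s)) (fun s => complex.Re (H s))) => [|s]; [exact:
      cder_continuous_Re hd|case: (hH s)].
by apply: (K (fun s => complex.Im (h s)) (fun s => complex.Im (H s))) => [|s]; [exact:
    cder_continuous_Im hd|case: (hH s)].
Qed.

Definition expi (s : R) : C := cexp ('i%C * s%:C).

Lemma expiE s : expi s = cos s +i* sin s.
Proof.
have e : 'i%C * s%:C = 0 +i* s :> C by apply: complex_eqP; rewrite ?(cReM, cImM) /=; ring.
by rewrite /expi e cexpE expR0 !mul1r.
Qed.

Lemma normc_expi s : normc (expi s) = 1.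
Proof. by rewrite expiE /= cos2Dsin2 sqrtr1. Qed.

Lemma expi_neq0 s : expi s != 0.
Proof. by apply/eqP => h; have := normc_expi s; rewrite h normc0 => /eqP; rewrite eq_sym oner_eq0. Qed.

Lemma cder_expi s : cder expi s ('i%C * expi s).
Proof.
apply: cder_cexp; split => /=.
  have -> : (fun t : R => 0 * t - 1 * 0) = cst 0 by apply/funext => t; rewrite /= mul0r mulr0 subr0.
  exact: is_derive_cst.
have -> : (fun t : R => 0 * 0 + 1 * t) = id by apply/funext => t; rewrite mul0r mul1r add0r.
exact: is_derive_id.
Qed.

Lemma expi2pi : expi (2 * pi) = 1.
Proof. by rewrite expiE mulr_natl cos2pi sin2pi. Qed.

Lemma expi0 : expi 0 = 1.
Proof. by rewrite expiE cos0 sin0. Qed.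

Lemma cderX (f : R -> C) x a n : cder f x a ->
  cder (fun t => f t ^+ n) x (n%:R * a * f x ^+ n.-1).
Proof.
move=> df.
have h := cder_horner 'X^n df.
move: h; under eq_fun do rewrite hornerXn.
by rewrite derivXn hornerMn hornerXn -mulr_natl mulrCA mulrA.
Qed.

Lemma i_neq0 : ('i%C : C) != 0.
Proof. by rewrite eq_complex /= oner_eq0 andbF. Qed.

Let cder_expi_pow n s : cder (fun t => expi t ^+ n) s (n%:R * 'i%C * expi s ^+ n).
Proof.
apply: cder_ext (cderX n (cder_expi s)) _.
by case: n => [|n]; rewrite ?mul0r//= exprS; ring.
Qed.

Let cder_expi_powV n s : cder (fun t => expi t ^- n) s (- n%:R * 'i%C * expi s ^- n).
Proof.
apply: cder_ext (cderV (expf_neq0 n (expi_neq0 s)) (cder_expi_pow n s)) _.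
have := expf_neq0 n (expi_neq0 s); move: (expi s ^+ n) => E E0.
by field.
Qed.

Lemma integral_expi_pow n : cintegral D (fun s => expi s ^+ n.+1) = 0.
Proof.
have k0 : n.+1%:R * 'i%C != 0 :> C by rewrite mulf_neq0 ?pnatr_eq0// i_neq0.
rewrite (@cintegral_FTC _ (fun s => (n.+1%:R * 'i%C)^-1 * expi s ^+ n.+1) _ _ (cder_expi_pow n.+1)).
  by rewrite expi2pi expi0 subrr.
move=> s; apply: cder_ext (cderM (cder_cst _ s) (cder_expi_pow n.+1 s)) _.
by rewrite mul0r add0r mulrA mulVf// mul1r.
Qed.

Lemma integral_expi_powV n : cintegral D (fun s => expi s ^- n.+1) = 0.
Proof.
have k0 : - n.+1%:R * 'i%C != 0 :> C by rewrite mulf_neq0 ?oppr_eq0 ?pnatr_eq0// i_neq0.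
rewrite (@cintegral_FTC _ (fun s => (- n.+1%:R * 'i%C)^-1 * expi s ^- n.+1) _ _ (cder_expi_powV n.+1)).
  by rewrite expi2pi expi0 subrr.
move=> s; apply: cder_ext (cderM (cder_cst _ s) (cder_expi_powV n.+1 s)) _.
by rewrite mul0r add0r mulrA mulVf// mul1r.
Qed.

Lemma integral_cst (a : C) : cintegral D (fun=> a) = a * (2 * pi)%:C.
Proof.
apply: complex_eqP; rewrite ?(cReM, cImM) [LHS]/= Rintegral_cst// circle_domain_length.
  by rewrite [X in _ = _ - _ * X]/= mulr0 subr0.
by rewrite [X in _ = _ * X + _]/= mulr0 add0r.
Qed.

Lemma eps_le0 (x K : R) : 0 <= K -> (forall e, 0 < e -> x <= K * e) -> x <= 0.
Proof.
move=> K0 h; apply/ler_addgt0Pl => e e0; rewrite addr0.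
have K1 : 0 < K + 1 by rewrite ltr_pwDr.
apply: (le_trans (h (e / (K + 1)) _)); first by rewrite divr_gt0.
by rewrite mulrA ler_pdivrMr// mulrC ler_pM2l// lerDl.
Qed.

Lemma pow_small (x e : R) : 0 <= x -> x < 1 -> 0 < e -> exists n, x ^+ n <= e.
Proof.
move=> x0 x1 e0.
have h : (x ^+ n) @[n --> \oo] --> (0 : R) by apply: cvg_expr; rewrite ger0_norm.
have /cvgrPdist_le /(_ _ e0) [n _ H] := h.
exists n; have := H n (leqnn n); rewrite sub0r normrN ger0_norm ?exprn_ge0//.
Qed.

(** Expand in powers of $ze^{-is}$: only the constant term has a nonzero integral, and the remainder
    is at most $|z|^{n+1}/(1-|z|)$. *)
Lemma integral_geometric (z : C) : normc z < 1 ->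
  cintegral D (fun s => (1 - z * (expi s)^-1)^-1) = (2 * pi)%:C.
Proof.
move=> z1.
have nz s : normc (z * (expi s)^-1) = normc z by rewrite normcM normcV normc_expi invr1 mulr1.
have d0 s : 1 - z * (expi s)^-1 != 0.
  rewrite subr_eq0; apply/eqP => h; have := nz s; rewrite -h normc1 => h1.
  by rewrite -h1 ltxx in z1.
have d1 s : 1 - normc z <= normc (1 - z * (expi s)^-1).
  by rewrite -[X in X - _](@normc1 R) -(nz s) normc_triangle_sub.
have z1' : 0 < 1 - normc z by rewrite subr_gt0.
have dV s : normc (1 - z * (expi s)^-1)^-1 <= (1 - normc z)^-1.
  by rewrite normcV lef_pV2 ?posrE// (lt_le_trans z1').
have cd s : cder (fun s => (1 - z * (expi s)^-1)^-1) s
    (- (0 + (-1) * (0 * (expi s)^-1 + z * (- ('i%C * expi s) / expi s ^+ 2))) / (1 - z * (expi s)^-1) ^+ 2).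
  apply: cderV; first exact: d0.
  apply: cderD; first exact: cder_cst.
  have -> : (fun t => - (z * (expi t)^-1)) = (fun t => (-1) * (z * (expi t)^-1)).
    by apply/funext => t; rewrite mulN1r.
  apply: cder_ext (cderM (cder_cst _ s) (cderM (cder_cst _ s) (cderV (expi_neq0 s) (cder_expi s)))) _.
  by rewrite [0 * (z * _)]mul0r add0r.
have [m1 m2] := cder_measurable cd.
have I0 : cintegrable D (fun s => (1 - z * (expi s)^-1)^-1).
  exact: (circle_integrable m1 m2 (fun s _ => dV s)).
have In n (a : C) : cintegrable D (fun s => a * expi s ^- n).
  have [n1 n2] := cder_measurable (fun s => cderM (cder_cst a s) (cder_expi_powV n s)).
  apply: (circle_integrable n1 n2 (B := normc a)) => s _.
  by rewrite normcM normcV normcX normc_expi expr1n invr1 mulr1.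
have part n : cintegral D (fun s => \sum_(k <- iota 0 n.+1) z ^+ k * expi s ^- k) = (2 * pi)%:C.
  have [_ ->] := @cintegral_sum _ _ (iota 0 n.+1) D (fun k s => z ^+ k * expi s ^- k) circle_domain_measurable
      (fun k => In k _).
  rewrite /= big_cons expr0 big1_seq ?addr0.
    by under eq_cintegral do rewrite expr0 invr1 mulr1; rewrite integral_cst mul1r.
  move=> k /andP[_]; rewrite mem_iota => /andP[k0 _].
  case: k k0 => // k _; rewrite cintegralZ ?integral_expi_powV ?mulr0//.
  by have := In k.+1 1; apply: eq_cintegrable => // s _; rewrite mul1r.
apply/eqP; rewrite -subr_eq0; apply/eqP/eq0_normc/eqP; rewrite eq_le normc_ge0 andbT.
have pi4 : 0 <= 2 * (2 * pi * (1 - normc z)^-1) by rewrite !mulr_ge0 ?pi_ge0// invr_ge0 ltW.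
apply: (eps_le0 pi4) => e e0.
have [n zn] := pow_small (normc_ge0 z) z1 e0.
rewrite -(part n) -mulN1r -cintegralZ//; last first.
  by have [] := @cintegral_sum _ _ (iota 0 n.+1) D (fun k s => z ^+ k * expi s ^- k) circle_domain_measurable
      (fun k => In k _).
rewrite -cintegralD//; last first.
  by apply: cintegrableZ => //; have [] := @cintegral_sum _ _ (iota 0 n.+1) D (fun k s => z ^+ k * expi s ^- k)
      circle_domain_measurable (fun k => In k _).
have -> : 2 * (2 * pi * (1 - normc z)^-1) * e = 2 * (2 * pi * (e / (1 - normc z))) by ring.
have EQ s : (1 - z * (expi s)^-1)^-1 + -1 * \sum_(k <- iota 0 n.+1) z ^+ k * expi s ^- k
    = (z * (expi s)^-1) ^+ n.+1 * (1 - z * (expi s)^-1)^-1.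
  have -> : \sum_(k <- iota 0 n.+1) z ^+ k * expi s ^- k = \sum_(k < n.+1) (z * (expi s)^-1) ^+ k.
    rewrite -[iota 0 n.+1]/(index_iota 0 n.+1) big_mkord; apply: eq_bigr => k _.
    by rewrite [RHS]exprMn exprVn.
  have := subrX1 (z * (expi s)^-1) n.+1; move: (d0 s); set x := z * (expi s)^-1.
  set S := \sum_(k < n.+1) x ^+ k => x0 h.
  apply: (mulIf x0); rewrite mulrDl mulVf// divfK//.
  have -> : x ^+ n.+1 = 1 + (x - 1) * S by rewrite -h addrC subrK.
  by ring.
apply: circle_integral_bound.
  apply: cintegrableD => //; apply: cintegrableZ => //.
  by have [] := @cintegral_sum _ _ (iota 0 n.+1) D (fun k s => z ^+ k * expi s ^- k) circle_domain_measurable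
      (fun k => In k _).
move=> s _; rewrite EQ normcM normcX nz; apply: ler_pM; rewrite ?normc_ge0 ?exprn_ge0 ?normc_ge0//.
by apply: le_trans zn; rewrite exprS ler_piMl ?exprn_ge0 ?normc_ge0// ltW.
Qed.
End Cauchy.

(** * Cauchy's formula for uniform limits of polynomials *)

Section Approx.
Context {R : realType}.
Notation C := R[i].
Notation mu := (@lebesgue_measure R).
Implicit Types (c q w z : C) (r x s e : R) (P Q : {poly C}) (F G : C -> C).
Local Notation D := (`[0%R, (2 * pi)%R]%classic : set (measurableTypeR R)).

(* For uniform limits of polynomials Cauchy's formula follows from explicit
   integrals of powers and of the geometric series. *)
Definition disk_limit c r F := forall e : R, 0 < e ->
  exists P, forall w, normc (w - c) <= r -> normc (F w - P.[w]) <= e.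

Lemma poly_disk_bound c r P : exists B, 0 <= B /\ forall w, normc (w - c) <= r -> normc P.[w] <= B.
Proof.
elim/poly_ind: P => [|p a [B [B0 HB]]].
  by exists 0; split => // w _; rewrite horner0 normc0.
exists (B * (`|r| + normc c) + normc a); split.
  by rewrite addr_ge0 ?mulr_ge0 ?addr_ge0 ?normc_ge0.
move=> w wr; rewrite hornerMXaddC; apply: (le_trans (le_normcD _ _)).
rewrite lerD2r normcM; apply: ler_pM; rewrite ?normc_ge0 ?HB//.
rewrite -[w](subrK c); apply: (le_trans (le_normcD _ _)); rewrite lerD2r.
exact: le_trans wr (ler_norm _).
Qed.

Lemma disk_limit_bound c r F : disk_limit c r F ->
  exists B, 0 <= B /\ forall w, normc (w - c) <= r -> normc (F w) <= B.
Proof.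
move=> /(_ 1 ltr01) [P HP]; have [B [B0 HB]] := poly_disk_bound c r P.
exists (1 + B); split; first by rewrite addr_ge0.
move=> w wr; rewrite -[F w](subrK P.[w]); apply: (le_trans (le_normcD _ _)).
by apply: lerD; [exact: HP|exact: HB].
Qed.

Lemma disk_limit_poly c r P : disk_limit c r (fun w => P.[w]).
Proof. by move=> e e0; exists P => w _; rewrite subrr normc0 ltW. Qed.

Lemma disk_limit_ext c r F G : (forall w, normc (w - c) <= r -> F w = G w) ->
  disk_limit c r F -> disk_limit c r G.
Proof. by move=> FG h e e0; have [P HP] := h e e0; exists P => w wr; rewrite -FG// HP. Qed.

Lemma disk_limitM c r F G : disk_limit c r F -> disk_limit c r G ->
  disk_limit c r (fun w => F w * G w).
Proof.
move=> hF hG e e0.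
have [B [B0 HB]] := disk_limit_bound hG.
have B1 : 0 < B + 1 by rewrite ltr_pwDr.
(* [P] is fixed first, because the accuracy demanded of [Q] depends on a bound for [P]; adding 1
   keeps the divisors positive. *)
have [P HP] := hF (e / 2 / (B + 1)) ltac:(by rewrite !divr_gt0).
have [B' [B'0 HB']] := poly_disk_bound c r P.
have B'1 : 0 < B' + 1 by rewrite ltr_pwDr.
have [Q HQ] := hG (e / 2 / (B' + 1)) ltac:(by rewrite !divr_gt0).
exists (P * Q) => w wr.
have -> : F w * G w - (P * Q).[w] = (F w - P.[w]) * G w + P.[w] * (G w - Q.[w]).
  by rewrite hornerM; ring.
apply: (le_trans (le_normcD _ _)); rewrite !normcM (splitr e).
apply: lerD.
  apply: (@le_trans _ _ (e / 2 / (B + 1) * B)).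
    by apply: ler_pM; rewrite ?normc_ge0 ?HP ?HB.
  by rewrite mulrAC ler_pdivrMr// ler_pM2l ?divr_gt0// lerDl.
rewrite mulrC; apply: (@le_trans _ _ (e / 2 / (B' + 1) * B')).
  by apply: ler_pM; rewrite ?normc_ge0 ?HQ ?HB'.
by rewrite mulrAC ler_pdivrMr// ler_pM2l ?divr_gt0// lerDl.
Qed.

(** Geometric series about the centre, with ratio at most $r/|q-c|<1$ on the disk. *)
Lemma disk_limit_inv c r q : 0 < r -> r < normc (q - c) -> disk_limit c r (fun w => (w - q)^-1).
Proof.
move=> r0 rd e e0; set d := normc (q - c) in rd.
have d0 : 0 < d by exact: lt_trans rd.
have dr : 0 < d - r by rewrite subr_gt0.
have x1 : r / d < 1 by rewrite ltr_pdivrMr// mul1r.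
have x0 : 0 <= r / d by rewrite divr_ge0// ltW.
have [n hn] := pow_small x0 x1 (mulr_gt0 e0 dr).
have qc : q - c != 0 by apply/eqP => h; move: d0; rewrite /d h normc0 ltxx.
exists (- \sum_(k < n) ((q - c) ^- k.+1) *: ('X - c%:P) ^+ k) => w wr.
have wq : w - q != 0.
  rewrite subr_eq0; apply/eqP => h; move: wr; rewrite h -/d => h2.
  by have := lt_le_trans rd h2; rewrite ltxx.
set x := (w - c) / (q - c).
have -> : (w - q)^-1 - (- \sum_(k < n) ((q - c) ^- k.+1) *: ('X - c%:P) ^+ k).[w] = x ^+ n / (w - q).
  rewrite hornerN opprK horner_sum.
  have -> : \sum_(i < n) ((q - c) ^- i.+1 *: ('X - c%:P) ^+ i).[w] = (q - c)^-1 * \sum_(i < n) x ^+ i.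
    rewrite big_distrr /=; apply: eq_bigr => i _.
    by rewrite hornerZ horner_exp hornerXsubC /x [in RHS]exprMn exprVn exprS invfM; ring.
  have h := subrX1 x n; set S := \sum_(i < n) _ in h *.
  have -> : x ^+ n = 1 + (x - 1) * S by rewrite -h addrC subrK.
  have -> : x - 1 = (w - q) / (q - c) by rewrite /x; field.
  by field; rewrite qc wq.
have wqd : d - r <= normc (w - q).
  have := normc_triangle_sub (q - c) (w - c); rewrite -/d => h.
  have -> : normc (w - q) = normc (q - c - (w - c)) by rewrite -normcN; congr normc; ring.
  by apply: le_trans h; rewrite lerD2l lerN2.
rewrite normcM normcX normcV ler_pdivrMr ?(lt_le_trans dr)//.
apply: (@le_trans _ _ (e * (d - r))); last by rewrite ler_pM2l.
apply: le_trans hn; rewrite lerXn2r ?nnegrE ?normc_ge0//.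
by rewrite /x normcM normcV -/d ler_pM2r ?invr_gt0.
Qed.

(** Measurability along the circle is obtained as a pointwise limit from the approximating
    polynomials; the bound comes from [disk_limit_bound]. *)
Lemma disk_limit_integrable c r F (k dk : R -> C) B : 0 < r -> disk_limit c r F ->
  (forall s, cder k s (dk s)) -> (forall s, normc (k s) <= B) ->
  cintegrable D (fun s => F (c + r%:C * expi s) * k s).
Proof.
move=> r0 hF dk0 kB.
have on_c s : normc (c + r%:C * expi s - c) <= r.
  by rewrite addrC addKr normcM normc_real normc_expi mulr1 gtr0_norm.
have [B' [B'0 HB']] := disk_limit_bound hF.
have B0 : 0 <= B := le_trans (normc_ge0 _) (kB 0).
have [P_ HP_] : exists P_ : nat -> {poly C}, forall n w, normc (w - c) <= r -> normc (F w - (P_ n).[w]) <= n.+1%:R^-1.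
  have h n : exists P, forall w, normc (w - c) <= r -> normc (F w - P.[w]) <= n.+1%:R^-1 by apply: hF;
      rewrite invr_gt0.
  by have [P_ h2] := choice h; exists P_.
have dw s : cder (fun s => c + r%:C * expi s) s (r%:C * ('i%C * expi s)).
  apply: cder_ext (cderD (cder_cst c s) (cderM (cder_cst _ s) (cder_expi s))) _.
  by rewrite add0r mul0r add0r.
pose h_ n s := (P_ n).[c + r%:C * expi s] * k s.
have dh n s : exists q, cder (h_ n) s q.
  by eexists; apply: cderM; [exact: cder_horner (dw s)|exact: dk0].
have [dh_ Hdh] : exists dh_ : nat -> R -> C, forall n s, cder (h_ n) s (dh_ n s).
  have h n : exists g : R -> C, forall s, cder (h_ n) s (g s) by have [g hg] := choice (dh n); exists g.
  by have [g h2] := choice h; exists g.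
have cv s : (forall e, 0 < e -> exists N : nat, forall n, (N <=
    n)%N -> normc (h_ n s - F (c + r%:C * expi s) * k s) <= e).
  move=> e e0.
  have B1 : 0 < B + 1 by rewrite ltr_pwDr.
  have h0 : @harmonic R n @[n --> \oo] --> (0 : R) by exact: cvg_harmonic.
  have /cvgrPdist_le /(_ _ (divr_gt0 e0 B1)) [N _ HN] := h0.
  exists N => n Nn; have {HN} := HN n Nn; rewrite sub0r normrN ger0_norm ?invr_ge0// => HN.
  rewrite /h_ -mulrBl normcM.
  apply: (@le_trans _ _ (e / (B + 1) * B)); last by rewrite mulrAC ler_pdivrMr// ler_pM2l// lerDl.
  apply: ler_pM; rewrite ?normc_ge0 ?kB//.
  by rewrite -normcN opprB; apply: le_trans HN; apply: HP_.
apply: (@circle_integrable _ _ (B' * B)).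
- apply: (@measurable_fun_cvg _ _ _ D (fun n s => complex.Re (h_ n s))).
    by move=> n; exact: (cder_measurable (Hdh n)).1.
  move=> s _; apply/cvgrPdist_le => e e0; have [N HN] := cv s e e0; exists N => // n /= Nn.
  apply: le_trans (HN n Nn); rewrite -normcN opprB; apply: le_trans (Re_le_normc _).
  by rewrite cReD cReN.
- apply: (@measurable_fun_cvg _ _ _ D (fun n s => complex.Im (h_ n s))).
    by move=> n; exact: (cder_measurable (Hdh n)).2.
  move=> s _; apply/cvgrPdist_le => e e0; have [N HN] := cv s e e0; exists N => // n /= Nn.
  apply: le_trans (HN n Nn); rewrite -normcN opprB; apply: le_trans (Im_le_normc _).
  by rewrite cImD cImN.
- by move=> s _; rewrite normcM; apply: ler_pM; rewrite ?normc_ge0 ?HB'.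
Qed.

Section Formula.
Variables (c q : C) (r : R).
Hypothesis qr : normc (q - c) < r.

Let r0 : 0 < r. Proof. exact: le_lt_trans (normc_ge0 _) qr. Qed.
Let rC : r%:C != 0 :> C. Proof. by rewrite fmorph_eq0 gt_eqF. Qed.
(** On the circle $w-q=re^{is}(1-ze^{-is})$ with $|z|<1$, which leads to [integral_geometric]. *)
Let z := (q - c) / r%:C.
Let z1 : normc z < 1.
Proof. by rewrite /z normcM normcV normc_real ger0_norm ?ltW// ltr_pdivrMr// mul1r. Qed.

(* [r i e^{is} / (w(s) - q)], for [w(s) = c + r e^{is}] on the circle *)
Let k s : C := 'i%C * (1 - z * (expi s)^-1)^-1.

Let kE s : (c + r%:C * expi s - q)^-1 * (r%:C * 'i%C * expi s) = k s.
Proof.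
have e0 := @expi_neq0 R s.
have -> : c + r%:C * expi s - q = r%:C * expi s * (1 - z * (expi s)^-1).
  by rewrite /z; move: (expi s) e0 => E e0; field; rewrite e0 rC.
rewrite /k; move: (expi s) e0 => E e0; rewrite 2!invfM.
set A := (1 - z / E)^-1.
by field; rewrite e0 rC.
Qed.

Let d0 s : 1 - z * (expi s)^-1 != 0.
Proof.
rewrite subr_eq0; apply/eqP => h; have : normc (z * (expi s)^-1) = normc z.
  by rewrite normcM normcV normc_expi invr1 mulr1.
by rewrite -h normc1 => h1; move: z1; rewrite -h1 ltxx.
Qed.

Let kB s : normc (k s) <= (1 - normc z)^-1.
Proof.
rewrite /k normcM /= expr0n expr1n add0r sqrtr1 mul1r normcV.
have z1' : 0 < 1 - normc z by rewrite subr_gt0.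
have nz : normc (z * (expi s)^-1) = normc z by rewrite normcM normcV normc_expi invr1 mulr1.
have h : 1 - normc z <= normc (1 - z * (expi s)^-1).
  by rewrite -[X in X - _](@normc1 R) -nz normc_triangle_sub.
by rewrite lef_pV2 ?posrE// (lt_le_trans z1').
Qed.

Let kd s : exists d, cder k s d.
Proof.
rewrite /k; eexists; apply: cderM; first exact: cder_cst.
apply: cderV; first exact: d0.
apply: cderD; first exact: cder_cst.
under eq_fun do rewrite -mulN1r.
by apply: cderM; [exact: cder_cst|apply: cderM; [exact: cder_cst|apply: cderV; [exact: expi_neq0|exact: cder_expi]]].
Qed.

Let kI F : disk_limit c r F -> cintegrable D (fun s => F (c + r%:C * expi s) * k s).
Proof.
by have [dk hk] := choice kd => hF; exact: (disk_limit_integrable r0 hF hk kB).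
Qed.

Let k_int : cintegral D k = (2 * pi)%:C * 'i%C.
Proof.
have h := kI (disk_limit_poly c r 1%:P).
have {}h : cintegrable D k by apply: eq_cintegrable h => [|s _]; [exact:
    circle_domain_measurable|rewrite hornerC mul1r].
have h2 : cintegrable D (fun s => (1 - z * (expi s)^-1)^-1).
  have := cintegrableZ (-'i%C) (@circle_domain_measurable R) h.
  apply: eq_cintegrable => [|s _]; first exact: circle_domain_measurable.
  by rewrite /k mulrA mulNr -expr2 sqr_i opprK mul1r.
by rewrite /k cintegralZ; [rewrite integral_geometric 1?mulrC | exact: circle_domain_measurable | exact: h2].
Qed.

Let poly_cauchy0 P : cintegral D (fun s => P.[c + r%:C * expi s] * (r%:C * 'i%C * expi s)) = 0.
Proof.
pose Q := P \Po ('X + c%:P).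
pose f (j : nat) (s : R) : C := (Q`_j * r%:C ^+ j.+1 * 'i%C) * expi s ^+ j.+1.
have EX s : P.[c + r%:C * expi s] * (r%:C * 'i%C * expi s) = \sum_(j <- iota 0 (size Q)) f j s.
  have -> : P.[c + r%:C * expi s] = Q.[r%:C * expi s] by rewrite /Q horner_comp hornerD hornerX hornerC addrC.
  have -> : iota 0 (size Q) = index_iota 0 (size Q) by rewrite /index_iota subn0.
  rewrite horner_coef big_mkord big_distrl; apply: eq_bigr => j _ /=.
  by rewrite /f (exprMn j (r%:C)) !exprS; move: (expi s) => E; ring.
have cd n s : cder (fun t => expi t ^+ n) s (n%:R * ('i%C * expi s) * expi s ^+ n.-1).
  by apply: cderX; exact: cder_expi.
have I1 n : cintegrable D (fun s => expi s ^+ n).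
  have [m1 m2] := cder_measurable (cd n).
  by apply: (circle_integrable m1 m2 (B := 1)) => s _; rewrite normcX normc_expi expr1n.
rewrite (@eq_cintegral _ _ _ (fun s => \sum_(j <- iota 0 (size Q)) f j s)); last by move=> s _; exact: EX.
have [_ ->] := @cintegral_sum _ _ (iota 0 (size Q)) D f (@circle_domain_measurable R)
  (fun j => cintegrableZ _ (@circle_domain_measurable R) (I1 j.+1)).
rewrite big1// => j _; rewrite cintegralZ ?integral_expi_pow ?mulr0//; exact: circle_domain_measurable.
Qed.

(** Writing $P=Q\cdot(X-q)+P(q)$ leaves a polynomial, whose circle integral is 0, plus the constant
    case. *)
Let poly_cauchy P : cintegral D (fun s => P.[c + r%:C * expi s] * k s) = (2 * pi)%:C * 'i%C * P.[q].
Proof.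
have [Q PQ] : exists Q, P = Q * ('X - q%:P) + P.[q]%:P.
  have : root (P - P.[q]%:P) q by rewrite rootE hornerD hornerN hornerC subrr.
  by move=> /factor_theorem [Q hQ]; exists Q; rewrite -hQ subrK.
have EX s : P.[c + r%:C * expi s] * k s = Q.[c + r%:C * expi s] * (r%:C * 'i%C * expi s) + P.[q] * k s.
  rewrite [in LHS]PQ hornerD hornerC hornerM hornerXsubC mulrDl; congr (_ + _).
  rewrite -kE -(mulrA Q.[_]) mulVKf//.
  apply/eqP => h; have := kE s; rewrite h invr0 mul0r /k => /esym/eqP.
  by rewrite mulf_eq0 (negbTE i_neq0) invr_eq0 (negbTE (d0 s)).
have h1 := kI (disk_limit_poly c r 1%:P).
have {}h1 : cintegrable D k by apply: eq_cintegrable h1 => [|s _]; [exact: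
    circle_domain_measurable|rewrite hornerC mul1r].
have h2 := kI (disk_limit_poly c r P).
rewrite (@eq_cintegral _ _ _ (fun s => Q.[c + r%:C * expi s] * (r%:C * 'i%C * expi s) + P.[q] * k s));
    last by move=> s _; exact: EX.
have mD := @circle_domain_measurable R.
rewrite cintegralD//.
- by rewrite poly_cauchy0 add0r cintegralZ// k_int mulrC.
- have h3 := cintegrableD mD h2 (cintegrableZ (- P.[q]) mD h1).
  by apply: eq_cintegrable h3 => // s _; rewrite EX mulNr addrK.
- exact: cintegrableZ.
Qed.

Lemma cauchy_integrable F : disk_limit c r F ->
  cintegrable D (fun s => F (c + r%:C * expi s) / (c + r%:C * expi s - q) * (r%:C * 'i%C * expi s)).
Proof.
move=> /kI; apply: eq_cintegrable => [|s _]; first exact: circle_domain_measurable.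
by rewrite -kE [LHS]mulrA.
Qed.

(** Both sides move by at most a constant times $e$ when $F$ moves by $e$ uniformly on the disk, so
    the polynomial case suffices. *)
Lemma cauchy_formula F : disk_limit c r F ->
  circle_integral c r (fun w => F w / (w - q)) = (2 * pi)%:C * 'i%C * F q.
Proof.
move=> hF.
have -> : circle_integral c r (fun w => F w / (w - q)) = cintegral D (fun s => F (c + r%:C * expi s) * k s).
  by apply: eq_cintegral => s _; rewrite -kE [RHS]mulrA.
have z1' : 0 < 1 - normc z by rewrite subr_gt0.
have K0 : 0 <= 2 * (2 * pi * (1 - normc z)^-1) + 2 * pi.
  by rewrite addr_ge0 ?mulr_ge0 ?pi_ge0 ?invr_ge0 ?mulr_ge0 ?pi_ge0 ?(ltW z1').
apply/eqP; rewrite -subr_eq0; apply/eqP/eq0_normc/eqP; rewrite eq_le normc_ge0 andbT.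
apply: (eps_le0 K0) => e e0; have [P HP] := hF e e0.
have on_c s : normc (c + r%:C * expi s - c) <= r.
  by rewrite addrC addKr normcM normc_real normc_expi mulr1 gtr0_norm.
have h1 := kI hF; have h2 := kI (disk_limit_poly c r P).
have -> : cintegral D (fun s => F (c + r%:C * expi s) * k s) - (2 * pi)%:C * 'i%C * F q =
  cintegral D (fun s => F (c + r%:C * expi s) * k s + (-1) * (P.[c + r%:C * expi s] * k s)) +
   (2 * pi)%:C * 'i%C * (P.[q] - F q).
  rewrite cintegralD//; last exact: cintegrableZ.
  by rewrite cintegralZ// poly_cauchy; ring.
apply: (le_trans (le_normcD _ _)); rewrite [X in _ <= X]mulrDl; apply: lerD.
  have -> : 2 * (2 * pi * (1 - normc z)^-1) * e = 2 * (2 * pi * (e * (1 - normc z)^-1)) by ring.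
  apply: circle_integral_bound; first by apply: cintegrableD => //; exact: cintegrableZ.
  move=> s _; rewrite mulN1r -mulrBl normcM; apply: ler_pM; rewrite ?normc_ge0 ?kB//.
  exact: HP.
rewrite 2!normcM normc_real ger0_norm ?mulr_ge0 ?pi_ge0//.
have -> : normc ('i%C : C) = 1 by rewrite /= expr0n expr1n add0r sqrtr1.
rewrite mulr1 ler_wpM2l ?mulr_ge0 ?pi_ge0//.
by rewrite -normcN opprB HP// ltW.
Qed.
End Formula.

Lemma cauchy_theorem_integrable c r F : 0 < r -> disk_limit c r F ->
  cintegrable D (fun s => F (c + r%:C * expi s) * (r%:C * 'i%C * expi s)).
Proof.
move=> r0 hF.
have h := disk_limitM hF (disk_limit_poly c r ('X - c%:P)).
have qr : normc (c - c) < r by rewrite subrr normc0.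
have := cauchy_integrable qr h; apply: eq_cintegrable => [|s _]; first exact: circle_domain_measurable.
congr (_ * _); rewrite hornerXsubC mulfK//.
rewrite addrC addKr mulf_neq0 ?fmorph_eq0 ?(gt_eqF r0)//; exact: expi_neq0.
Qed.

(** Cauchy's formula at the centre for $F(w)(w-c)$, which vanishes there. *)
Lemma cauchy_theorem c r F : 0 < r -> disk_limit c r F -> circle_integral c r F = 0.
Proof.
move=> r0 hF.
have h := disk_limitM hF (disk_limit_poly c r ('X - c%:P)).
have qr : normc (c - c) < r by rewrite subrr normc0.
have := cauchy_formula qr h; rewrite hornerXsubC subrr !mulr0 => <-.
apply: eq_cintegral => s _; congr (_ * _); rewrite hornerXsubC mulfK//.
rewrite addrC addKr mulf_neq0 ?fmorph_eq0 ?(gt_eqF r0)//; exact: expi_neq0.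
Qed.

End Approx.

(** * Polynomial approximation of the exponential and the sine quotient *)

Section Entire.
Context {R : realType}.
Notation C := R[i].
Implicit Types (c q w z u h : C) (r x y s e : R) (P Q : {poly C}).

Lemma expR_taylor2 x : `|expR x - 1 - x| <= x ^+ 2 * expR `|x|.
Proof.
have key (f : R -> R) : f 0 = 0 -> (forall t : R, is_derive t (1 : R) f (expR t - 1)) ->
    `|f x| <= x ^+ 2 * expR `|x|.
  move=> f0 df.
  have cf a b : {within `[a, b], continuous f}.
    apply: continuous_subspaceT => t; apply/differentiable_continuous/derivable1_diffP.
    by case: (df t).
  have bd t : `|t| <= `|x| -> `|expR t - 1| <= `|x| * expR `|x|.
    move=> tx; apply: le_trans (expR_sub1_bound t) _.
    by apply: ler_pM; rewrite ?expR_ge0// ler_expR.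
  have [x0|x0|<-] := ltgtP 0 x.
  - have [t] := @MVT R f _ _ _ x0 (fun t _ => df t) (cf _ _).
    rewrite in_itv /= => /andP[t0 tx]; rewrite f0 !subr0 => ->.
    rewrite normrM -[x ^+ 2]real_normK ?num_real// mulrC expr2 -mulrA ler_wpM2l//.
    by apply: bd; rewrite !gtr0_norm// ltW.
  - have [t] := @MVT R f _ _ _ x0 (fun t _ => df t) (cf _ _).
    rewrite in_itv /= => /andP[tx t0]; rewrite f0 !sub0r => h.
    rewrite -normrN h normrM normrN -[x ^+ 2]real_normK ?num_real// mulrC expr2 -mulrA ler_wpM2l//.
    by apply: bd; rewrite !ltr0_norm// lerN2 ltW.
  - by rewrite f0 normr0 mulr_ge0 ?sqr_ge0 ?expR_ge0.
apply: (key (fun x => expR x - 1 - x)); first by rewrite expR0 !subr0 subrr.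
by move=> t; apply: is_derive_eq; rewrite subr0.
Qed.

Lemma cos_sub1_sq y : `|cos y - 1| <= y ^+ 2.
Proof.
have -> : cos y - 1 = - (2 * sin (y / 2) ^+ 2).
  have -> : cos y = cos ((y / 2) *+ 2) by congr cos; rewrite -mulr_natr divfK.
  by rewrite cos_mulr2n cos2sin2 -mulr_natl; ring.
rewrite normrN normrM gtr0_norm// normrX.
have h := sin_le_norm (y / 2).
have h2 : `|sin (y / 2)| ^+ 2 <= `|y / 2| ^+ 2 by rewrite lerXn2r ?nnegrE.
apply: (@le_trans _ _ (2 * `|y / 2| ^+ 2)); first by rewrite ler_pM2l.
rewrite real_normK ?num_real// expr_div_n.
by have := sqr_ge0 y; lra.
Qed.

Lemma sin_taylor2 y : `|sin y - y| <= y ^+ 2.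
Proof.
wlog y0 : y / 0 < y.
  move=> hw; have [|y0|<-] := ltgtP 0 y; first exact: hw.
    have := hw (- y); rewrite oppr_gt0 sinN sqrrN => /(_ y0).
    have -> : - sin y - - y = - (sin y - y) by ring.
    by rewrite normrN.
  by rewrite sin0 subrr normr0 sqr_ge0.
have df (t : R) : is_derive t (1 : R) (fun t => sin t - t) (cos t - 1).
  by apply: is_derive_eq.
have cf : {within `[0, y], continuous (fun t => sin t - t)}.
  apply: continuous_subspaceT => t; apply/differentiable_continuous/derivable1_diffP.
  by case: (df t).
have [t] := @MVT R _ _ _ _ y0 (fun t _ => df t) cf.
rewrite in_itv /= => /andP[t0 ty]; rewrite sin0 !subr0 => ->.
rewrite normrM (gtr0_norm y0) expr2 ler_pM2r//.
by apply: (le_trans (cos_sub1_norm t)); rewrite gtr0_norm// ltW.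
Qed.

(** The three pieces are bounded by $2$, $2$ and $1$ times $e|h|^2$; the 7 leaves room. *)
Lemma cexp_taylor2 h : normc h <= 1 -> normc (cexp h - 1 - h) <= (7 * expR 1) * normc h ^+ 2.
Proof.
case: h => x y h1.
have nx : `|x| <= normc (x +i* y) by exact: (Re_le_normc (x +i* y)).
have ny : `|y| <= normc (x +i* y) by exact: (Im_le_normc (x +i* y)).
set n := normc _ in h1 nx ny *.
have n0 : 0 <= n by exact: normc_ge0.
have E : cexp (x +i* y) - 1 - (x +i* y) = (expR x)%:C * ((cos y - 1) +i* (sin y - y)) + (0 +i* ((expR x - 1) *
    y)) + (expR x - 1 - x)%:C.
  by rewrite cexpE; apply: complex_eqP; rewrite ?(cReD, cImD, cReN, cImN, cReM, cImM) /=; ring.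
rewrite E.
have ex : `|expR x| <= expR 1 by rewrite gtr0_norm ?expR_gt0// ler_expR (le_trans (ler_norm x))// (le_trans nx).
have ex2 : expR `|x| <= expR 1 by rewrite ler_expR (le_trans nx).
have x2 : x ^+ 2 <= n ^+ 2 by rewrite -[x ^+ 2]real_normK ?num_real// lerXn2r ?nnegrE.
have y2 : y ^+ 2 <= n ^+ 2 by rewrite -[y ^+ 2]real_normK ?num_real// lerXn2r ?nnegrE.
have a1 : normc ((expR x)%:C * ((cos y - 1) +i* (sin y - y))) <= expR 1 * (2 * n ^+ 2).
  rewrite normcM normc_real; apply: ler_pM; rewrite ?normc_ge0//.
  by apply: normc_le_ReIm; [exact: le_trans (cos_sub1_sq y) y2|exact: le_trans (sin_taylor2 y) y2].
have a2 : normc (0 +i* ((expR x - 1) * y) : C) <= 2 * (n ^+ 2 * expR 1).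
  apply: normc_le_ReIm => /=; first by rewrite normr0 mulr_ge0 ?sqr_ge0 ?expR_ge0.
  rewrite normrM expr2 mulrAC; apply: ler_pM => //.
  by apply: (le_trans (expR_sub1_bound x)); apply: ler_pM; rewrite ?expR_ge0.
have a3 : normc ((expR x - 1 - x)%:C : C) <= n ^+ 2 * expR 1.
  by rewrite normc_real (le_trans (expR_taylor2 x))//; apply: ler_pM; rewrite ?sqr_ge0 ?expR_ge0.
apply: (le_trans (le_normcD _ _)); apply: (le_trans (lerD (le_normcD _ _) a3)).
have := mulr_ge0 (sqr_ge0 n) (expR_ge0 1); lra.
Qed.

Lemma normc_cexp_le u : normc (cexp u) <= expR (normc u).
Proof.
case: u => x y; rewrite normc_cexp ler_expR (le_trans (ler_norm x))//.
exact: (Re_le_normc (x +i* y)).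
Qed.

Lemma normc_subrXX_le (A B : C) (M : R) n : 0 <= M -> normc A <= M -> normc B <= M ->
  normc (A ^+ n.+1 - B ^+ n.+1) <= normc (A - B) * (n.+1%:R * M ^+ n).
Proof.
move=> M0 hA hB; rewrite subrXX normcM ler_wpM2l ?normc_ge0//.
apply: (le_trans (normc_sum _ _)).
apply: (@le_trans _ _ (\sum_(i < n.+1) M ^+ n)); last by rewrite sumr_const card_ord [X in _ <= X]mulr_natl lexx.
apply: ler_sum => i _; rewrite normcM !normcX.
have -> : M ^+ n = M ^+ (n.+1 - i.+1) * M ^+ i by rewrite -exprD subSS subnK// -ltnS.
rewrite -[(n.+1.-1 - i)%N]/(n.+1 - i.+1)%N.
by apply: ler_pM; rewrite ?exprn_ge0 ?normc_ge0// lerXn2r ?nnegrE ?normc_ge0.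
Qed.

Lemma cexp_mulrn u n : cexp (n%:R * u) = cexp u ^+ n.
Proof.
elim: n => [|n IH].
  by rewrite mul0r expr0 (_ : 0 = 0 +i* 0 :> C)// cexpE expR0 cos0 sin0 mul1r mulr0.
by rewrite -nat1r mulrDl mul1r cexpD IH exprS.
Qed.

(** Euler's limit with a rate: $e^u$ is the $(n+1)$-st power of $e^{u/(n+1)}$, which differs from
    $1+u/(n+1)$ to second order, and a difference of powers costs one further factor $n+1$. *)
Lemma cexp_approx u (n : nat) : normc u <= n.+1%:R ->
  normc (cexp u - (1 + n.+1%:R^-1 * u) ^+ n.+1) <=
  7 * expR 1 * normc u ^+ 2 * expR (normc u) * n.+1%:R^-1.
Proof.
move=> un.
have mR0 : 0 < n.+1%:R :> R by rewrite ltr0n.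
set h := n.+1%:R^-1 * u.
have nm : normc (n.+1%:R : C) = n.+1%:R by rewrite -(rmorph_nat (real_complex R)) normc_real gtr0_norm.
have nh : normc h = n.+1%:R^-1 * normc u by rewrite /h normcM normcV nm.
have -> : cexp u = cexp h ^+ n.+1 by rewrite -cexp_mulrn /h mulVKf.
have h1 : normc h <= 1 by rewrite nh mulrC ler_pdivrMr// mul1r.
have M1 : normc (cexp h) <= expR (normc h) := normc_cexp_le h.
have M2 : normc (1 + h) <= expR (normc h).
  apply: (le_trans (le_normcD _ _)); rewrite normc1; exact: expR_ge1Dx.
apply: (le_trans (normc_subrXX_le n (expR_ge0 _) M1 M2)).
have h3 : expR (normc h) ^+ n <= expR (normc u).
  rewrite -expRM_natl ler_expR nh mulrA ler_piMl ?normc_ge0//.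
  by rewrite ler_pdivrMr// mul1r ler_nat.
have h2 := cexp_taylor2 h1; rewrite -addrA -opprD in h2.
apply: (@le_trans _ _ (7 * expR 1 * normc h ^+ 2 * (n.+1%:R * expR (normc u)))).
  apply: ler_pM => //; rewrite ?normc_ge0 ?mulr_ge0 ?exprn_ge0 ?expR_ge0//.
  by rewrite ler_pM2l.
rewrite nh le_eqVlt; apply/orP; left; apply/eqP.
by move: (n.+1%:R) mR0 => m m0'; field; rewrite gt_eqF.
Qed.

Lemma disk_limit_cexp c r (a : C) : disk_limit c r (fun w => cexp (w * a)).
Proof.
move=> e e0.
pose B := (`|r| + normc c) * normc a.
have B0 : 0 <= B by rewrite mulr_ge0 ?addr_ge0 ?normc_ge0.
pose K := 7 * expR 1 * B ^+ 2 * expR B.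
have K0 : 0 <= K by rewrite mulr_ge0 ?expR_ge0// mulr_ge0 ?sqr_ge0// mulr_ge0 ?expR_ge0.
(* One [n] meets both demands: $|wa|\le n+1$ for [cexp_approx] and an error $K/(n+1)\le e$. *)
have [n nB] : exists n : nat, B + K / e <= n%:R.
  by exists (Num.truncn (B + K / e)).+1; exact/ltW/truncnS_gt.
have Ke : 0 <= K / e by rewrite divr_ge0// ltW.
exists ((1 + (n.+1%:R^-1 * a) *: 'X) ^+ n.+1) => w wr.
have wB : normc (w * a) <= B.
  rewrite normcM /B ler_wpM2r ?normc_ge0// -[w](subrK c).
  apply: (le_trans (le_normcD _ _)); rewrite lerD2r.
  exact: le_trans wr (ler_norm _).
have -> : ((1 + (n.+1%:R^-1 * a) *: 'X) ^+ n.+1).[w] = (1 + n.+1%:R^-1 * (w * a)) ^+ n.+1.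
  by rewrite horner_exp hornerD hornerC hornerZ hornerX; congr (_ ^+ _); ring.
apply: (le_trans (@cexp_approx (w * a) n _)); first by apply: (le_trans wB); lra.
apply: (@le_trans _ _ (K * n.+1%:R^-1)).
  rewrite ler_pM2r ?invr_gt0//; apply: ler_pM; rewrite ?mulr_ge0 ?expR_ge0 ?normc_ge0 ?ler_expR//.
  by rewrite ler_pM2l ?mulr_gt0 ?expR_gt0// lerXn2r ?nnegrE ?normc_ge0.
rewrite ler_pdivrMr// mulrC -ler_pdivrMr//; lra.
Qed.

Definition sinc u : C := if u == 0 then pi%:C else csin (pi%:C * u) / u.

(** The sine is a difference of exponentials, approximated by two Euler powers. Their difference is
    divisible by $u=w-p$, and the cofactor in $A^m-B^m$ is the approximating polynomial, equal to
    $\pi$ at $u=0$. The error of the powers is quadratic in $|u|$, so it survives the division by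
    $u$. *)
Lemma disk_limit_sinc c r p : disk_limit c r (fun w => sinc (w - p)).
Proof.
move=> e e0.
pose B0 := `|r| + normc c + normc p.
have B00 : 0 <= B0 by rewrite !addr_ge0 ?normc_ge0.
pose B := pi * B0.
have B_0 : 0 <= B by rewrite mulr_ge0 ?pi_ge0.
pose K := 7 * expR 1 * pi ^+ 2 * B0 * expR B.
have K0 : 0 <= K by rewrite mulr_ge0 ?expR_ge0// mulr_ge0// mulr_ge0 ?sqr_ge0// mulr_ge0 ?expR_ge0.
have [n nB] : exists n : nat, B + K / e <= n%:R.
  by exists (Num.truncn (B + K / e)).+1; exact/ltW/truncnS_gt.
have Ke : 0 <= K / e by rewrite divr_ge0// ltW.
pose m : C := n.+1%:R.
have m0 : m != 0 by rewrite pnatr_eq0.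
pose A (z : C) : {poly C} := 1 + (m^-1 * z) *: ('X - p%:P).
pose zp : C := 'i%C * pi%:C; pose zm : C := - ('i%C * pi%:C).
exists ((m^-1 * pi%:C) *: \sum_(i < n.+1) (A zp) ^+ (n.+1.-1 - i) * (A zm) ^+ i) => w wr.
set u := w - p.
have uB : normc u <= B0.
  rewrite /u /B0; apply: (le_trans (le_normcD _ _)); rewrite normcN lerD2r.
  rewrite -[w](subrK c); apply: (le_trans (le_normcD _ _)); rewrite lerD2r.
  exact: le_trans wr (ler_norm _).
have AE z : (A z).[w] = 1 + m^-1 * (u * z).
  by rewrite /A hornerD hornerC hornerZ hornerXsubC -/u; ring.
set S := _.[w].
have SE : S = m^-1 * pi%:C * \sum_(i < n.+1) (A zp).[w] ^+ (n.+1.-1 - i) * (A zm).[w] ^+ i.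
  rewrite /S hornerZ horner_sum; congr (_ * _); apply: eq_bigr => i _.
  by rewrite hornerM !horner_exp.
rewrite /sinc; case: eqP => [u0|/eqP u0].
  rewrite SE; under eq_bigr do rewrite !AE u0 !mul0r mulr0 addr0 !expr1n mulr1.
  rewrite sumr_const card_ord -[1 *+ _]/m.
  have -> : m^-1 * pi%:C * m = pi%:C by rewrite mulrAC mulVf// mul1r.
  by rewrite subrr normc0 ltW.
have i2 : (2 * 'i%C : C) != 0 by rewrite mulf_neq0 ?pnatr_eq0 ?i_neq0.
have Su : S = ((1 + m^-1 * (u * zp)) ^+ n.+1 - (1 + m^-1 * (u * zm)) ^+ n.+1) / (2 * 'i%C * u).
  have := subrXX (A zp).[w] (A zm).[w] n.+1; rewrite !AE => ->.
  rewrite SE !AE; set T := \sum_(i < n.+1) _.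
  have -> : 1 + m^-1 * (u * zp) - (1 + m^-1 * (u * zm)) = 2 * 'i%C * u * (m^-1 * pi%:C).
    by rewrite /zp /zm; ring.
  have d0 : 2 * 'i%C * u != 0 by rewrite mulf_neq0.
  by move: (m^-1) (2 * 'i%C * u) d0 => mi d d0; field.
have csE : csin (pi%:C * u) / u = (cexp (u * zp) - cexp (u * zm)) / (2 * 'i%C * u).
  have -> : u * zp = 'i%C * (pi%:C * u) by rewrite /zp; ring.
  have -> : u * zm = - ('i%C * (pi%:C * u)) by rewrite /zm; ring.
  by rewrite /csin -[LHS]mulrA -invfM.
rewrite csE Su -mulrBl.
have nz (z : C) : normc z = pi -> normc (cexp (u * z) - (1 + m^-1 * (u * z)) ^+ n.+1) <=
    7 * expR 1 * (pi * normc u) ^+ 2 * expR B * n.+1%:R^-1.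
  move=> zpi.
  have nuz : normc (u * z) = pi * normc u by rewrite normcM zpi mulrC.
  have nuB : normc (u * z) <= B by rewrite nuz ler_pM2l ?pi_gt0.
  have nn : n%:R <= n.+1%:R :> R by rewrite ler_nat.
  apply: (le_trans (@cexp_approx (u * z) n _)); first by apply: (le_trans nuB); lra.
  rewrite nuz ler_wpM2r ?invr_ge0//; apply: ler_wpM2l; last by rewrite ler_expR -nuz.
  by rewrite mulr_ge0 ?sqr_ge0// mulr_ge0 ?expR_ge0.
have ni : normc ('i%C : C) = 1 by rewrite /= expr0n expr1n add0r sqrtr1.
have npi : normc ('i%C * pi%:C : C) = pi by rewrite normcM ni mul1r normc_real gtr0_norm ?pi_gt0.
have h1 := nz zp npi; have h2 := nz zm (etrans (normcN _) npi).
have nu0 : 0 < normc u.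
  by rewrite lt_neqAle normc_ge0 andbT eq_sym; apply: contra_neq u0; exact: eq0_normc.
have n2 : normc (2 * 'i%C * u) = 2 * normc u.
  rewrite 2!normcM ni mulr1 (_ : normc (2 : C) = 2)//.
  by rewrite -(rmorph_nat (real_complex R)) normc_real gtr0_norm.
rewrite normcM normcV n2 ler_pdivrMr ?mulr_gt0//.
set X := cexp _; set Y := cexp _; set X' := _ ^+ _; set Y' := _ ^+ _.
have -> : X - Y - (X' - Y') = (X - X') - (Y - Y') by ring.
apply: (le_trans (le_normcD _ _)); rewrite normcN.
apply: (le_trans (lerD h1 h2)).
have -> : 7 * expR 1 * (pi * normc u) ^+ 2 * expR B * n.+1%:R^-1 + 7 * expR 1 * (pi * normc u) ^+ 2 * expR B *
    n.+1%:R^-1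
  = (7 * expR 1 * pi ^+ 2 * normc u * expR B / n.+1%:R) * (2 * normc u) by ring.
rewrite ler_pM2r ?mulr_gt0// ler_pdivrMr//.
apply: (@le_trans _ _ K).
  rewrite /K ler_wpM2r ?expR_ge0// ler_wpM2l//.
  by rewrite mulr_ge0 ?sqr_ge0// mulr_ge0 ?expR_ge0.
rewrite mulrC -ler_pdivrMr//.
have nn : n%:R <= n.+1%:R :> R by rewrite ler_nat.
lra.
Qed.

End Entire.

(** * Circle integrals up to finitely many points *)

Section AE.
Context {R : realType}.
Notation C := R[i].
Notation mu := (@lebesgue_measure R).
Implicit Types (D N : set (measurableTypeR R)).

(** Every subset of a countable set is measurable, whatever values [f] takes there. *)
Lemma measurable_fun_off_countable D N (f g : R -> R) : countable N ->
  (forall s, D s -> ~ N s -> f s = g s) -> measurable_fun D g -> measurable_fun D f.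
Proof.
move=> cN fg mg mD Y mY.
have mN (A : set (measurableTypeR R)) : countable A -> measurable A.
  by move=> cA; apply: countable_measurable => // x; exact: measurable_set1.
have -> : D `&` f @^-1` Y = ((D `&` g @^-1` Y) `\` N) `|` (N `&` (D `&` f @^-1` Y)).
  apply/seteqP; split => s /=.
    move=> [Ds fY]; have [Ns|Ns] := pselect (N s); first by right.
    by left; split => //; rewrite -fg.
  by move=> [[[Ds gY] Ns]|[Ns [Ds fY]]]//; split => //; rewrite fg.
apply: measurableU; first by apply: measurableD; [exact: mg|exact: mN].
by apply: mN; apply: sub_countable cN; apply: subset_card_le => s [].
Qed.

Lemma cintegral_off_countable D N (f g : R -> C) : measurable D -> countable N ->
  (forall s, D s -> ~ N s -> f s = g s) -> cintegrable D g -> cintegral D f = cintegral D g.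
Proof.
move=> mD cN fg [g1 g2].
have mN : measurable N.
  by apply: countable_measurable => // x; exact: measurable_set1.
have K (u v : R -> R) : (forall s, D s -> ~ N s -> u s = v s) ->
    mu.-integrable D (EFin \o v) -> \int[mu]_(s in D) u s = \int[mu]_(s in D) v s.
  move=> uv iv; congr fine.
  have mv : measurable_fun D v by apply/measurable_EFinP; exact: measurable_int iv.
  apply: ae_eq_integral => //.
  - by apply/measurable_EFinP; apply: measurable_fun_off_countable uv mv.
  - exact/measurable_EFinP.
  - exists N; split => //; first exact: countable_lebesgue_measure0.
    by move=> s /= /not_implyP[Ds h]; apply: contrapT => Ns; apply: h; rewrite uv.
by apply: complex_eqP; rewrite /cintegral [LHS]/= [RHS]/=; apply: K => // s Ds Ns; rewrite fg.
Qed.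
End AE.

Section CircleAE.
Context {R : realType}.
Notation C := R[i].
Implicit Types (c q w z : C) (r s : R).
Local Notation D := (`[0%R, (2 * pi)%R]%classic : set (measurableTypeR R)).

(** The point determines $\cos s$, hence $s$ is an arccosine or its reflection in $2\pi$. *)
Lemma circle_point_finite c r q : 0 < r ->
  exists l : seq R, forall s, D s -> c + r%:C * expi s = q -> s \in l.
Proof.
move=> r0; pose x := complex.Re (q - c) / r.
exists [:: acos x; 2 * pi - acos x] => s Ds h.
have cx : cos s = x.
  rewrite /x -h addrC addKr cReM expiE /= mul0r subr0 mulrAC divff ?mul1r// gt_eqF//.
move: Ds; rewrite /= in_itv => /andP[s0 s2].
rewrite !inE; have [sp|sp] := lerP s pi.
  by rewrite -cx cosK ?eqxx// in_itv; apply/andP; split.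
apply/orP; right; rewrite -cx.
have -> : cos s = cos (2 * pi - s).
  by rewrite cosB mulr_natl cos2pi sin2pi mul1r mul0r addr0.
have s2' : s <= 2 * pi := s2.
have a1 : 0 <= 2 * pi - s by lra.
have a2 : 2 * pi - s <= pi by lra.
rewrite cosK; last by rewrite in_itv; apply/andP; split.
by apply/eqP; lra.
Qed.

Definition circle_cintegrable c r (f : C -> C) : Prop :=
  cintegrable D (fun s => f (c + r%:C * expi s) * (r%:C * 'i%C * expi s)).

Lemma circle_integral_ae c r (l : seq C) (f h : C -> C) : 0 < r ->
  (forall w, w \notin l -> f w = h w) -> circle_cintegrable c r h ->
  circle_integral c r f = circle_integral c r h.
Proof.
move=> r0 fh hI.
have [L HL] : exists L : seq R, forall s, D s -> c + r%:C * expi s \in l -> s \in L.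
  elim: l {fh} => [|q l [L HL]]; first by exists [::].
  have [L' HL'] := circle_point_finite c q r0.
  exists (L' ++ L) => s Ds; rewrite inE mem_cat => /orP[/eqP h1|h1].
    by rewrite HL'.
  by rewrite HL// orbT.
apply: (@cintegral_off_countable _ _ [set` L]) hI; first exact: circle_domain_measurable.
  by apply: finite_set_countable; exact: finite_seq.
move=> s Ds sL; congr (_ * _); apply: fh; apply/negP => h1; apply: sL => /=.
exact: HL.
Qed.

Lemma circle_integralD c r (f h : C -> C) :
  circle_cintegrable c r f -> circle_cintegrable c r h ->
  circle_cintegrable c r (fun w => f w + h w) /\
  circle_integral c r (fun w => f w + h w) = circle_integral c r f + circle_integral c r h.
Proof.
move=> fI hI; have mD := @circle_domain_measurable R; split.
  by have := cintegrableD mD fI hI; apply: eq_cintegrable => // s _; rewrite mulrDl.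
by rewrite /circle_integral -(cintegralD mD fI hI); apply: eq_cintegral => s _; rewrite mulrDl.
Qed.

Lemma circle_integralZ c r (a : C) (f : C -> C) :
  circle_cintegrable c r f -> circle_cintegrable c r (fun w => a * f w) /\
  circle_integral c r (fun w => a * f w) = a * circle_integral c r f.
Proof.
move=> fI; have mD := @circle_domain_measurable R; split.
  by have := cintegrableZ a mD fI; apply: eq_cintegrable => // s _; rewrite mulrA.
by rewrite /circle_integral -(cintegralZ a mD fI); apply: eq_cintegral => s _; rewrite -mulrA.
Qed.

Lemma circle_integral_sum (I : Type) (l : seq I) c r (f : I -> C -> C) :
  (forall i, circle_cintegrable c r (f i)) ->
  circle_cintegrable c r (fun w => \sum_(i <- l) f i w) /\
  circle_integral c r (fun w => \sum_(i <- l) f i w) = \sum_(i <- l) circle_integral c r (f i).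
Proof.
move=> fI; have mD := @circle_domain_measurable R.
have [h1 h2] := cintegral_sum l mD fI.
split; first by apply: eq_cintegrable h1 => // s _; rewrite mulr_suml.
by rewrite -h2; apply: eq_cintegral => s _; rewrite mulr_suml.
Qed.
End CircleAE.

(** * Evaluation of the kernel *)

Section Residues.
Context {R : realType}.
Notation C := R[i].
Implicit Types (c q w z u : C) (r s : R).
Local Notation D := (`[0%R, (2 * pi)%R]%classic : set (measurableTypeR R)).

Lemma csin_Dpi u : csin (u + pi%:C) = - csin u.
Proof.
case: u => x y; rewrite (_ : x +i* y + pi%:C = (x + pi) +i* y :> C); last first.
  by apply: complex_eqP; rewrite ?(cReD, cImD) /= ?addr0.
by rewrite !csinE sinDpi cosDpi; apply: complex_eqP; rewrite ?(cReN, cImN) /= mulNr.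
Qed.

Lemma csin_shift w (p : int) : csin (pi%:C * w) = (-1) ^ p * csin (pi%:C * (w - p%:~R)).
Proof.
elim/int_rect: p => [|n IH|n IH].
- by rewrite subr0 expr0z mul1r.
- rewrite IH -addn1 PoszD exprzD_nat expr1z.
  have -> : pi%:C * (w - n%:Z%:~R) = pi%:C * (w - (n%:Z + 1%:Z)%:~R) + pi%:C by rewrite intrD; ring.
  by rewrite csin_Dpi; ring.
- rewrite IH.
  have -> : (-1) ^ (- (n.+1)%:Z) = - ((-1) ^ (- n%:Z)) :> C.
    have -> : - (n.+1)%:Z = - n%:Z + (-1) by rewrite -addn1 PoszD opprD.
    by rewrite expfzDr ?oppr_eq0 ?oner_eq0// exprN1 invrN1 mulrN1.
  have -> : pi%:C * (w - (- n.+1%:Z)%:~R) = pi%:C * (w - (- n%:Z)%:~R) + pi%:C.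
    by rewrite !rmorphN /= -[n.+1]addn1 PoszD intrD; ring.
  by rewrite csin_Dpi; ring.
Qed.

Lemma csin_sinc w (p : int) : w != p%:~R ->
  csin (pi%:C * w) / (w - p%:~R) = (-1) ^ p * sinc (w - p%:~R).
Proof.
move=> wp; rewrite /sinc subr_eq0 (negbTE wp) mulrA; congr (_ / _); exact: csin_shift.
Qed.

(** The zeros in $w$ of $(w-x_1)_{t_1+1}$. *)
Definition ladder t1 (x1 : int) (i : 'I_t1.+1) : int := x1 - (i : nat)%:Z.

Section OneCircle.
Variables (N : nat) (a : 'I_N -> int) (t1 : nat) (x1 : int) (z mu c A : C) (r : R).
Hypothesis N0 : (0 < N)%N.
Hypothesis aI : injective a.
Hypothesis r0 : 0 < r.
Hypothesis zr : r < normc (z - c).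
Local Notation b := (@ladder t1 x1).
Hypothesis pole_off : forall i k, b i = a k -> normc ((b i)%:~R - c) != r.

Let aC k : C := (a k)%:~R.
Let bC i : C := (b i)%:~R.
Let bI : injective b.
Proof. by move=> i j /addrI /oppr_inj [] /val_inj. Qed.
Let aCI : injective aC. Proof. by move=> i j /intr_inj /aI. Qed.
Let bCI : injective bC. Proof. by move=> i j /intr_inj /bI. Qed.
Let cf i := \prod_(j | j != i) (bC i - bC j)^-1.
Let df k := \prod_(j | j != k) (aC k - aC j)^-1.

Definition kernel_w (w : C) : C := csin (pi%:C * w) * cexp (w * mu) / (w - z)
  * \prod_i (w - (b i)%:~R)^-1 * \prod_k (w - (a k)%:~R)^-1.

Let E w := cexp (w * mu) / (w - z).

Let E_lim : disk_limit c r E.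
Proof. by apply: disk_limitM; [exact: disk_limit_cexp|exact: disk_limit_inv]. Qed.

Let SE_lim (p : int) : disk_limit c r (fun w => (-1) ^ p * sinc (w - p%:~R) * E w).
Proof.
apply: disk_limitM; last exact: E_lim.
apply: disk_limitM; last exact: disk_limit_sinc.
by have := disk_limit_poly c r ((-1) ^ p)%:P; apply: disk_limit_ext => w _; rewrite hornerC.
Qed.

(** One term of the double partial fraction expansion, free of removable singularities. If
    $b_i=a_k$, the sine reduces the double pole to a simple one and Cauchy's formula applies when it
    is inside. Otherwise $1/((w-b_i)(w-a_k))$ splits and the sine cancels each pole, so the integral
    is 0. *)
Let h i k w : C := if b i == a k then ((-1) ^ (b i) * sinc (w - bC i) * E w) / (w - bC i)
  else (bC i - aC k)^-1 * (((-1) ^ (b i) * sinc (w - bC i) * E w)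
    + (-1) * ((-1) ^ (a k) * sinc (w - aC k) * E w)).

Let h_int i k : circle_cintegrable c r (h i k) /\
  circle_integral c r (h i k) = ((b i == a k) && (normc (bC i - c) < r))%:R *
    ((2 * pi)%:C * 'i%C * ((-1) ^ (b i) * pi%:C * E (bC i))).
Proof.
rewrite /h; case: eqVneq => [bak|bak] /=.
  have := pole_off bak; rewrite -/(bC i) neq_lt => /orP[lt|gt].
    rewrite lt mul1r; split; first exact: (cauchy_integrable lt (SE_lim (b i))).
    by rewrite (cauchy_formula lt (SE_lim (b i))) /sinc subrr eqxx.
  have L : disk_limit c r (fun w => ((-1) ^ (b i) * sinc (w - bC i) * E w) / (w - bC i)).
    by apply: disk_limitM; [exact: SE_lim|exact: disk_limit_inv].
  rewrite ltNge ltW//= mul0r; split; first exact: (cauchy_theorem_integrable r0 L).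
  exact: (cauchy_theorem r0 L).
rewrite mul0r.
have I1 : circle_cintegrable c r (fun w => (-1) ^ (b i) * sinc (w - bC i) * E w) :=
    cauchy_theorem_integrable r0 (SE_lim (b i)).
have I2 : circle_cintegrable c r (fun w => (-1) ^ (a k) * sinc (w - aC k) * E w) :=
    cauchy_theorem_integrable r0 (SE_lim (a k)).
have [I3 J3] := circle_integralZ (-1) I2.
have [I4 J4] := circle_integralD I1 I3.
have [I5 J5] := circle_integralZ (bC i - aC k)^-1 I4.
split; first exact: I5.
by rewrite J5 J4 J3 !cauchy_theorem ?mulr0 ?addr0 ?mulr0//; exact: SE_lim.
Qed.

(** Both products are expanded in partial fractions, and the sum of the terms [h] replaces the
    integrand off the nodes. The indicator keeps the common nodes inside this circle. *)
Lemma circle_kernel_w : circle_integral c r (fun w => A * kernel_w w) =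
  A * \sum_i \sum_k (\prod_(j | j != i) ((b i)%:~R - (b j)%:~R)^-1) *
     (\prod_(j | j != k) ((a k)%:~R - (a j)%:~R)^-1) *
   (((b i == a k) && (normc ((b i)%:~R - c) < r))%:R *
    ((2 * pi)%:C * 'i%C * ((-1) ^ (b i) * pi%:C * (cexp ((b i)%:~R * mu) / ((b i)%:~R - z))))).
Proof.
have S k : (forall i, circle_cintegrable c r (fun w => cf i * df k * h i k w)).
  by move=> i; case: (circle_integralZ (cf i * df k) (h_int i k).1).
have SS i : circle_cintegrable c r (fun w => \sum_k cf i * df k * h i k w).
  by case: (@circle_integral_sum R _ (index_enum 'I_N) c r (fun k w => cf i * df k * h i k w) (fun k => S k i)).
have [TI T] := @circle_integral_sum R _ (index_enum 'I_t1.+1) c r (fun i w => \sum_k cf i * df k * h i k w) SS.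
have [AI AT] := circle_integralZ A TI.
rewrite (@circle_integral_ae _ c r ([seq bC i | i : 'I_t1.+1] ++ [seq aC k | k : 'I_N]) _
   (fun w => A * \sum_i \sum_k cf i * df k * h i k w))//.
  rewrite AT; congr (_ * _).
  rewrite T; apply: eq_bigr => i _.
  have [_ ->] := @circle_integral_sum R _ (index_enum 'I_N) c r (fun k w => cf i * df k * h i k w) (fun k => S k i).
  apply: eq_bigr => k _.
  have [_ ->] := circle_integralZ (cf i * df k) (h_int i k).1.
  by rewrite (h_int i k).2.
move=> w; rewrite mem_cat negb_or => /andP[wb wa].
have wb' i : w != bC i by apply: contra wb => /eqP->; apply/mapP; exists i => //; rewrite mem_enum.
have wa' k : w != aC k by apply: contra wa => /eqP->; apply/mapP; exists k => //; rewrite mem_enum.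
congr (_ * _); rewrite /kernel_w (partial_fractions bCI (ltn0Sn _) wb') (partial_fractions aCI N0 wa').
rewrite -mulrA big_distrl /= big_distrr /=; apply: eq_bigr => i _.
rewrite big_distrr big_distrr /=; apply: eq_bigr => k _.
rewrite -/(cf i) -/(df k).
have wbi : w - bC i != 0 by rewrite subr_eq0.
have wak : w - aC k != 0 by rewrite subr_eq0.
have -> : csin (pi%:C * w) * cexp (w * mu) / (w - z) * (cf i * (w - bC i)^-1 * (df k * (w - aC k)^-1)) =
  cf i * df k * (csin (pi%:C * w) / (w - bC i) / (w - aC k) * E w) by rewrite /E; ring.
congr (_ * _); rewrite /h; case: eqVneq => [bak|bak].
  rewrite -csin_sinc ?wb'// -/(bC i).
  have -> : aC k = bC i by rewrite /aC /bC bak.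
  by rewrite -/(bC i); move: (E w) (csin _) => e s; field.
have ba : bC i - aC k != 0 by rewrite subr_eq0; apply: contra bak => /eqP /intr_inj ->.
rewrite -!csin_sinc ?wb' ?wa'// -/(bC i) -/(aC k).
by field; rewrite ba wbi wak.
Qed.
End OneCircle.
End Residues.

Section Factorials.
Context {F : numFieldType}.

Lemma prod_succ n : \prod_(0 <= j < n) (j.+1)%:R = (n`!)%:R :> F.
Proof.
elim: n => [|n IH]; first by rewrite big_geq.
by rewrite big_nat_recr//= IH factS natrM mulrC.
Qed.

Lemma prod_succN n : \prod_(0 <= j < n) - (j.+1)%:R = (-1) ^+ n * (n`!)%:R :> F.
Proof.
elim: n => [|n IH]; first by rewrite big_geq// mul1r.
by rewrite big_nat_recr//= IH factS natrM exprS; ring.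
Qed.

Lemma prod_diff_ord n (i : 'I_n.+1) :
  \prod_(j < n.+1 | j != i) ((j : nat)%:R - (i : nat)%:R) =
  (-1) ^+ i * ((i`!)%:R * ((n - i)`!)%:R) :> F.
Proof.
rewrite big_mkcond -(big_mkord xpredT (fun j : nat => if j != i :> nat then j%:R - (i : nat)%:R else 1 : F)).
have lein : (i <= n.+1)%N by exact/ltnW/ltn_ord.
rewrite (@big_cat_nat _ _ _ i) //=.
rewrite [X in _ * X]big_ltn ?ltn_ord// eqxx /= mul1r mulrA -prod_succN -prod_succ; congr (_ * _).
  rewrite big_nat_rev /=; apply: eq_big_nat => j /andP[_ ji].
  rewrite add0n ltn_eqF ?ltn_subrL//=; last by rewrite (leq_ltn_trans _ ji).
  by rewrite natrB// addrAC subrr sub0r.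
rewrite -[X in \prod_(X <= _ < _) _]add0n big_addn subSS; apply: eq_big_nat => j /andP[_ ji].
rewrite gtn_eqF ?ltn_addl//= addnS -addSn natrD addrK//.
Qed.

(** Up to $n!$, the left side is the partial fraction coefficient of $1/(w-x_1)_{n+1}$ at $x_1-i$:
    this is how the factor $t_1!$ of the kernel produces binomial coefficients. *)
Lemma fact_ladder n (i : 'I_n.+1) :
  (n`!)%:R * \prod_(j < n.+1 | j != i) ((j : nat)%:R - (i : nat)%:R)^-1 = (-1) ^+ i * 'C(n, i)%:R :> F.
Proof.
rewrite prodfV prod_diff_ord.
have i1 : (i <= n)%N by rewrite -ltnS.
rewrite -(bin_fact i1) !natrM.
have f1 : (i`!)%:R != 0 :> F by rewrite pnatr_eq0 -lt0n fact_gt0.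
have f2 : ((n - i)`!)%:R != 0 :> F by rewrite pnatr_eq0 -lt0n fact_gt0.
have s1 : (-1) ^+ i * (-1) ^+ i = 1 :> F by rewrite -exprMn mulrNN mulr1 expr1n.
rewrite invfM.
have -> : ((-1) ^+ i)^-1 = (-1) ^+ i :> F.
  by apply: (mulIf (x := (-1) ^+ i)); rewrite ?signr_eq0// s1 mulVf// signr_eq0.
by field; rewrite f1 f2.
Qed.

End Factorials.

Lemma step_poly_shift (F : numFieldType) (b c : F) (p : {poly F}) :
  step_poly b p \Po ('X + c%:P) = step_poly b (p \Po ('X + c%:P)).
Proof.
rewrite /step_poly comp_polyD !comp_polyZ -!comp_polyA; congr (_ + _ *: (_ \Po _)).
by rewrite !comp_polyD !comp_polyX !comp_polyC addrAC.
Qed.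

(** * The double integral of the kernel *)

Section Kernel.
Context {R : realType} (N : nat) (a : weyl N) (beta : R).
Notation C := R[i].
Hypothesis N0 : (0 < N)%N.
Hypothesis beta01 : 0 < beta < 1.
Implicit Types (t : nat) (x : int) (z w : C).

Let rho : R := (1 - beta) / beta.
Let mu : C := (ln rho)%:C.
Let aC (k : 'I_N) : C := (a k)%:~R.

Let b0 : 0 < beta. Proof. by case/andP: beta01. Qed.
Let b1 : 0 < 1 - beta. Proof. by rewrite subr_gt0; case/andP: beta01. Qed.
Let rho0 : 0 < rho. Proof. by rewrite divr_gt0. Qed.
Let rhoC0 : rho%:C != 0 :> C. Proof. by rewrite fmorph_eq0 gt_eqF. Qed.

Let cexp_mu1 : cexp mu = rho%:C.
Proof.
by rewrite /mu -[_%:C]/(ln rho +i* 0) cexpE cos0 sin0 mulr1 mulr0 lnK.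
Qed.

Let cexp0 : cexp (0 : C) = 1.
Proof. by rewrite -[0]/(0 +i* 0 : C) cexpE expR0 cos0 sin0 mulr1 mulr0. Qed.

Lemma cexp_intmul x : cexp (x%:~R * mu) = rho%:C ^ x.
Proof.
elim/int_rect: x => [|n IH|n IH].
- by rewrite mul0r cexp0 expr0z.
- by rewrite -addn1 PoszD intrD mulrDl mul1r cexpD IH cexp_mu1 expfzDr// expr1z.
- have h : cexp (- (n.+1)%:Z%:~R * mu) * cexp mu = cexp (- n%:Z%:~R * mu).
    by rewrite -cexpD; congr cexp; rewrite -addn1 PoszD intrD; ring.
  apply: (mulIf rhoC0); rewrite -{1}cexp_mu1 rmorphN h -rmorphN IH.
  by rewrite -[in RHS](expr1z rho%:C) -expfzDr//; congr (_ ^ _); lia.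
Qed.

Section Contour.
Variables (t1 t2 : nat) (x1 x2 : int) (g : circles R).
Hypothesis adm : admissible_wcontour a t1 x1 t2 x2 g.

(** Some disk contains the pole, and disjointness of the closed disks puts it strictly outside every
    other one. *)
Let wpole_index p : wpole a t1 x1 p -> exists i0, [/\ (i0 < size g)%N,
  normc (p%:~R - (nth (0, 0) g i0).1) < (nth (0, 0) g i0).2 &
  forall i, (i < size g)%N -> i != i0 -> (nth (0, 0) g i).2 < normc (p%:~R - (nth (0, 0) g i).1)].
Proof.
have [_ _ disj _ enc] := adm; move=> /enc [cr crg].
rewrite /odisk /= -[`|_|]/((normc _)%:C) ltcR => lt.
exists (index cr g); rewrite index_mem nth_index//; split=> // i ig ii.
rewrite ltNge; apply/negP => le.
have c1 : cdisk (nth (0, 0) g i) (p%:~R) by rewrite /cdisk /= -[`|_|]/((normc _)%:C) lecR.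
have c2 : cdisk (nth (0, 0) g (index cr g)) (p%:~R).
  by rewrite nth_index// /cdisk /= -[`|_|]/((normc _)%:C) lecR ltW.
move: ii; rewrite neq_ltn => /orP[ii|ii].
  have /seteqP[/(_ p%:~R) h _] := disj i (index cr g) ltac:(by rewrite ii index_mem).
  by case: h.
have /seteqP[/(_ p%:~R) h _] := disj (index cr g) i ltac:(by rewrite ii).
by case: h.
Qed.

Let inside_off p : wpole a t1 x1 p -> forall cr, cr \in g -> normc (p%:~R - cr.1) != cr.2.
Proof.
move=> /wpole_index [i0 [i0g lt gt]] cr crg.
rewrite -(nth_index (0, 0) crg).
have [->|ii] := eqVneq (index cr g) i0; first by rewrite lt_eqF.
by rewrite gt_eqF// gt// index_mem.
Qed.

Let inside_sum p : wpole a t1 x1 p ->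
  \sum_(cr <- g) ((normc (p%:~R - cr.1) < cr.2)%R : nat)%:R = 1 :> C.
Proof.
move=> /wpole_index [i0 [i0g lt gt]].
rewrite (big_nth (0, 0)) big_mkord (bigD1 (Ordinal i0g))//= lt big1 ?addr0// => i ii.
by rewrite lt_gtF// gt.
Qed.

(** The part of the residue at $a_k$ that does not depend on $z$; the minus sign is that of
    $(z-a_k)/(a_k-z)$. *)
Let residue_coef (k : 'I_N) : C :=
  - \sum_(i < t1.+1) (\prod_(j | j != i) ((ladder x1 i)%:~R - (ladder x1 j)%:~R)^-1) *
    ((ladder x1 i == a k)%:R * ((2 * pi)%:C * 'i%C * ((-1) ^ (a k) * pi%:C * cexp ((a k)%:~R * mu)))).

Let z_part (k : 'I_N) z : C := pochhammer (z - x2%:~R + 1) (t2 - 1) / csin (pi%:C * z)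
  * cexp (- z * mu) * (lagrange_poly aC k).[z].

Let ladder_wpole (i : 'I_t1.+1) k : ladder x1 i = a k -> wpole a t1 x1 (a k).
Proof.
move=> ik; split; last by exists k.
by rewrite -ik /ladder; have := ltn_ord i; lia.
Qed.

(** Summed over the circles, each common node counts once. At $w=a_k$ the factor $1/(a_k-z)$ cancels
    one factor of $\prod_r(z-a_r)$ up to sign, and what is left is the $k$-th Lagrange
    polynomial. *)
Lemma inner_integral z : complex.Re z = zline R t2 x2 -> (forall k, z != aC k) ->
  circles_integral g (bernoulli_integrand a beta t1 x1 t2 x2 z) = \sum_k residue_coef k * z_part k z.
Proof.
move=> zl za; have [_ gpos _ goff _] := adm.
pose A : C := pochhammer (z - x2%:~R + 1) (t2 - 1) / csin (pi%:C * z) * cexp (- z * mu) * \prod_k (z - aC k).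
have E w : bernoulli_integrand a beta t1 x1 t2 x2 z w = A * kernel_w a t1 x1 z mu w.
  rewrite /bernoulli_integrand /kernel_w /A.
  have -> : (pochhammer (w - x1%:~R) t1.+1)^-1 = \prod_(i < t1.+1) (w - (ladder x1 i)%:~R)^-1.
    rewrite /pochhammer -prodfV; apply: eq_bigr => i _; congr (_^-1).
    by rewrite /ladder rmorphB /= opprB addrA addrAC.
  have -> : rpow ((1 - beta) / beta) (w - z) = cexp (w * mu) * cexp (- z * mu).
    by rewrite /rpow -cexpD -mulrDl.
  have -> : \prod_(r < N) ((z - (a r)%:~R) / (w - (a r)%:~R)) = \prod_k (z - aC k) * \prod_k (w - (a k)%:~R)^-1.
    by rewrite -big_split.
  by ring.
pose V (i : 'I_t1.+1) : C := (2 * pi)%:C * 'i%C * ((-1) ^ (ladder x1 i) * pi%:C * (cexp ((ladder x1 i)%:~R *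
    mu) / ((ladder x1 i)%:~R - z))).
pose c i : C := \prod_(j | j != i) ((ladder x1 i)%:~R - (@ladder t1 x1 j)%:~R)^-1.
pose d k : C := \prod_(j | j != k) (aC k - aC j)^-1.
have circ cr : cr \in g -> circle_integral cr.1 cr.2 (bernoulli_integrand a beta t1 x1 t2 x2 z) =
    A * \sum_i \sum_k c i * d k * (((ladder x1 i == a k) && (normc ((ladder x1 i)%:~R - cr.1) < cr.2))%:R * V i).
  move=> crg.
  have -> : bernoulli_integrand a beta t1 x1 t2 x2 z = (fun w => A * kernel_w a t1 x1 z mu w) by apply/funext
      => w; exact: E.
  apply: circle_kernel_w => //; [exact: weyl_inj|exact: gpos| |].
    rewrite ltNge; apply/negP => le; apply: (goff cr z crg zl).
    by rewrite /cdisk /= -[`|_|]/((normc _)%:C) lecR.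
  by move=> i k ik; rewrite ik; apply: inside_off crg; exact: ladder_wpole ik.
rewrite /circles_integral; under eq_big_seq do rewrite circ//.
rewrite -mulr_sumr.
have -> : \sum_(cr <- g) \sum_i \sum_k c i * d k * (((ladder x1 i == a k) && (normc ((ladder x1 i)%:~R - cr.1)
    < cr.2))%:R * V i) =
   \sum_k \sum_i c i * d k * ((ladder x1 i == a k)%:R * V i).
  rewrite exchange_big [RHS]exchange_big /=; apply: eq_bigr => i _.
  rewrite exchange_big /=; apply: eq_bigr => k _.
  rewrite -mulr_sumr -mulr_suml; congr (_ * (_ * _)).
  case: eqVneq => [ik|_] /=; last by rewrite big1.
  by rewrite ik inside_sum//; exact: ladder_wpole ik.
rewrite mulr_sumr; apply: eq_bigr => k _.
rewrite /residue_coef mulNr mulr_suml mulr_sumr -sumrN; apply: eq_bigr => i _.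
case: eqVneq => [ik|_]; last by rewrite !(mul0r, mulr0, oppr0).
rewrite !mul1r /V ik /A /z_part -/(c i) (bigD1 k)//= /lagrange_poly hornerZ horner_prod -/(d k).
under [X in _ = - (_ * (_ * (_ * X)))]eq_bigr do rewrite hornerXsubC.
have zk : aC k - z != 0 by rewrite subr_eq0 eq_sym za.
have h : (z - aC k) / (aC k - z) = -1 by rewrite -(opprB (aC k) z) mulNr divff.
rewrite -/(aC k).
set X1 := _ / csin _; set X2 := cexp (- z * mu); set X3 := \prod_(_ | _) _; set X4 := cexp _; set X5 := (-1) ^ a k.
transitivity (((z - aC k) / (aC k - z)) * (X1 * X2 * X3 * (c i * d k * ((2 * pi)%:C * 'i%C * (X5 * pi%:C *
    X4))))); first by ring.
by rewrite h /c ik; ring.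
Qed.

Let lag_shift k : {poly C} := lagrange_poly aC k \Po ('X + (x2%:~R)%:P).

Let csin_zline s : csin (pi%:C * (zline R t2 x2 +i* s)) = (-1) ^ (x2 - t2%:Z) * (ch (pi * s))%:C :> C.
Proof.
rewrite (csin_shift _ (x2 - t2%:Z)); congr (_ * _).
have -> : pi%:C * ((zline R t2 x2 +i* s) - (x2 - t2%:Z)%:~R) = (pi / 2) +i* (pi * s) :> C.
  rewrite -(rmorph_int (real_complex R)) /zline; apply: complex_eqP; rewrite !(cReM, cImM, cReD, cImD, cReN, cImN).
    by move: (@pi R) => p; rewrite /=; ring.
  by move: (@pi R) => p; rewrite /=; ring.
rewrite csinE sin_pihalf cos_pihalf mul1r mul0r; reflexivity.
Qed.

Let zline_off s k : zline R t2 x2 +i* s != aC k.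
Proof.
rewrite /aC -(rmorph_int (real_complex R)) eq_complex negb_and; apply/orP; left; apply/eqP => /= h.
have : (2 * (a k - (x2 - t2%:Z)))%:~R = 1%:~R :> R.
  by rewrite intrM rmorphB /= -h /zline; field.
by move/intr_inj; lia.
Qed.

(** The substitution $z=x_2+u$: the sine becomes a signed $\cosh(\pi s)$, the power releases
    $\rho^{-x_2}$, and the rest is the integrand of [lint]. *)
Let z_part_line k s : (0 < t2)%N -> z_part k (zline R t2 x2 +i* s) =
  (-1) ^ (x2 - t2%:Z) * rho%:C ^ (- x2) *
  (gl (- ln rho) (rising (t2 - 1) * lag_shift k) ((- t2%:R + 2^-1) +i* s) * ((ch (pi * s))^-1)%:C).
Proof.
move=> t20; rewrite /z_part csin_zline /gl.
set z := zline R t2 x2 +i* s; set u := (- t2%:R + 2^-1) +i* s.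
have zu : z = x2%:~R + u.
  by rewrite /z /u -(rmorph_int (real_complex R)) /zline; apply: complex_eqP;
      rewrite !(cReD, cImD) /= ?add0r// rmorphB addrA.
have -> : pochhammer (z - x2%:~R + 1) (t2 - 1) = (rising (t2 - 1)).[u].
  rewrite /pochhammer /rising horner_prod; apply: eq_bigr => i _.
  by rewrite hornerD hornerX hornerC zu -[i.+1%:R]nat1r; ring.
have -> : cexp (- z * mu) = rho%:C ^ (- x2) * cexp (u * (- ln rho)%:C).
  rewrite -cexp_intmul -cexpD; congr cexp; rewrite zu rmorphN /= rmorphN /= -/mu; ring.
rewrite hornerM horner_comp hornerD hornerX hornerC zu (addrC u) fmorphV.
have -> : (rising (t2 - 1)).[u] / ((-1) ^ (x2 - t2%:Z) * (ch (pi * s))%:C) =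
  (-1) ^ (x2 - t2%:Z) * ((rising (t2 - 1)).[u] / (ch (pi * s))%:C).
  by rewrite invfM expfV invrN1 mulrCA.
move: (rising _).[u] (cexp _) ((ch _)%:C^-1) (lagrange_poly _ _).[_] ((-1) ^ _) (rho%:C ^ _) => v1 v2 v3 v4 v5 v6.
by ring.
Qed.

Lemma outer_integral : (0 < t2)%N ->
  vline_integral (zline R t2 x2) (fun z => circles_integral g (bernoulli_integrand a beta t1 x1 t2 x2 z)) =
  \sum_k residue_coef k * ((-1) ^ (x2 - t2%:Z) * rho%:C ^ (- x2) * 'i%C) *
    lint (- ln rho) (- t2%:R + 2^-1) (rising (t2 - 1) * lag_shift k).
Proof.
move=> t20; rewrite /vline_integral.
transitivity (cintegral setT (fun s => \sum_k residue_coef k * ((-1) ^ (x2 - t2%:Z) * rho%:C ^ (- x2) * 'i%C) *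
   (gl (- ln rho) (rising (t2 - 1) * lag_shift k) ((- t2%:R + 2^-1) +i* s) * ((ch (pi * s))^-1)%:C))).
  apply: eq_cintegral => s _.
  rewrite (@inner_integral (zline R t2 x2 +i* s) erefl (zline_off s)).
  rewrite mulr_suml; apply: eq_bigr => k _; rewrite (z_part_line k s t20).
  by move: (gl _ _ _) (_%:C) => G c; ring.
have I k := @lint_integrable R (- ln rho) (- t2%:R + 2^-1) (rising (t2 - 1) * lag_shift k).
have [_ ->] := @cintegral_sum R _ (index_enum 'I_N) setT (fun k s => residue_coef k * ((-1) ^ (x2 - t2%:Z) *
    rho%:C ^ (- x2) * 'i%C) *
   (gl (- ln rho) (rising (t2 - 1) * lag_shift k) ((- t2%:R + 2^-1) +i* s) * ((ch (pi * s))^-1)%:C)) measurableT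
   (fun k => cintegrableZ _ measurableT (I k)).
by apply: eq_bigr => k _; rewrite (cintegralZ _ measurableT (I k)).
Qed.

Let signC (p : int) : ((-1) ^ p)^-1 = (-1) ^ p :> C.
Proof. by rewrite expfV invrN1. Qed.

Let rho_powC (m : nat) : (beta%:C / (1 - beta%:C)) ^+ m = rho%:C ^- m :> C.
Proof. by rewrite -exprVn -fmorphV /rho invf_div rmorphM fmorphV rmorphB. Qed.

Let bC0 : beta%:C != 0 :> C. Proof. by rewrite fmorph_eq0 gt_eqF. Qed.
Let bC1 : 1 - beta%:C != 0 :> C.
Proof. by rewrite -(rmorph1 (real_complex R)) -rmorphB fmorph_eq0 gt_eqF. Qed.

(** Only the rung $x_1-i=a_k$ contributes, and [fact_ladder] gives it the binomial coefficient of a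
    $t_1$-step walk from $a_k$ to $x_1$. Both sides vanish if there is no such rung. *)
Let residue_coefE k : t1`!%:R * residue_coef k = - ((2 * pi)%:C * 'i%C * pi%:C) *
  ((-1) ^ x1 * rho%:C ^ x1 * (1 - beta%:C) ^- t1 * walk_prob beta%:C t1 (a k) x1).
Proof.
rewrite /residue_coef mulrN mulNr; congr (- _).
transitivity (\sum_(i < t1.+1) (ladder x1 i == a k)%:R * ((-1) ^+ i * 'C(t1, i)%:R) *
    ((2 * pi)%:C * 'i%C * ((-1) ^ (a k) * pi%:C * cexp ((a k)%:~R * mu)))).
  rewrite mulr_sumr; apply: eq_bigr => i _; rewrite -fact_ladder.
  have -> : \prod_(j | j != i) ((ladder x1 i)%:~R - (@ladder t1 x1 j)%:~R)^-1 =
    \prod_(j < t1.+1 | j != i) ((j : nat)%:R - (i : nat)%:R)^-1 :> C.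
    apply: eq_bigr => j _; congr (_^-1); rewrite /ladder !rmorphB /=; ring.
  by rewrite [RHS]mulrAC [RHS]mulrC -!mulrA.
rewrite cexp_intmul.
have [lt|le] := ltP x1 (a k).
  rewrite walk_prob_lt// !mulr0 big1// => i _.
  by rewrite /ladder lt_eqF ?mul0r//; lia.
pose m := `|x1 - a k|%N.
have xm : x1 = a k + m%:Z by rewrite /m; lia.
rewrite [in walk_prob _ _ _ _]xm walk_probE// rho_powC.
have ladder_m (i : 'I_t1.+1) : (ladder x1 i == a k) = (i == m :> nat).
  by rewrite /ladder xm; lia.
under eq_bigr do rewrite ladder_m.
have [mt|mt] := leqP m t1; last first.
  rewrite bin_small// !(mul0r, mulr0) big1// => i _.
  by rewrite ltn_eqF ?mul0r// (leq_trans (ltn_ord i)).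
rewrite (bigD1 (Ordinal (mt : (m < t1.+1)%N)))//= eqxx big1 ?addr0; last first.
  by move=> i im; rewrite (_ : (i == m :> nat) = false) ?mul0r//; exact: negbTE im.
rewrite xm !expfzDr ?oppr_eq0 ?oner_eq0// -!exprnP.
have r0 : rho%:C ^+ m != 0 :> C by rewrite expf_neq0.
have b1' : (1 - beta%:C) ^+ t1 != 0 :> C by rewrite expf_neq0.
by move: (pi%:C) => p; rewrite rmorphM /=; move: ((1 - beta%:C) ^+ _) b1' (rho%:C ^+ m) r0 ((-1) ^+ m) ((-1) ^
    a k) (rho%:C ^ a k)
  ('C(_, _)%:R) (p) => *; field; apply/andP; split.
Qed.

(** Writing each harmonic polynomial as a step of the next, [line_funS] raises the time index $n$
    times and [line_fun0] once more, with evaluation. *)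
Let line_harmonic n m k : line_fun beta n ((harmonic_poly beta%:C a m k) \Po ('X + (x2%:~R)%:P)) =
  (harmonic_poly beta%:C a (m + n.+1) k).[x2%:~R].
Proof.
elim: n m => [|n IH] m; rewrite -[harmonic_poly _ _ m k]harmonic_step step_poly_shift.
  by rewrite line_fun0// horner_comp hornerD hornerX hornerC add0r addn1.
by rewrite line_funS// IH addSnnS.
Qed.

Definition gauge t x : C := (-1) ^ x * rho%:C ^ x * (1 - beta%:C) ^- t.

Lemma gauge_neq0 t x : gauge t x != 0.
Proof.
by rewrite /gauge !mulf_neq0 ?invr_neq0 ?expf_neq0 ?expfz_neq0 ?oppr_eq0 ?oner_eq0.
Qed.

(** Multiplication by the ratio of gauges strips [walk_prob] of its powers of $\rho$ and $1-\beta$,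
    which turns the propagator into the signed binomial. The double integral matches term by term in
    $k$. *)
Lemma bernoulli_kernelE : (0 < t2)%N ->
  bernoulli_kernel a beta g t1 x1 t2 x2 =
  gauge t1 x1 / gauge t2 x2 * walk_kernel beta%:C a t1 x1 t2 x2.
Proof.
move=> t20; rewrite /bernoulli_kernel outer_integral// /walk_kernel mulrDr; congr (_ + _).
  have [t21|t12] := ltnP; last by rewrite andbF oppr0 mulr0.
  have [x21|x12] := leP; last by rewrite walk_prob_lt// oppr0 mulr0.
  rewrite /=; set m := `|x1 - x2|%N.
  have xm : x1 = x2 + m%:Z by rewrite /m; lia.
  have t12 : t1 = (t2 + (t1 - t2))%N by rewrite subnKC// ltnW.
  rewrite xm walk_probE// rho_powC /gauge.
  have -> : x2 + m%:Z - x2 + 1 = m%:Z + 1 by lia.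
  rewrite [in (1 - _) ^- t1]t12 exprD !expfzDr ?oppr_eq0 ?oner_eq0// -!exprnP expr1.
  have h1 : (1 - beta%:C) ^+ (t1 - t2) != 0 :> C by rewrite expf_neq0.
  have h2 : (1 - beta%:C) ^+ t2 != 0 :> C by rewrite expf_neq0.
  have h3 : rho%:C ^+ m != 0 :> C by rewrite expf_neq0.
  have h4 : rho%:C ^ x2 != 0 :> C by rewrite expfz_neq0.
  have h5 : (-1) ^ x2 != 0 :> C by rewrite expfz_neq0 ?oppr_eq0 ?oner_eq0.
  move: (_ ^+ (t1 - t2)) h1 (_ ^+ t2) h2 (rho%:C ^+ m) h3 (rho%:C ^ x2) h4 ((-1) ^ x2) h5 ((-1) ^+ m) ('C(_,
      _)%:R) => *.
  by field; do ?[apply/andP; split].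
rewrite !mulr_sumr; apply: eq_bigr => k _.
(* [line_fun n] inverts $n+1$ steps, so positivity of $t_2$ is what makes it applicable with
   $n=t_2-1$. *)
have [n t2n] : exists n, t2 = n.+1 by exists t2.-1; rewrite prednK.
have f0 : n`!%:R != 0 :> C by rewrite pnatr_eq0 -lt0n fact_gt0.
have pi0 : pi%:C != 0 :> C by rewrite fmorph_eq0 gt_eqF// pi_gt0.
have b1n : (1 - beta%:C) ^+ t2 != 0 :> C by rewrite expf_neq0.
have := line_harmonic n 0 k; rewrite add0n -t2n => <-.
rewrite /line_fun -t2n.
have tn : (t2 - 1 = n)%N by rewrite t2n subn1.
rewrite tn; set L := lint _ _ _;
have -> : t1`!%:R / n`!%:R * (1 / (2 * pi%:C * 'i%C) ^+ 2) *
  (residue_coef k * ((-1) ^ (x2 - t2%:Z) * rho%:C ^ (- x2) * 'i%C) * L) =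
  (t1`!%:R * residue_coef k) * ((-1) ^ (x2 - t2%:Z) * rho%:C ^ (- x2) * 'i%C / (2 * pi%:C * 'i%C) ^+ 2 / n`!%:R * L).
  move: (residue_coef k) ((-1) ^ _) (rho%:C ^ _) L (pi%:C) => *; ring.
rewrite residue_coefE /gauge.
(* The sign from $t_2=n+1$ cancels that of [residue_coef]; the factor $1/2$ of [line_fun] is
   $2\pi\mathrm i\cdot\pi\cdot\mathrm i/(2\pi\mathrm i)^2$. *)
have -> : (-1) ^ (x2 - t2%:Z) = - ((-1) ^ x2 * (-1) ^+ n) :> C.
  rewrite expfzDr ?oppr_eq0 ?oner_eq0// -invr_expz signC t2n -exprnP exprS; ring.
have -> : (2 * pi)%:C = 2 * pi%:C :> C by rewrite rmorphM rmorph_nat.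
have i0 : 'i%C != 0 :> C by rewrite eq_complex /= oner_eq0 andbF.
have r0 : rho%:C ^ x2 != 0 :> C by rewrite expfz_neq0.
have -> : (1 - beta)%:C = 1 - beta%:C :> C by rewrite rmorphB.
have -> : rho%:C ^ (- x2) = (rho%:C ^ x2)^-1 by rewrite invr_expz.
have inv3 (u v q : C) : u^-1 = u -> (u * v / q)^-1 = u * v^-1 * q by move=> uV; rewrite !invfM uV invrK.
rewrite (inv3 _ _ _ (signC x2)).
move: L (walk_prob _ _ _ _) pi%:C pi0 'i%C i0 ((-1) ^ x1) ((-1) ^ x2) ((-1) ^+ n) (rho%:C ^ x1) (rho%:C ^ x2) r0
  ((1 - beta%:C) ^+ t2) b1n (_ ^- t1) (n`!%:R) f0.
move=> L' W p p0 I I0 e1 e2 e3 r1 r2 r20 q q0 q' f f0'.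
by field; rewrite I0 p0 r20 q0 f0'.
Qed.

End Contour.

End Kernel.

(** * Identification of the probability with the kernel determinant *)

Lemma det_diag_conj (F : fieldType) k (u : 'I_k -> F) (K : 'I_k -> 'I_k -> F) :
  (forall i, u i != 0) ->
  \det (\matrix_(i < k, j < k) (u i / u j * K i j)) = \det (\matrix_(i < k, j < k) K i j).
Proof.
move=> u0; pose D (v : 'I_k -> F) := diag_mx (\row_i v i).
have -> : \matrix_(i < k, j < k) (u i / u j * K i j) =
    D u *m (\matrix_(i < k, j < k) K i j) *m D (fun i => (u i)^-1).
  apply/matrixP => i j; rewrite mul_mx_diag mul_diag_mx !mxE; ring.
rewrite !det_mulmx mulrAC !det_diag -big_split /= big1 ?mul1r// => i _.
by rewrite !mxE divff.
Qed.

Theorem theorem2p1 (R : realType) (d : measure_display) (T : measurableType d)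
    (P : probability T R) (N : nat) (beta : R) (a : weyl N)
    (X : nat -> T -> weyl N)
    (gamma : nat -> int -> nat -> int -> circles R)
    (k : nat) (t : 'I_k -> nat) (y : 'I_k -> int) :
  (0 < N)%N ->
  0 < beta < 1 ->
  noncolliding_bernoulli_walk P beta a X ->
  (forall (t1 : nat) (x1 : int) (t2 : nat) (x2 : int),
     (0 < t1)%N -> (0 < t2)%N ->
     admissible_wcontour a t1 x1 t2 x2 (gamma t1 x1 t2 x2)) ->
  (0 < k)%N ->
  (forall i, (0 < t i)%N) ->
  injective (fun i => (t i, y i)) ->
  (fine (P [set w | forall i, occupies (X (t i) w) (y i)]))%:C =
  \det (\matrix_(i < k, j < k)
          bernoulli_kernel a beta (gamma (t i) (y i) (t j) (y j))
            (t i) (y i) (t j) (y j)).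
Proof.
move=> N0 beta01 [mc P1] adm _ t0 tyI.
pose Phi (h : nat -> weyl N) := [forall z, hit t y h z].
have -> : [set w | forall i, occupies (X (t i) w) (y i)] = [set w | Phi (X ^~ w)].
  apply/seteqP; split => w /= hw.
    by apply/forallP => z; apply/existsP; have [i hi] := hw z; exists i; apply/eqP.
  by move=> z; move/forallP: hw => /(_ z) /existsP[i /eqP hi]; exists i.
have mX s (A : set (weyl N)) : measurable [set w | A (X s w)] by exact: mc.1.
have p1 (x : weyl N) : \sum_(x' <- next_states x) bernoulli_step beta x x' = 1.
  rewrite -(step_weight_sum1 beta x) big_seq [RHS]big_seq; apply: eq_bigr => x'.
  exact: bernoulli_step_weight.
(* The last observation time is the horizon of the path sum; the event depends on the path only up
   to it. *)
have tT z : (t z <= \max_i t i)%N by exact: leq_bigmax.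
have Philoc g g' : (forall u, (u <= \max_i t i)%N -> g u = g' u) -> Phi g = Phi g'.
  by move=> gg; apply: eq_forallb => z; apply: eq_existsb => i; rewrite gg.
have mPhi : measurable [set w | Phi (X ^~ w)].
  have -> : [set w | Phi (X ^~ w)] = \bigcap_(z in [set: 'I_k]) [set w | hit t y (X ^~ w) z].
    by apply/seteqP; split => w /= => [/forallP h z _|h]; [exact: h|apply/forallP => z; exact: h].
  apply: fin_bigcap_measurable => [|z _]; first exact: finite_finset.
  exact: (mX (t z) [set x | [exists i, x i == y z]]).
rewrite (prob_start_path_sum mc p1 P1 Philoc mPhi).
rewrite (@path_sum_cast _ _ _ (step_weight beta%:C)); last first.
  move=> x x' x'x; rewrite bernoulli_step_weight// /step_weight rmorphM fmorph_div !rmorph_int (rmorph_prod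
      (real_complex R)).
  congr (_ * _); apply: eq_bigr => i _; rewrite /jump; case: ifP => // _.
  by rewrite rmorphB.
transitivity (path_sum (step_weight beta%:C) (\max_i t i) 0 (fun=> a) (fun h => \prod_z (hit t y h z)%:R : R[i])).
  apply: eq_path_sum => h; rewrite rmorph_nat /Phi; case: forallP => hh.
    by rewrite big1// => z _; rewrite hh.
  have [z /negbTE hz] : exists z, ~~ hit t y h z.
    have [/existsP//|/existsPn hn] := boolP [exists z, ~~ hit t y h z].
    by case: hh => z; have := hn z; rewrite negbK.
  by rewrite (bigD1 z)//= hz mul0r.
rewrite (path_sum_hits _ _ N0 t0 tT tyI).
(* The gauge depends on one space-time point at a time, so it acts as conjugation by a diagonal
   matrix. *)
rewrite -(@det_diag_conj _ _ (fun i => gauge beta (t i) (y i))); last by move=> i; exact: gauge_neq0.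
congr (\det _); apply/matrixP => i j; rewrite !mxE.
by rewrite (bernoulli_kernelE N0 beta01 (adm _ _ _ _ (t0 i) (t0 j)) (t0 j)).
Qed.
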